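(* Assume in addition $\mathbb E X_0^3<\infty$ and $\mathbb E\varepsilon_1^3<\infty$. Then $\sqrt n(\tilde\alpha_n-\alpha)\to\mathcal N(0,\sigma_{\alpha,\varepsilon}^2)$ in distribution. Moreover, conditionally on the values $(Y_{s_1-1},Y_{s_2-1},Y_{s_1+1},Y_{s_2+1})$, $$\begin{bmatrix}\sqrt n(\tilde\theta_{1,n}-L_1)\\ \sqrt n(\tilde\theta_{2,n}-L_2)\end{bmatrix}\to\mathcal N\Big(\begin{bmatrix}0\\0\end{bmatrix},\sigma_{\alpha,\varepsilon}^2\,e_{\alpha,\varepsilon}e_{\alpha,\varepsilon}^\top\Big),$$ where $L_i=Y_{s_i}-\frac{\alpha}{1+\alpha^2}(Y_{s_i-1}+Y_{s_i+1})-\frac{1-\alpha}{1+\alpha^2}\mu_\varepsilon$ and $$e_{\alpha,\varepsilon}=\frac{1}{(1+\alpha^2)^2}\begin{bmatrix}(\alpha^2-1)(Y_{s_1-1}+Y_{s_1+1})+(1+2\alpha-\alpha^2)\mu_\varepsilon\\(\alpha^2-1)(Y_{s_2-1}+Y_{s_2+1})+(1+2\alpha-\alpha^2)\mu_\varepsilon\end{bmatrix}.$$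
   Context: INAR(1) process: Let $\alpha\in(0,1)$. Let $(\varepsilon_k)_{k\in\mathbb N}$ be i.i.d. non-negative integer-valued random variables with $\mathbb E\varepsilon_1^2<\infty$ and $\mathbb P(\varepsilon_1\ne 0)>0$; write $\mu_\varepsilon=\mathbb E\varepsilon_1$ (assumed known), $\sigma_\varepsilon^2=\operatorname{Var}\varepsilon_1$. For each $k\in\mathbb N$ let $(\xi_{k,j})_{j\in\mathbb N}$ be i.i.d. Bernoulli random variables with mean $\alpha$, these sequences being mutually independent and independent of $(\varepsilon_k)$. Let $X_0$ be a non-negative integer-valued random variable with $\mathbb E X_0^2<\infty$, independent of all $\xi_{k,j}$ and $\varepsilon_k$, and set $X_k=\sum_{j=1}^{X_{k-1}}\xi_{k,j}+\varepsilon_k$ for $k\in\mathbb N$. This Markov chain has a unique stationary distribution; $\tilde X$ denotes a random variable with it, and $\sigma_{\alpha,\varepsilon}^2=\frac{\alpha(1-\alpha)\mathbb E\tilde X^3+\sigma_\varepsilon^2\mathbb E\tilde X^2}{(\mathbb E\tilde X^2)^2}$. Two non-neighbouring additive outliers: fix known $s_1,s_2\in\mathbb N$ with $s_1<s_2-1$ and $\theta_1,\theta_2\in\mathbb N$; $Y_k=X_k+\delta_{k,s_1}\theta_1+\delta_{k,s_2}\theta_2$; $\mathbf Y_n=(Y_0,\dots,Y_n)$. For $n\ge s_2+1$, $$Q_n(\mathbf y_n;\alpha',\theta_1',\theta_2')=\sum_{\substack{k=1\\k\notin\{s_1,s_1+1,s_2,s_2+1\}}}^n(y_k-\alpha'y_{k-1}-\mu_\varepsilon)^2+\sum_{i=1}^2\Big[(y_{s_i}-\alpha'y_{s_i-1}-\mu_\varepsilon-\theta_i')^2+(y_{s_i+1}-\alpha'y_{s_i}-\mu_\varepsilon+\alpha'\theta_i')^2\Big],$$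 and $(\tilde\alpha_n,\tilde\theta_{1,n},\tilde\theta_{2,n})$ is the unique global minimizer over $\mathbb R^3$ of $Q_n(\mathbf Y_n;\cdot)$ when it exists uniquely, and $(0,0,0)$ otherwise. Conditional convergence: for random vectors $\zeta_n$ and a random vector $\eta$ with values in $\mathbb Z_+^d$, ''conditionally on the values $\eta$, $\zeta_n\to\mathcal N(0,\Sigma(\eta))$'' means: for every $m$ with $\mathbb P(\eta=m)>0$, the conditional distribution of $\zeta_n$ given $\{\eta=m\}$ converges weakly to $\mathcal N(0,\Sigma(m))$. *)

(* Defs.v *)
From HB Require Import structures.
From mathcomp Require Import all_boot all_order all_algebra.
From mathcomp Require Import all_classical all_reals all_analysis.
Set Implicit Arguments. Unset Strict Implicit. Unset Printing Implicit Defensive.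
Import Order.TTheory GRing.Theory Num.Theory.
Import numFieldNormedType.Exports.
Local Open Scope classical_set_scope.
Local Open Scope ring_scope.

Section INAR_defs.
Context {R : realType} {d : measure_display} {T : measurableType d}.
Variable P : probability T R.

Definition mutually_independent (I : eqType) (X : I -> T -> nat) : Prop :=
  forall (s : seq I) (B : I -> set nat), uniq s ->
    P (\bigcap_(i in [set i | i \in s]) (X i @^-1` B i)) =
    (\prod_(i <- s) P (X i @^-1` B i))%E.

Definition Exp (f : T -> R) : \bar R := (\int[P]_w (f w)%:E)%E.

Definition cond_exp (A : set T) (f : T -> R) : R :=
  Rintegral P A f / fine (P A).
End INAR_defs.

Definition inar_family {T : Type} (X0 : T -> nat) (eps : nat -> T -> nat)
  (xi : nat -> nat -> T -> nat) (i : option (nat + (nat * nat))) : T -> nat :=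
  match i with
  | None => X0
  | Some (inl k) => eps k
  | Some (inr kj) => xi kj.1 kj.2
  end.

(* INAR(1) recursion, with the shift convention
   eps k = epsilon_{k+1},  xi k j = xi_{k+1, j+1}:
   X_{k+1} = sum_{j=1}^{X_k} xi_{k+1,j} + eps_{k+1}. *)
Fixpoint inar {T : Type} (X0 : T -> nat) (eps : nat -> T -> nat)
  (xi : nat -> nat -> T -> nat) (k : nat) (w : T) : nat :=
  match k with
  | 0 => X0 w
  | k'.+1 => (\sum_(j < inar X0 eps xi k' w) xi k' j w + eps k' w)%N
  end.

Definition Yobs {T : Type} (X : nat -> T -> nat) (s1 s2 th1 th2 : nat)
  (k : nat) (w : T) : nat :=
  (X k w + (k == s1) * th1 + (k == s2) * th2)%N.

Section estimator.
Context {R : realType}.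

Definition Qn (mu : R) (s1 s2 n : nat) (y : nat -> R) (a t1 t2 : R) : R :=
  \sum_(1 <= k < n.+1 | k \notin [:: s1; s1.+1; s2; s2.+1])
      (y k - a * y k.-1 - mu) ^+ 2
  + ((y s1 - a * y s1.-1 - mu - t1) ^+ 2 + (y s1.+1 - a * y s1 - mu + a * t1) ^+ 2)
  + ((y s2 - a * y s2.-1 - mu - t2) ^+ 2 + (y s2.+1 - a * y s2 - mu + a * t2) ^+ 2).

Definition is_global_min (F : R * R * R -> R) (v : R * R * R) : Prop :=
  forall w, F v <= F w.

(* (alpha~_n, theta~_{1,n}, theta~_{2,n}) : the unique global minimiser of
   Q_n(y; .) over R^3 if it exists uniquely, (0,0,0) otherwise. *)
Definition CLS (mu : R) (s1 s2 n : nat) (y : nat -> R) : R * R * R :=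
  let F := fun v : R * R * R => Qn mu s1 s2 n y v.1.1 v.1.2 v.2 in
  xget (0, 0, 0)
    [set v | is_global_min F v /\ forall w, is_global_min F w -> w = v].

(* Transition kernel of the INAR(1) chain:
   K(n,m) = P(Bin(n,alpha) + eps = m), with peps k = P(eps = k). *)
Definition inar_kernel (alpha : R) (peps : nat -> R) (n m : nat) : R :=
  \sum_(i < (minn n m).+1)
     'C(n, i)%:R * alpha ^+ i * (1 - alpha) ^+ (n - i) * peps (m - i)%N.

Definition is_stationary (alpha : R) (peps : nat -> R) (pi : nat -> R) : Prop :=
  (forall n, 0 <= pi n) /\
  (\sum_(n <oo) (pi n)%:E = 1)%E /\
  (forall m, (pi m)%:E = \sum_(n <oo) (pi n * inar_kernel alpha peps n m)%:E)%E.

Definition moment (pi : nat -> R) (k : nat) : R :=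
  fine (\sum_(n <oo) ((n%:R) ^+ k * pi n)%:E)%E.

Definition sigma2_ae (alpha sig2eps : R) (pi : nat -> R) : R :=
  (alpha * (1 - alpha) * moment pi 3 + sig2eps * moment pi 2) / (moment pi 2) ^+ 2.

(* E f(Z) for Z ~ N(0, s2) represented as sqrt(s2) * N(0,1). *)
Definition normal_expect (s2 : R) (f : R -> R) : R :=
  Rintegral (normal_prob 0 1) setT (fun z => f (Num.sqrt s2 * z)).

(* E f(W) for W ~ N(0, s2 * e e^T) (rank-one covariance), represented as
   sqrt(s2) * Z * e with Z ~ N(0,1). *)
Definition normal_rank1_expect (s2 : R) (e : R * R) (f : R * R -> R) : R :=
  Rintegral (normal_prob 0 1) setT
    (fun z => f (Num.sqrt s2 * z * e.1, Num.sqrt s2 * z * e.2)).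

Definition bounded_fun {U : Type} (f : U -> R) : Prop :=
  exists M : R, forall x, `|f x| <= M.
End estimator.

Section convergence.
Context {R : realType} {d : measure_display} {T : measurableType d}.
Variable P : probability T R.

Definition cvg_dist_normal (zeta : nat -> T -> R) (s2 : R) : Prop :=
  forall f : R -> R, continuous f -> bounded_fun f ->
    (fun n => Rintegral P setT (fun w => f (zeta n w))) @ \oo
      --> normal_expect s2 f.

Definition cond_cvg_dist_normal_rank1 {M : Type} (zeta : nat -> T -> R * R)
  (eta : T -> M) (s2 : R) (e : M -> R * R) : Prop :=
  forall m : M, (0 < P (eta @^-1` [set m]))%E ->
  forall f : R * R -> R, continuous f -> bounded_fun f ->
    (fun n => cond_exp P (eta @^-1` [set m]) (fun w => f (zeta n w))) @ \oo
      --> normal_rank1_expect s2 (e m) f.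
End convergence.

(* Main.v *)
(** For fixed [a] the objective is quadratic in each outlier size; eliminating them
leaves the profile [A a^2 - 2 b a + c + (p + q a) / (1 + a^2)], where only [A] and [b]
grow with [n].  Once [A] dominates [|p| + |q|] the profile has a unique minimiser, within
[O(1/A)] of [b / A].  Hence [sqrt n (alpha_n - alpha)] differs by [o(1)] in probability
from [W_n = S_n / (sqrt n m2)], where [m2] is the stationary second moment and [S_n] the
martingale with increments [X_k (X_{k+1} - alpha X_k - mu)]; the optimal outlier sizes are
rational functions of the minimiser, so their errors are [W_n e] up to [o(1)].

The conditional variance of the increments is a cubic polynomial in [X_k].  Subtracting its
stationary mean [v] leaves [g - K g] for a cubic [g] ([K] the transition operator), so the
corrected transforms [E a cos(t S_k + phi) (1 - t^2 g(X_k) / 2)], [t = th / sqrt n], satisfy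
a recursion with factor [1 - t^2 v / 2] up to [o(1/n)]; the Lindeberg-type error terms use
uniform integrability of [X_k^3], which follows from the contraction of tails under
binomial thinning.  This holds for every bounded weight [a] that depends on finitely many
[X_k], in particular for the indicator of the conditioning event, so the limit is the same
conditionally.  Bernstein approximation in [(1 + sin (t x)) / 2] passes from cosines to
bounded continuous test functions. *)

Require Import Defs.
From HB Require Import structures.
From mathcomp Require Import all_boot all_order all_algebra.
From mathcomp Require Import all_classical all_reals all_analysis.
From mathcomp Require Import measurable_realfun.
From mathcomp Require Import ring lra zify.
Set Implicit Arguments. Unset Strict Implicit. Unset Printing Implicit Defensive.
Import Order.TTheory GRing.Theory Num.Theory.
Import numFieldNormedType.Exports.
Local Open Scope classical_set_scope.
Local Open Scope ring_scope.

(** The chain has third moments and no more, and this shapes every estimate. The squared increment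
    has a cubic conditional mean, so it is only just integrable: Taylor remainders must keep the
    cut-off form [min (u ^+ 2) (|u| ^+ 3)]. The conditional variances are themselves cubic in [X_k];
    the correction by [g] cancels their fluctuations inside the expectation instead of averaging
    them along the path. Only [X_k ^+ 2] is averaged along the path, and the martingale differences
    of its Poisson decomposition have moments of order [3/2], which is why [sqrt (1 + s^2)] replaces
    the square in that estimate. Cosines with a free phase [phi] stand for characteristic functions:
    shifting the phase gives the sine, and the family is stable under multiplication by sines. The
    weight looks ahead to time [s2 + 1], so the recursion starts there; the contribution of the
    earlier increments disappears because [t] tends to [0]. That the limit factorises into the mean
    of the weight and a Gaussian term is exactly what conditioning requires. *)

(** * Discrete random variables and decompositions over their fibres *)

Section discrete.
Context {R : realType} {d : measure_display} {T : measurableType d}.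
Variable P : probability T R.
Local Open Scope ereal_scope.

(** Measurability is asked of singletons only, since the targets (lists of states, pairs) are bare
    countable types; countability extends it to all sets. *)
Definition discrete_rv (U : countType) (Z : T -> U) :=
  forall u, measurable (Z @^-1` [set u]).

Lemma discrete_rv_set (U : countType) (Z : T -> U) (A : set U) :
  discrete_rv Z -> measurable (Z @^-1` A).
Proof.
move=> mZ.
have -> : Z @^-1` A = \bigcup_n
    (if unpickle n is Some u then if `[<A u>] then Z @^-1` [set u] else set0
     else set0).
  apply/seteqP; split => [w Aw|w [n _]].
    by exists (pickle (Z w)) => //=; rewrite pickleK; case: asboolP.
  by case: (unpickle n) => // u; case: asboolP => // Au /=; move: Au => /[swap] <-.
apply: bigcupT_measurable => n; case: (unpickle n) => // u.
by case: ifP.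
Qed.

Lemma discrete_rv_comp (U V : countType) (Z : T -> U) (h : U -> V) :
  discrete_rv Z -> discrete_rv (h \o Z).
Proof. by move=> mZ v; rewrite comp_preimage; exact: discrete_rv_set. Qed.

Lemma discrete_rv_pair (U V : countType) (Z : T -> U) (W : T -> V) :
  discrete_rv Z -> discrete_rv W -> discrete_rv (fun w => (Z w, W w)).
Proof.
move=> mZ mW [u v].
rewrite (_ : _ @^-1` _ = Z @^-1` [set u] `&` W @^-1` [set v]); last first.
  by apply/seteqP; split => w /= [] => [<- <-|<- <-].
exact: measurableI.
Qed.

Lemma discrete_rv_map (I : Type) (U : countType) (Z : I -> T -> U) (s : seq I) :
  (forall i, discrete_rv (Z i)) -> discrete_rv (fun w => [seq Z i w | i <- s]).
Proof.
move=> mZ; elim: s => [|i s ih] /=.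
  by move=> u; have [->|u0] := eqVneq u [::];
    [rewrite (_ : _ @^-1` _ = setT) | rewrite (_ : _ @^-1` _ = set0)];
    rewrite ?predeqE => // w; split => //= /esym /eqP; rewrite (negbTE u0).
exact: (discrete_rv_comp (fun x => x.1 :: x.2) (discrete_rv_pair (mZ i) ih)).
Qed.

Lemma discrete_rv_measurable (U : countType) (Z : T -> U) d' (V : measurableType d')
  (f : U -> V) : discrete_rv Z -> measurable_fun setT (f \o Z).
Proof.
by move=> mZ _ B _; rewrite setTI comp_preimage; exact: discrete_rv_set.
Qed.

(** Fibres are indexed by the codes [pickle u], so that sums over a countable type become series
    over [nat]; a code of no value has an empty fibre. *)
Lemma discrete_fibers (U : countType) (Z : T -> U) (D : set T) :
  D = \bigcup_n (D `&` (pickle \o Z) @^-1` [set n]).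
Proof. by apply/seteqP; split => [w Dw|w [n _ []//]]; exists (pickle (Z w)). Qed.

Lemma discrete_fibers_trivIset (U : countType) (Z : T -> U) (D : set T) :
  trivIset setT (fun n => D `&` (pickle \o Z) @^-1` [set n]).
Proof. by apply/trivIsetP => i j _ _ /eqP ij; rewrite -subset0 => w [[_ /= wi] [_ /= wj]]; apply: ij; rewrite -wi -wj. Qed.

Lemma ge0_integral_fibers (U : countType) (Z : T -> U) (D : set T)
    (f : T -> \bar R) : discrete_rv Z -> measurable D ->
  measurable_fun D f -> (forall w, D w -> 0 <= f w) ->
  \int[P]_(w in D) f w =
  \sum_(n <oo) \int[P]_(w in D `&` (pickle \o Z) @^-1` [set n]) f w.
Proof.
move=> mZ mD mf f0; rewrite {1}(discrete_fibers Z D) ge0_integral_bigcup//.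
- move=> k; apply: measurableI => //; exact: (discrete_rv_comp pickle mZ).
- by rewrite -(discrete_fibers Z D).
- by move=> w; rewrite -(discrete_fibers Z D); exact: f0.
- exact: discrete_fibers_trivIset.
Qed.

Lemma measure_fibers (U : countType) (Z : T -> U) (D : set T) :
  discrete_rv Z -> measurable D ->
  P D = \sum_(n <oo) P (D `&` (pickle \o Z) @^-1` [set n]).
Proof.
move=> mZ mD; rewrite {1}(discrete_fibers Z D) measure_bigcup//.
- by apply: eq_eseriesl => n; rewrite ?in_setT.
- move=> k _; apply: measurableI => //; exact: (discrete_rv_comp pickle mZ).
- exact: discrete_fibers_trivIset.
Qed.

Lemma nat_rv_discrete (Z : T -> nat) : measurable_fun setT Z -> discrete_rv Z.
Proof. by move=> mZ u; rewrite -[_ @^-1` _]setTI; exact: mZ. Qed.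

Lemma ge0_integral_nat_rv (Z : T -> nat) (D : set T) (f : nat -> R) :
  discrete_rv Z -> measurable D -> (forall n, 0 <= f n)%R ->
  \int[P]_(w in D) (f (Z w))%:E = \sum_(n <oo) (f n)%:E * P (D `&` Z @^-1` [set n]).
Proof.
move=> mZ mD f0; rewrite (ge0_integral_fibers mZ)//; last 2 first.
- by apply: measurable_funTS; exact: (discrete_rv_measurable (EFin \o f) mZ).
- by move=> w _; rewrite lee_fin.
apply: eq_eseriesr => n _.
have mD' : measurable (D `&` Z @^-1` [set n]) by exact: measurableI.
by rewrite -integral_cst//; apply: eq_integral => w; rewrite inE => -[_ /= <-].
Qed.

End discrete.

(** * Events determined by finitely many independent variables *)

Section independence.
Context {R : realType} {d : measure_display} {T : measurableType d}.
Variable P : probability T R.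
Variables (I : eqType) (Z : I -> T -> nat).
Hypothesis mZ : forall i, discrete_rv (Z i).
Hypothesis indep : mutually_independent P Z.
Local Open Scope ereal_scope.

(** Pointwise counterpart of membership in the sigma-algebra generated by the variables listed in
    [s]: the event is a union of cylinders over [s]. *)
Definition determined (s : seq I) (E : set T) :=
  forall w w', {in s, forall i, Z i w = Z i w'} -> E w -> E w'.

Lemma determined_sub s s' E : {subset s <= s'} -> determined s E -> determined s' E.
Proof. by move=> ss' dE w w' ww'; apply: dE => i /ss'; exact: ww'. Qed.

Lemma determinedI s E F : determined s E -> determined s F -> determined s (E `&` F).
Proof.
by move=> dE dF w w' ww' [Ew Fw]; split; [exact: (dE w)|exact: (dF w)].
Qed.

Lemma determined_measurable s E : determined s E -> measurable E.
Proof.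
move=> dE; pose V w := [seq Z i w | i <- s].
have -> : E = V @^-1` (V @` E).
  apply/seteqP; split => [w Ew|w' [w Ew Vw]]; first by exists w.
  apply: (dE w w' _ Ew) => i; move/eq_in_map: Vw; exact.
by apply: discrete_rv_set; exact: discrete_rv_map.
Qed.

(** Decompose [E] along the values of the finite vector [V]. A non-empty piece is a full cylinder
    because [E] is determined by [s], so the product formula applies to it with and without the
    extra variable [Z i]; the common factor then leaves the series. *)
Lemma determined_indep s E i (B : set nat) : determined s E -> i \notin s ->
  P (E `&` Z i @^-1` B) = P E * P (Z i @^-1` B).
Proof.
move=> dE0 si0.
(* Mutual independence is stated for lists without repetition. *)
have : determined (undup s) E by apply: determined_sub dE0 => j; rewrite mem_undup.
have : i \notin undup s by rewrite mem_undup.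
have := undup_uniq s; move: (undup s) => {dE0 si0 s} s us si dE.
have mE := determined_measurable dE.
pose V w := [seq Z j w | j <- s].
have mV : discrete_rv V by exact: discrete_rv_map.
have mB : measurable (Z i @^-1` B) by exact: discrete_rv_set.
rewrite (measure_fibers P mV mE) (measure_fibers P mV (measurableI _ _ mE mB)).
rewrite muleC -(fineK (fin_num_measure P _ mB)) -nneseriesZl//.
apply: eq_eseriesr => n _; rewrite fineK ?fin_num_measure// muleC setIAC.
have [->|/set0P[w0 [Ew0 Vw0]]] := eqVneq (E `&` (pickle \o V) @^-1` [set n]) set0.
  by rewrite set0I !measure0 mul0e.
have -> : E `&` (pickle \o V) @^-1` [set n] =
    \bigcap_(j in [set j | j \in s]) (Z j @^-1` [set Z j w0]).
  apply/seteqP; split => w.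
    move=> [Ew /= Vw] j /= js; move: Vw; rewrite -Vw0 => /(pcan_inj pickleK).
    by move=> /eq_in_map; exact.
  move=> h; split; first by apply: (dE w0 w _ Ew0) => j js; exact/esym/(h j js).
  by rewrite /= -Vw0 /=; congr pickle; apply/eq_in_map => j /h.
pose A j := if j == i then B else [set Z j w0].
have Aj j : j \in s -> A j = [set Z j w0].
  by rewrite /A; case: eqVneq => // -> /(negP si).
have := indep A us; have /= := @indep (i :: s) A.
rewrite si us => /(_ isT); rewrite big_cons {2}/A eqxx.
rewrite [in X in _ -> X -> _](_ : \bigcap_(_ in _) _ =
  \bigcap_(j in [set j | j \in s]) (Z j @^-1` [set Z j w0])); last first.
  by apply: eq_bigcapr => j js; rewrite Aj.
move=> h1 ->; rewrite muleC -h1; congr (P _).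
apply/seteqP; split => [w [h wB] j|w h].
  rewrite /= inE; case: eqVneq => [->|_] /=; first by rewrite /A eqxx.
  by move=> js; rewrite Aj//; exact: h.
split; last by have := h i; rewrite /= inE eqxx /A eqxx; exact.
by move=> j /= js; have := h j; rewrite /= inE js orbT Aj//; exact.
Qed.

End independence.

(** * Assumptions on the chain, its transition kernel and the kernel's action on functions *)

Record inar_model (R : realType) (d : measure_display) (T : measurableType d)
    (P : probability T R) (alpha : R) (X0 : T -> nat) (eps : nat -> T -> nat)
    (xi : nat -> nat -> T -> nat) (mu sig2 : R) : Prop := InarModel {
  inar_alpha : 0 < alpha < 1;
  inar_mX0 : measurable_fun setT X0;
  inar_meps : forall k, measurable_fun setT (eps k);
  inar_mxi : forall k j, measurable_fun setT (xi k j);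
  inar_indep : mutually_independent P (inar_family X0 eps xi);
  inar_eps_law : forall k (B : set nat), P (eps k @^-1` B) = P (eps 0%N @^-1` B);
  inar_bernoulli : forall k j, P (xi k j @^-1` [set 1%N]) = alpha%:E /\
    P (xi k j @^-1` [set 0%N]) = (1 - alpha)%:E;
  inar_eps3 : (Exp P (fun w => ((eps 0%N w)%:R ^+ 3)%R) < +oo)%E;
  inar_eps_neq0 : (0 < P (eps 0%N @^-1` [set n | n != 0%N]))%E;
  inar_eps_mean : Exp P (fun w => (eps 0%N w)%:R) = mu%:E;
  inar_eps_var : Exp P (fun w => ((eps 0%N w)%:R - mu) ^+ 2) = sig2%:E;
  inar_X03 : (Exp P (fun w => ((X0 w)%:R ^+ 3)%R) < +oo)%E }.

(** Binomial coefficients vanish beyond [n], so the range of summation can be made independent of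
    [n], as a recursion in [n] requires. *)
Lemma inar_kernel_mkord (R : realType) (a : R) (p : nat -> R) n m :
  inar_kernel a p n m =
  \sum_(i < m.+1) 'C(n, i)%:R * a ^+ i * (1 - a) ^+ (n - i) * p (m - i)%N.
Proof.
rewrite /inar_kernel -!(big_mkord xpredT (fun i => 'C(n, i)%:R * a ^+ i *
  (1 - a) ^+ (n - i) * p (m - i)%N)).
rewrite [RHS](big_cat_nat (n := (minn n m).+1))//= ?ltnS ?geq_minr//.
rewrite [X in _ = _ + X]big_nat_cond [X in _ = _ + X]big1 ?addr0// => i.
rewrite andbT => /andP[+ im]; rewrite gtn_min => /orP[ni|].
  by rewrite bin_small// !mul0r.
by rewrite ltnNge -ltnS im.
Qed.

Lemma inar_kernel0 (R : realType) (a : R) (p : nat -> R) m :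
  inar_kernel a p 0 m = p m.
Proof. by rewrite /inar_kernel min0n big_ord1 bin0 !expr0 subn0 !mul1r. Qed.

(* Pascal's rule: thinning [n.+1] individuals is thinning [n] and deciding on
   the last one separately. *)
Lemma inar_kernelS (R : realType) (a : R) (p : nat -> R) n m :
  inar_kernel a p n.+1 m = (1 - a) * inar_kernel a p n m +
    a * (if m is m'.+1 then inar_kernel a p n m' else 0).
Proof.
rewrite !inar_kernel_mkord.
(* For [i > n] truncated subtraction breaks the power rule, but both sides vanish with the binomial
   coefficient. *)
have expS i : 'C(n, i)%:R * (1 - a) ^+ (n.+1 - i) =
    (1 - a) * ('C(n, i)%:R * (1 - a) ^+ (n - i)) :> R.
  have [ni|ni] := ltnP n i; first by rewrite bin_small// !mul0r mulr0.
  by rewrite subSn// exprS mulrCA.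
rewrite big_ord_recl /= bin0 expr0 subn0 [in RHS]big_ord_recl /= bin0 expr0 subn0.
rewrite mulrDr -addrA subn0; congr (_ + _).
  by rewrite exprS; ring.
case: m => [|m]; first by rewrite !big_ord0 !mulr0 addr0.
rewrite inar_kernel_mkord !mulr_sumr -big_split /=; apply: eq_bigr => i _.
rewrite /bump /= add1n binS natrD subSS mulrDl mulrDl mulrDl; congr (_ + _).
  have := expS i.+1; rewrite subSS => e.
  rewrite -!mulrA (mulrCA (a ^+ _)) subSS.
  by rewrite [LHS]mulrA e -!mulrA (mulrCA (a ^+ _)).
by rewrite subSS exprS; ring.
Qed.

(** The transition operator with extended values, meaningful for every non-negative [f] before
    anything is known about integrability. *)
Definition Kop (R : realType) (a : R) (p : nat -> R) (f : nat -> R) (x : nat) : \bar R :=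
  (\sum_(y <oo) (f y * inar_kernel a p x y)%:E)%E.

Section kop.
Context {R : realType}.
Variables (a : R) (p : nat -> R).
Hypotheses (a01 : 0 < a < 1) (p0 : forall n, 0 <= p n).

Lemma inar_kernel_ge0 n m : 0 <= inar_kernel a p n m.
Proof.
apply: sumr_ge0 => i _; have /andP[a0 a1] := a01.
by rewrite !mulr_ge0 ?exprn_ge0 ?subr_ge0// ltW.
Qed.

Lemma Kop_ge0 (f : nat -> R) x : (forall y, 0 <= f y) -> (0 <= Kop a p f x)%E.
Proof.
by move=> f0; apply: nneseries_ge0 => y _ _; rewrite lee_fin mulr_ge0// inar_kernel_ge0.
Qed.

(** Pascal's rule seen from the test function: the last individual either dies or shifts the
    argument by one. All moment formulas below come from this recursion in the starting point. *)
Lemma KopS (f : nat -> R) x : (forall y, 0 <= f y) ->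
  (Kop a p f x.+1 = (1 - a)%:E * Kop a p f x + a%:E * Kop a p (f \o succn) x)%E.
Proof.
have /andP[/ltW a0 /ltW a1] := a01; rewrite -subr_ge0 in a1.
move=> f0; rewrite /Kop -!nneseriesZl; first last.
- by move=> y _; rewrite lee_fin mulr_ge0 ?inar_kernel_ge0//; exact: f0.
- by move=> y _; rewrite lee_fin mulr_ge0 ?inar_kernel_ge0//; exact: f0.
rewrite (_ : (\sum_(y <oo) (a%:E * (_ * inar_kernel a p x y)%:E) =
  \sum_(y <oo) (a * (f y * (if y is z.+1 then inar_kernel a p x z else 0)))%:E)%E).
  rewrite -nneseriesD; first last.
  - by move=> y _ _; rewrite lee_fin !mulr_ge0//; case: y => // y; exact: inar_kernel_ge0.
  - by move=> y _ _; rewrite -EFinM lee_fin !mulr_ge0 ?inar_kernel_ge0.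
  apply: eq_eseriesr => y _; rewrite inar_kernelS -EFinM -EFinD; congr (_%:E).
  by ring.
rewrite [RHS]nneseries_recl//; last first.
  by move=> y _; rewrite lee_fin !mulr_ge0//; case: y => // y; exact: inar_kernel_ge0.
rewrite !mulr0 add0e -(@nneseries_addn _ _ 1%N)//; first last.
  by move=> y; rewrite lee_fin !mulr_ge0//; case: y => // y; exact: inar_kernel_ge0.
by apply: eq_eseriesr => y _; rewrite addn1 -EFinM.
Qed.

End kop.

(** * The Markov property of the chain *)

Section markov.
Context {R : realType} {d : measure_display} {T : measurableType d}.
Variables (P : probability T R) (alpha : R) (X0 : T -> nat) (eps : nat -> T -> nat).
Variables (xi : nat -> nat -> T -> nat) (mu sig2 : R).
Hypothesis H : inar_model P alpha X0 eps xi mu sig2.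

Definition eps_pmf n := fine (P (eps 0%N @^-1` [set n])).
Local Notation X := (inar X0 eps xi).
Local Notation Z := (inar_family X0 eps xi).
Local Notation ker := (inar_kernel alpha eps_pmf).

Definition path_to (k : nat) (w : T) := [seq X i w | i <- iota 0 k.+1].

(** A transition out of a frozen state [x], driven by the variables of time [k]; it coincides with
    [X k.+1] where [X k = x]. *)
Definition step k x (w : T) := (\sum_(j < x) xi k j w + eps k w)%N.

Lemma discrete_family i : discrete_rv (Z i).
Proof.
apply: nat_rv_discrete; case: i => [[k|[k j]]|] /=.
- exact: inar_meps H k.
- exact: inar_mxi H k j.
- exact: inar_mX0 H.
Qed.

Lemma eps_pmf_ge0 n : 0 <= eps_pmf n.
Proof. exact: fine_ge0. Qed.

Lemma discrete_step k x : discrete_rv (step k x).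
Proof.
have -> : step k x = (fun v => \sum_(j <- behead v) j + head 0 v)%N \o
    (fun w => [seq Z i w | i <- Some (inl k) :: [seq Some (inr (k, j)) | j <- iota 0 x]]).
  apply/funext => w /=; rewrite -map_comp big_map /step; congr addn.
  by rewrite -(big_mkord xpredT (fun j => xi k j w)) /index_iota subn0.
by apply: discrete_rv_comp; apply: discrete_rv_map; exact: discrete_family.
Qed.

Lemma discrete_inar k : discrete_rv (X k).
Proof.
elim: k => [|k ih]; first exact: nat_rv_discrete (inar_mX0 H).
move=> u; rewrite (_ : _ @^-1` _ = \bigcup_x (X k @^-1` [set x] `&` step k x @^-1` [set u])).
  apply: bigcupT_measurable => x; apply: measurableI; first exact: ih.
  exact: discrete_step.
apply/seteqP; split => w /=; first by move=> <-; exists (X k w).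
by case=> x _ [/= <- <-].
Qed.

Lemma discrete_path k : discrete_rv (path_to k).
Proof. by apply: discrete_rv_map => i; exact: discrete_inar. Qed.

(** The probabilities of the values [0] and [1] add up to one, so all other values of the
    natural-valued [xi k j] form a null event. *)
Lemma bernoulli_split k j (E : set T) : measurable E ->
  P E = (P (E `&` xi k j @^-1` [set 0%N]) + P (E `&` xi k j @^-1` [set 1%N]))%E.
Proof.
move=> mE; have [h1 h0] := inar_bernoulli H k j.
have mxi B : measurable (xi k j @^-1` B).
  by apply: discrete_rv_set; exact: (discrete_family (Some (inr (k, j)))).
have P01 : P (xi k j @^-1` [set 0%N; 1%N]) = 1%E.
  rewrite (_ : _ @^-1` _ = xi k j @^-1` [set 0%N] `|` xi k j @^-1` [set 1%N])//.
  rewrite measureU//; last by rewrite -subset0 => w [/= ->].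
  by apply: (etrans (congr2 (fun a b => a + b)%E h0 h1)); rewrite -EFinD subrK.
rewrite -measureU; [|exact: measurableI|exact: measurableI|]; last first.
  by rewrite -subset0 => w [[_ /= ->] []].
rewrite -setIUr; set F := _ `|` _.
have mF : measurable F by exact: measurableU.
rewrite [LHS](measureDI P mE mF) [X in (X + _)%E = _](_ : _ = 0%E) ?add0e//.
apply/eqP; rewrite -measure_le0; apply: le_trans (_ : P (~` F) <= _)%E.
  by apply: le_measure; rewrite ?inE; [exact: measurableD|exact: measurableC|move=> w []].
by rewrite probability_setC// (_ : F = xi k j @^-1` [set 0%N; 1%N])// P01 subee.
Qed.

(** The event has to stay general in the induction on [x]: fixing the value of the last thinning
    variable enlarges [E] to [F b], still determined by finitely many variables and still free of
    those the shorter step reads. Pascal's rule for the kernel recombines the two cases. *)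
Lemma step_indep k x (s : seq (option (nat + nat * nat))) E y :
  determined Z s E -> Some (inl k) \notin s ->
  (forall j, (j < x)%N -> Some (inr (k, j)) \notin s) ->
  P (E `&` step k x @^-1` [set y]) = (P E * (ker x y)%:E)%E.
Proof.
elim: x s E y => [|x ih] s E y dE sk sj.
  rewrite inar_kernel0 /eps_pmf fineK//.
    rewrite -(inar_eps_law H k) -(determined_indep discrete_family (inar_indep H) _ dE sk).
    by congr (P (_ `&` _)); apply/funext => w /=; rewrite /step big_ord0 add0n.
  by apply: fin_num_measure; exact: (discrete_family (Some (inl 0%N))).
have mE := determined_measurable discrete_family dE.
have [h1 h0] := inar_bernoulli H k x.
pose F b := E `&` xi k x @^-1` [set b].
have dF b : determined Z (Some (inr (k, x)) :: s) (F b).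
  apply: determinedI; first by apply: determined_sub dE => i; rewrite inE orbC => ->.
  by move=> w w' /(_ (Some (inr (k, x)))) /=; rewrite inE eqxx => /(_ isT) ->.
have ihF b z : P (F b `&` step k x @^-1` [set z]) = (P (F b) * (ker x z)%:E)%E.
  apply: (ih _ _ _ (dF b)); first by rewrite inE.
  move=> j jx; rewrite inE negb_or sj ?andbT//; last exact: ltnW.
  by apply/eqP => -[] e; rewrite e ltnn in jx.
have PF b : P (F b) = (P E * P (xi k x @^-1` [set b]))%E.
  exact: (determined_indep discrete_family (inar_indep H) _ dE (sj _ (ltnSn x))).
have mEs : measurable (E `&` step k x.+1 @^-1` [set y]).
  by apply: measurableI => //; exact: discrete_step.
rewrite (bernoulli_split k x mEs) ![_ `&` _ `&` xi k x @^-1` _]setIAC -/(F 0%N) -/(F 1%N).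
have -> : P (F 0%N `&` step k x.+1 @^-1` [set y]) = (P E * ((1 - alpha) * ker x y)%:E)%E.
  rewrite EFinM muleA -h0 -PF -ihF; congr (P _).
  by apply/seteqP; split => w [[Ew w0] /= <-]; split => //=;
    rewrite /step big_ord_recr /= w0 addn0.
have -> : P (F 1%N `&` step k x.+1 @^-1` [set y]) =
    (P E * (alpha * (if y is y'.+1 then ker x y' else 0))%:E)%E.
  case: y {mEs} => [|y].
    rewrite mulr0 mule0 (_ : _ `&` _ = set0) ?measure0//.
    by rewrite -subset0 => w [[_ w1]]; rewrite /= /step big_ord_recr /= w1 addn1.
  rewrite EFinM muleA -h1 -PF -ihF; congr (P _).
  apply/seteqP; split => w [[Ew w0] /=]; rewrite /step ?big_ord_recr /= w0 addn1.
    by rewrite addSn => -[<-].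
  by move=> <-; split.
have k0 n m : 0 <= ker n m by apply: inar_kernel_ge0; [exact: inar_alpha H|exact: eps_pmf_ge0].
have /andP[a0 a1] := inar_alpha H.
rewrite inar_kernelS EFinD ge0_muleDr// lee_fin mulr_ge0// ?subr_ge0 ?(ltW a0) ?(ltW a1)//.
by case: y {mEs}.
Qed.

(** The number of thinning variables read at time [i] is random, but on the event that the path
    equals [p] it is [nth 0 p i]. Hence each single path event is determined by a finite list, which
    contains nothing of time [k] or later. *)
Definition path_vars (p : seq nat) (k : nat) : seq (option (nat + nat * nat)) :=
  None :: flatten [seq Some (inl i) :: [seq Some (inr (i, j)) | j <- iota 0 (nth 0%N p i)]
                  | i <- iota 0 k].

Lemma path_to_nth k w i : (i <= k)%N -> nth 0%N (path_to k w) i = X i w.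
Proof.
by move=> ik; rewrite (nth_map 0%N) ?size_iota// nth_iota.
Qed.

Lemma path_toP k w (p : seq nat) : path_to k w = p <->
  size p = k.+1 /\ forall i, (i <= k)%N -> X i w = nth 0%N p i.
Proof.
split=> [<-|[sp h]].
  by split=> [|i ik]; rewrite ?size_map ?size_iota// path_to_nth.
apply: (@eq_from_nth _ 0%N); first by rewrite size_map size_iota sp.
by move=> i; rewrite size_map size_iota ltnS => ik; rewrite path_to_nth// h.
Qed.

Lemma path_determined k p :
  determined Z (path_vars p k) (path_to k @^-1` [set p]).
Proof.
move=> w w' ww' /path_toP [sp h]; apply/path_toP; split => // i.
have mem j x : (j < k)%N -> (x < nth 0%N p j)%N ->
    Some (inr (j, x)) \in path_vars p k.
  move=> jk xp; rewrite inE; apply/flattenP => /=.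
  exists (Some (inl j) :: [seq Some (inr (j, x)) | x <- iota 0 (nth 0%N p j)]).
    by apply/mapP; exists j => //; rewrite mem_iota.
  by rewrite inE; apply/mapP; exists x => //; rewrite mem_iota.
have meml j : (j < k)%N -> Some (inl j) \in path_vars p k.
  move=> jk; rewrite inE; apply/flattenP => /=.
  exists (Some (inl j) :: [seq Some (inr (j, x)) | x <- iota 0 (nth 0%N p j)]).
    by apply/mapP; exists j => //; rewrite mem_iota.
  by rewrite inE eqxx.
elim: i => [|i ih] ik.
  by rewrite -h//; apply/esym/(ww' None).
rewrite -(h _ ik) /= (h i (ltnW ik)) (ih (ltnW ik)); apply/esym.
congr addn; last exact: ww' (meml i ik).
by apply: eq_bigr => j _; exact: ww' (mem _ _ ik (ltn_ord j)).
Qed.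

Lemma path_vars_fresh p k : Some (inl k) \notin path_vars p k /\
  forall j, Some (inr (k, j)) \notin path_vars p k.
Proof.
split=> [|j]; rewrite inE /=; apply/flattenP => -[_ /mapP[i +] ->];
  rewrite mem_iota /= inE => /ltn_eqF ik.
  case/orP => [/eqP -[e]|/mapP[? _ //]].
  by rewrite e eqxx in ik.
by case/orP => [//|/mapP[? _ [e _]]]; rewrite e eqxx in ik.
Qed.

Lemma measurable_path k (f : seq nat -> nat -> R) :
  measurable_fun setT (fun w => (f (path_to k w) (X k.+1 w))%:E).
Proof.
apply: (@discrete_rv_measurable _ _ _ (fun w => (path_to k w, X k.+1 w)) _ _ (fun x => (f x.1 x.2)%:E)).
by apply: discrete_rv_pair; [exact: discrete_path|exact: discrete_inar].
Qed.

(** On the fibre where the path equals [p] the next state is [step k x] with [x] the last entry of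
    [p], and its variables are fresh; summing over the countably many paths gives the identity. *)
Lemma ge0_markov k (f : seq nat -> nat -> R) : (forall p y, 0 <= f p y) ->
  (\int[P]_w (f (path_to k w) (X k.+1 w))%:E =
   \int[P]_w (Kop alpha eps_pmf (f (path_to k w)) (X k w)))%E.
Proof.
move=> f0; have pe0 := eps_pmf_ge0; have a01 := inar_alpha H.
rewrite (ge0_integral_fibers P (discrete_path k))//; last 2 first.
- exact: measurable_path.
- by move=> w _; rewrite lee_fin.
rewrite [RHS](ge0_integral_fibers P (discrete_path k))//; last 2 first.
- apply: (@discrete_rv_measurable _ _ _ (fun w => (path_to k w, X k w)) _ _ (fun x => Kop alpha eps_pmf (f x.1) x.2)).
  by apply: discrete_rv_pair; [exact: discrete_path|exact: discrete_inar].
- by move=> w _; exact: Kop_ge0.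
apply: eq_eseriesr => n _; rewrite setTI.
have [[p pn]|np] := pselect (exists p : seq nat, pickle p = n); last first.
  rewrite (_ : _ @^-1` _ = set0) ?integral_set0//.
  by rewrite -subset0 => w /= e; apply: np; exists (path_to k w).

have -> : (pickle \o path_to k) @^-1` [set n] = path_to k @^-1` [set p].
  apply/seteqP; split => w /=; rewrite -pn; last by move=> ->.
  exact: (pcan_inj pickleK).
have mE : measurable (path_to k @^-1` [set p]) by exact: discrete_path.
set x := nth 0%N p k.
rewrite (eq_integral (fun w => (f p (step k x w))%:E)); last first.
  move=> w; rewrite inE => pw; have /path_toP[_ h] := pw.
  by rewrite pw -[X k.+1 w]/(step k (X k w) w) h.
rewrite [RHS](eq_integral (fun=> Kop alpha eps_pmf (f p) x)); last first.
  move=> w; rewrite inE => pw; have /path_toP[_ h] := pw. by rewrite pw h.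
rewrite [RHS](integral_cst P mE (Kop alpha eps_pmf (f p) x)) (ge0_integral_nat_rv P (discrete_step k x) mE (f0 p)).
have [fr1 fr2] := path_vars_fresh p k.
under eq_eseriesr => y _ do rewrite (step_indep y (path_determined (k:=k) (p:=p)) fr1 (fun j _ => fr2 j)).
rewrite [RHS]muleC -(fineK (fin_num_measure P _ mE)).
transitivity (\sum_(y <oo) (fine (P (path_to k @^-1` [set p])))%:E * (f p y * ker x y)%:E)%E.
  by apply: eq_eseriesr => y _; rewrite muleCA EFinM.
rewrite nneseriesZl ?fineK ?fin_num_measure// => y _.
by rewrite lee_fin mulr_ge0// inar_kernel_ge0.
Qed.

End markov.

(** * Calculus of real-valued expectations *)

Section mean.
Context {R : realType} {d : measure_display} {T : measurableType d}.
Variable P : probability T R.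

Definition mean (f : T -> R) : R := Rintegral P setT f.
Definition integ (f : T -> R) := P.-integrable setT (EFin \o f).

Lemma integ_measurable f : integ f -> measurable_fun setT f.
Proof. by move=> /measurable_int /measurable_EFinP. Qed.

Lemma integ_le (g f : T -> R) : measurable_fun setT f ->
  (forall w, `|f w| <= g w) -> integ g -> integ f.
Proof.
move=> mf fg ig; apply: (le_integrable _ _ _ ig) => //.
  exact/measurable_EFinP.
move=> w _ /=; rewrite lee_fin; exact: le_trans (fg w) (ler_norm _).
Qed.

Lemma integ_cst c : integ (fun=> c).
Proof. exact: finite_measure_integrable_cst. Qed.

Lemma integD f g : integ f -> integ g -> integ (fun w => f w + g w).
Proof. by move=> i1 i2; exact: (integrableD measurableT i1 i2). Qed.

Lemma integZ c f : integ f -> integ (fun w => c * f w).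
Proof. by move=> i1; exact: (integrableZl measurableT c i1). Qed.

Lemma integB f g : integ f -> integ g -> integ (fun w => f w - g w).
Proof. by move=> i1 i2; exact: (integrableB measurableT i1 i2). Qed.

Lemma integ_norm f : integ f -> integ (fun w => `|f w|).
Proof. by move=> i1; exact: (integrable_norm i1). Qed.

Lemma integ_bounded C (f : T -> R) : measurable_fun setT f -> (forall w, `|f w| <= C) -> integ f.
Proof. by move=> mf fC; apply: (@integ_le (fun=> C)) => //; exact: integ_cst. Qed.

Lemma integMb C (f g : T -> R) : measurable_fun setT g -> (forall w, `|g w| <= C) ->
  integ f -> integ (fun w => g w * f w).
Proof.
move=> mg gC i; apply: (@integ_le (fun w => C * `|f w|)).
- by apply: measurable_funM => //; exact: integ_measurable.
- by move=> w; rewrite normrM ler_wpM2r.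
- by apply: integZ; exact: integ_norm.
Qed.

Lemma integ_sum (I : Type) (s : seq I) (f : I -> T -> R) :
  (forall i, integ (f i)) -> integ (fun w => \sum_(i <- s) f i w).
Proof.
move=> h; elim: s => [|i s ih].
  by under eq_fun do rewrite big_nil; exact: integ_cst.
by under eq_fun do rewrite big_cons; exact: integD.
Qed.

Lemma eq_mean (f g : T -> R) : (forall w, f w = g w) -> mean f = mean g.
Proof. by move=> fg; congr mean; exact/funext. Qed.

Lemma mean_cst c : mean (fun=> c) = c.
Proof.
by rewrite /mean (Rintegral_cst P measurableT) // [X in fine X](_ : _ = 1%E) ?mulr1//; exact: probability_setT.
Qed.

Lemma meanD f g : integ f -> integ g ->
  mean (fun w => f w + g w) = mean f + mean g.
Proof. by move=> i1 i2; exact: RintegralD. Qed.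

Lemma meanB f g : integ f -> integ g ->
  mean (fun w => f w - g w) = mean f - mean g.
Proof. by move=> i1 i2; exact: RintegralB. Qed.

Lemma meanZ c f : integ f -> mean (fun w => c * f w) = c * mean f.
Proof. by move=> i1; exact: RintegralZl. Qed.

Lemma le_mean f g : integ f -> integ g -> (forall w, f w <= g w) ->
  mean f <= mean g.
Proof. by move=> i1 i2 fg; apply: le_Rintegral. Qed.

Lemma mean_ge0 f : (forall w, 0 <= f w) -> 0 <= mean f.
Proof. by move=> f0; apply: Rintegral_ge0. Qed.

Lemma norm_mean_le f g : integ f -> integ g -> (forall w, `|f w| <= g w) ->
  `|mean f| <= mean g.
Proof.
move=> i1 i2 fg; apply: le_trans (le_normr_Rintegral _ i1) _ => //.
by apply: le_mean => //; exact: integ_norm.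
Qed.

Lemma meanE f : integ f -> (\int[P]_w (f w)%:E)%E = (mean f)%:E.
Proof. by move=> i; rewrite /mean /Rintegral fineK// integrable_fin_num. Qed.

Lemma ge0_integP (f : T -> R) : measurable_fun setT f -> (forall w, 0 <= f w) ->
  integ f <-> (\int[P]_w (f w)%:E < +oo)%E.
Proof.
move=> mf f0; split=> [i|fi]; first by rewrite meanE// ltry.
apply/integrableP; split; first exact/measurable_EFinP.
by rewrite (eq_integral (fun w => (f w)%:E))// => w _; rewrite /= ger0_norm.
Qed.

Lemma mean_indic A : measurable A -> mean (\1_A) = fine (P A).
Proof. by move=> mA; rewrite /mean /Rintegral integral_indic// setIT. Qed.

Lemma mean_dominated (f : nat -> T -> R) (f0 g : T -> R) :
  (forall n, measurable_fun setT (f n)) -> integ g ->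
  (forall n w, `|f n w| <= g w) -> (forall w, f n w @[n --> \oo] --> f0 w) ->
  mean (f n) @[n --> \oo] --> mean f0.
Proof.
move=> mf ig fg ff.
have mf0 : measurable_fun setT f0.
  by apply: (measurable_fun_cvg mf) => w _; exact: ff.
have := @dominated_convergence _ _ _ P _ measurableT (fun n => EFin \o f n)
  (EFin \o f0) (EFin \o g).
case.
- by move=> n; exact/measurable_EFinP.
- exact/measurable_EFinP.
- by apply: aeW => w _; apply: cvg_EFin; [exact: nearW|exact: ff].
- exact: ig.
- by apply: aeW => w n _; rewrite /= lee_fin.
by move=> i0 _; rewrite meanE// => /fine_cvg.
Qed.

End mean.

(** * Moments of the chain up to order three *)

Section inar_moments.
Context {R : realType} {d : measure_display} {T : measurableType d}.
Variables (P : probability T R) (alpha : R) (X0 : T -> nat) (eps : nat -> T -> nat).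
Variables (xi : nat -> nat -> T -> nat) (mu sig2 : R).
Hypothesis H : inar_model P alpha X0 eps xi mu sig2.
Local Notation X := (inar X0 eps xi).
Local Notation path := (path_to X0 eps xi).
Local Notation st := (step eps xi 0).
Local Notation E := (mean P).
Local Notation pmf := (eps_pmf P eps).

(** The largest polynomial growth that third moments can integrate. *)
Definition cubic (f : nat -> R) := exists C, forall y, `|f y| <= C * (y%:R + 1) ^+ 3.

(** The transition operator with real values, meant for [cubic] functions. The variables of time [0]
    serve as a representative transition, the chain being homogeneous. *)
Definition Kmean (f : nat -> R) (x : nat) : R := E (fun w => f (st x w)).

Lemma measurable_rv (U : countType) (Z : T -> U) (f : U -> R) :
  discrete_rv Z -> measurable_fun setT (fun w => f (Z w)).
Proof. exact: discrete_rv_measurable. Qed.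

Lemma Kop_integral (f : nat -> R) x : (forall y, 0 <= f y) ->
  (Kop alpha pmf f x = \int[P]_w (f (st x w))%:E)%E.
Proof.
move=> f0; rewrite (ge0_integral_nat_rv P (discrete_step H 0 x) measurableT f0).
apply: eq_eseriesr => y _.
rewrite (@step_indep _ _ _ _ _ _ _ _ _ _ H 0 x [::])//.
by rewrite probability_setT mul1e EFinM.
Qed.

(** Since [KopS] holds with extended values, finiteness at [x] yields integrability at [x.+1]
    together with the real recursion. *)
Lemma step_split (f : nat -> R) x : (forall y, 0 <= f y) ->
  integ P (fun w => f (st x w)) -> integ P (fun w => f (st x w).+1) ->
  integ P (fun w => f (st x.+1 w)) /\
  Kmean f x.+1 = (1 - alpha) * Kmean f x + alpha * Kmean (fun y => f y.+1) x.
Proof.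
move=> f0 i1 i2; have := KopS (inar_alpha H) (eps_pmf_ge0 P eps) x f0.
rewrite !Kop_integral//= [in RHS](meanE i1) [in RHS](meanE i2) => h.
have i : integ P (fun w => f (st x.+1 w)).
  apply/ge0_integP => //; last by rewrite h -EFinM -EFinM -EFinD ltry.
  by apply: measurable_rv; exact: discrete_step H _ _.
by split => //; move: h; rewrite (meanE i) -EFinM -EFinM -EFinD => -[].
Qed.

Lemma integ_le_pow (f : T -> R) n m : (n <= m)%N -> (forall w, 0 <= f w) ->
  measurable_fun setT f -> integ P (fun w => f w ^+ m) -> integ P (fun w => f w ^+ n).
Proof.
move=> nm f0 mf i; apply: (@integ_le _ _ _ _ (fun w => 1 + f w ^+ m)).
- exact: measurable_funX.
- move=> w; rewrite ger0_norm ?exprn_ge0//.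
  have [f1|/ltW f1] := leP (f w) 1; first by rewrite ler_wpDr ?exprn_ge0// exprn_ile1.
  by rewrite ler_wpDl// ler_weXn2l.
- by apply: integD => //; exact: integ_cst.
Qed.

Lemma cube_split (x c : R) : 0 <= x -> 0 <= c -> (x + c) ^+ 3 <= 4 * x ^+ 3 + 4 * c ^+ 3.
Proof.
move=> x0 c0; rewrite -subr_ge0.
rewrite (_ : _ - _ = 3 * (x + c) * (x - c) ^+ 2); last by ring.
by rewrite mulr_ge0 ?sqr_ge0// mulr_ge0// addr_ge0.
Qed.

Lemma integ_addc3 (U : T -> nat) c : discrete_rv U ->
  integ P (fun w => (U w)%:R ^+ 3) -> integ P (fun w => ((U w)%:R + c%:R) ^+ 3).
Proof.
move=> mU i; apply: (@integ_le _ _ _ _ (fun w => 4 * (U w)%:R ^+ 3 + 4 * c%:R ^+ 3)).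
- exact: (measurable_rv (fun u => (u%:R + c%:R) ^+ 3) mU).
- by move=> w; rewrite ger0_norm ?exprn_ge0 ?addr_ge0// cube_split.
- by apply: integD; [exact: integZ|exact: integ_cst].
Qed.

Lemma integ_eps3 : integ P (fun w => (eps 0%N w)%:R ^+ 3).
Proof.
apply/ge0_integP; last by have := inar_eps3 H.
- apply: (measurable_rv (fun u => u%:R ^+ 3)); exact: nat_rv_discrete (inar_meps H 0%N).
- by move=> w; rewrite exprn_ge0.
Qed.

(** The shift [c] is universally quantified because the recursion at [x.+1] calls the claim at [x]
    for [c] and for [c.+1]. *)
Lemma integ_step3 x c : integ P (fun w => ((st x w)%:R + c%:R) ^+ 3).
Proof.
elim: x c => [|x ih] c.
  rewrite (_ : (fun w => _) = (fun w => ((eps 0%N w)%:R + c%:R) ^+ 3)).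
    by apply: integ_addc3; [exact: nat_rv_discrete (inar_meps H 0%N)|exact: integ_eps3].
  by apply/funext => w; rewrite /step big_ord0.
have i2 : integ P (fun w => ((st x w).+1%:R + c%:R) ^+ 3).
  rewrite (_ : (fun w => _) = (fun w => ((st x w)%:R + c.+1%:R) ^+ 3)); first exact: ih.
  by apply/funext => w; rewrite -!natrD addnS addSn.
have f0 (y : nat) : 0 <= (y%:R + c%:R) ^+ 3 :> R by rewrite exprn_ge0// addr_ge0.
exact: (step_split f0 (ih c) i2).1.
Qed.

Lemma integ_step (f : nat -> R) x : cubic f -> integ P (fun w => f (st x w)).
Proof.
move=> [C fC]; apply: (@integ_le _ _ _ _ (fun w => C * ((st x w)%:R + 1%:R) ^+ 3)).
- exact: (measurable_rv f (discrete_step H _ _)).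
- by move=> w; exact: fC.
- by apply: integZ; exact: integ_step3.
Qed.

Lemma cubic_pow (n : nat) : (n <= 3)%N -> cubic (fun y => y%:R ^+ n).
Proof.
move=> n3; exists 1 => y; rewrite mul1r ger0_norm ?exprn_ge0//.
by rewrite (@le_trans _ _ ((y%:R + 1) ^+ n))// ?lerXn2r ?nnegrE ?addr_ge0 ?lerDl// ler_weXn2l// lerDr.
Qed.

Lemma cubic_cst (c : R) : cubic (fun=> c).
Proof.
exists `|c| => y; rewrite ler_peMr// exprn_ege1// lerDr.
by [].
Qed.

Lemma cubicD (f g : nat -> R) : cubic f -> cubic g -> cubic (fun y => f y + g y).
Proof.
move=> [C fC] [D gD]; exists (C + D) => y; rewrite mulrDl.
by rewrite (le_trans (ler_normD _ _))// lerD.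
Qed.

Lemma cubicZ c (f : nat -> R) : cubic f -> cubic (fun y => c * f y).
Proof.
by move=> [C fC]; exists (`|c| * C) => y; rewrite normrM -mulrA ler_wpM2l.
Qed.

Lemma cubic_dom (f g : nat -> R) : cubic g -> (forall y, `|f y| <= `|g y|) -> cubic f.
Proof. by move=> [C gC] fg; exists C => y; exact: le_trans (fg y) (gC y). Qed.

Lemma KmeanD f g x : cubic f -> cubic g ->
  Kmean (fun y => f y + g y) x = Kmean f x + Kmean g x.
Proof. by move=> cf cg; rewrite /Kmean meanD//; exact: integ_step. Qed.

Lemma KmeanZ c f x : cubic f -> Kmean (fun y => c * f y) x = c * Kmean f x.
Proof. by move=> cf; rewrite /Kmean meanZ//; exact: integ_step. Qed.

Lemma Kmean_cst c x : Kmean (fun=> c) x = c.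
Proof. exact: mean_cst. Qed.

Lemma KmeanS (f : nat -> R) x : (forall y, 0 <= f y) -> cubic f -> cubic (fun y => f y.+1) ->
  Kmean f x.+1 = (1 - alpha) * Kmean f x + alpha * Kmean (fun y => f y.+1) x.
Proof.
by move=> f0 cf cf'; exact: (step_split f0 (integ_step x cf) (integ_step x cf')).2.
Qed.

Definition eps_moment n := E (fun w => (eps 0%N w)%:R ^+ n).

Lemma Kmean0 f : Kmean f 0 = E (fun w => f (eps 0%N w)).
Proof. by apply: eq_mean => w; rewrite /step big_ord0. Qed.

Lemma integ_eps n : (n <= 3)%N -> integ P (fun w => (eps 0%N w)%:R ^+ n).
Proof.
move=> n3; apply: (integ_le_pow n3) => //; last exact: integ_eps3.
apply: (measurable_rv (fun u => u%:R)); exact: nat_rv_discrete (inar_meps H 0%N).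
Qed.

Lemma eps_moment1 : eps_moment 1 = mu.
Proof.
have := inar_eps_mean H; rewrite /Exp.
rewrite (meanE (f := fun w => (eps 0%N w)%:R)); first by case.
exact: (@integ_eps 1).
Qed.

Lemma eps_moment2 : eps_moment 2 = sig2 + mu ^+ 2.
Proof.
have i1 := @integ_eps 1 isT; have i2 := @integ_eps 2 isT.
have := inar_eps_var H; rewrite /Exp.
have e w : ((eps 0%N w)%:R - mu) ^+ 2 =
    (eps 0%N w)%:R ^+ 2 + (- (2 * mu)) * (eps 0%N w)%:R ^+ 1 + mu ^+ 2 by ring.
under eq_integral do rewrite e.
have i3 := integZ (- (2 * mu)) i1; have i4 := integD i2 i3; have i5 := integ_cst P (mu ^+ 2).
rewrite (meanE (integD i4 i5)) (meanD i4 i5) (meanD i2 i3) (meanZ _ i1) mean_cst.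
rewrite -/(eps_moment 2) -/(eps_moment 1) eps_moment1 => -[<-].
by ring.
Qed.

Lemma Kmean_id x : Kmean (fun y => y%:R) x = alpha * x%:R + mu.
Proof.
have c1 : cubic (fun y => y%:R) by exact: (@cubic_pow 1).
elim: x => [|x ih]; first by rewrite mulr0 add0r Kmean0 -eps_moment1.
have e : (fun y : nat => y.+1%:R : R) = (fun y => y%:R + 1).
  by apply/funext => y; rewrite -natr1.
rewrite KmeanS ?e//; last by apply: cubicD => //; exact: cubic_cst.
rewrite KmeanD//; last exact: cubic_cst.
by rewrite Kmean_cst ih -natr1; ring.
Qed.

(** Coefficient of [x] in the second moment of a transition from [x]; the leading coefficient is
    [alpha ^+ 2]. *)
Definition ker2 : R := alpha * (1 - alpha) + 2 * alpha * mu.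

Lemma Kmean_sqr x : Kmean (fun y => y%:R ^+ 2) x =
  alpha ^+ 2 * x%:R ^+ 2 + ker2 * x%:R + (sig2 + mu ^+ 2).
Proof.
have c1 : cubic (fun y => y%:R) by exact: (@cubic_pow 1).
have c2 := @cubic_pow 2 isT; have cc := cubic_cst.
elim: x => [|x ih].
  by rewrite Kmean0 -/(eps_moment 2) eps_moment2 !expr0n /=; ring.
have e : (fun y : nat => y.+1%:R ^+ 2 : R) = (fun y => y%:R ^+ 2 + (2 * y%:R + 1)).
  by apply/funext => y; rewrite -natr1; ring.
have cz := cubicZ 2 c1; have cs := cubicD cz (cc 1).
rewrite KmeanS ?e//; last exact: cubicD c2 cs.
rewrite !KmeanD// KmeanZ// Kmean_cst Kmean_id ih /ker2 -natr1.
by ring.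
Qed.

(** Coefficients of degrees two, one and zero in the third moment of a transition from [x]; the
    leading one is [alpha ^+ 3]. *)
Definition ker3 : R * R * R :=
  let b := 3 * alpha ^+ 2 * (1 - alpha) + 3 * alpha ^+ 2 * mu in
  (b, 3 * alpha * (sig2 + mu ^+ 2) + 3 * alpha * mu + alpha - alpha ^+ 3 - b,
   eps_moment 3).

Lemma Kmean_cube x : Kmean (fun y => y%:R ^+ 3) x =
  alpha ^+ 3 * x%:R ^+ 3 + ker3.1.1 * x%:R ^+ 2 + ker3.1.2 * x%:R + ker3.2.
Proof.
have c1 : cubic (fun y => y%:R) by exact: (@cubic_pow 1).
have c2 := @cubic_pow 2 isT; have cc := cubic_cst; have c3 := @cubic_pow 3 isT.
elim: x => [|x ih].
  by rewrite Kmean0 -/(eps_moment 3) !expr0n /=; ring.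
have e : (fun y : nat => y.+1%:R ^+ 3 : R) =
    (fun y => y%:R ^+ 3 + (3 * y%:R ^+ 2 + (3 * y%:R + 1))).
  by apply/funext => y; rewrite -natr1; ring.
have cz := cubicZ 3 c1; have cs := cubicD cz (cc 1).
have cz2 := cubicZ 3 c2; have cs2 := cubicD cz2 cs.
rewrite KmeanS ?e//; last exact: cubicD c3 cs2.
rewrite !KmeanD// !KmeanZ// Kmean_cst Kmean_id Kmean_sqr ih /ker2 /ker3 /= -natr1.
by ring.
Qed.

Lemma Kmean_var x : Kmean (fun y => (y%:R - alpha * x%:R - mu) ^+ 2) x =
  alpha * (1 - alpha) * x%:R + sig2.
Proof.
have c1 : cubic (fun y => y%:R) by exact: (@cubic_pow 1).
have c2 := @cubic_pow 2 isT; have cc := cubic_cst.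
rewrite (_ : (fun y => _) = (fun y : nat => y%:R ^+ 2 +
   ((- (2 * (alpha * x%:R + mu))) * y%:R + (alpha * x%:R + mu) ^+ 2))); last first.
  by apply/funext => y; ring.
have cz := cubicZ (- (2 * (alpha * x%:R + mu))) c1.
rewrite !KmeanD//; last exact: cubicD cz (cc _).
by rewrite KmeanZ// Kmean_cst Kmean_id Kmean_sqr /ker2; ring.
Qed.

(** The non-negative Markov property is applied to the positive and negative parts of [f]; cubic
    growth of each section [f p] makes [Kmean] linear on them. *)
Lemma markov_mean k (f : seq nat -> nat -> R) : (forall p, cubic (f p)) ->
  integ P (fun w => f (path k w) (X k.+1 w)) ->
  integ P (fun w => Kmean (f (path k w)) (X k w)) /\
  E (fun w => f (path k w) (X k.+1 w)) = E (fun w => Kmean (f (path k w)) (X k w)).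
Proof.
move=> cf i.
have ge0 (g : seq nat -> nat -> R) : (forall p y, 0 <= g p y) -> (forall p, cubic (g p)) ->
    integ P (fun w => g (path k w) (X k.+1 w)) ->
    integ P (fun w => Kmean (g (path k w)) (X k w)) /\
    E (fun w => g (path k w) (X k.+1 w)) = E (fun w => Kmean (g (path k w)) (X k w)).
  move=> g0 cg ig.
  have := ge0_markov H k g0; rewrite (meanE ig).
  rewrite [in RHS](eq_integral (fun w => (Kmean (g (path k w)) (X k w))%:E)); last first.
    by move=> w _; rewrite Kop_integral// meanE//; exact: integ_step.
  move=> h; have iK : integ P (fun w => Kmean (g (path k w)) (X k w)).
    apply/ge0_integP; last by rewrite -h ltry.
    - apply: (measurable_rv (Z := fun w => (path k w, X k w)) (fun z => Kmean (g z.1) z.2)).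
      by apply: discrete_rv_pair; [exact: discrete_path H k|exact: discrete_inar H k].
    - by move=> w; apply: mean_ge0.
  by split => //; move: h; rewrite (meanE iK) => -[].
pose fp p y := Num.max (f p y) 0; pose fn p y := Num.max (- f p y) 0.
have fE p y : f p y = fp p y + (-1) * fn p y.
  rewrite /fp /fn; have [h|h] := leP (f p y) 0.
    by rewrite (max_idPl _) ?oppr_ge0//; ring.
  by rewrite (max_idPr _) ?oppr_le0 1?ltW//; ring.
have cfp p : cubic (fp p).
  apply: cubic_dom (cf p) _ => y; rewrite /fp; case: (lerP (f p y) 0) => // _.
  by rewrite normr0.
have cfn p : cubic (fn p).
  apply: cubic_dom (cf p) _ => y; rewrite /fn; case: (lerP (- f p y) 0) => // _.
    by rewrite normr0.
  by rewrite normrN.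
have mX (g : seq nat -> nat -> R) : measurable_fun setT (fun w => g (path k w) (X k.+1 w)).
  apply: (measurable_rv (Z := fun w => (path k w, X k.+1 w)) (fun z => g z.1 z.2)).
  by apply: discrete_rv_pair; [exact: discrete_path H k|exact: discrete_inar H k.+1].
have ifp : integ P (fun w => fp (path k w) (X k.+1 w)).
  apply: integ_le (integ_norm i); first exact: mX.
  by move=> w; rewrite /fp; case: (lerP (f _ _) 0) => // _; rewrite normr0.
have ifn : integ P (fun w => fn (path k w) (X k.+1 w)).
  apply: integ_le (integ_norm i); first exact: mX.
  by move=> w; rewrite /fn; case: (lerP (- f _ _) 0) => // _; rewrite ?normr0 ?normrN.
have fp0 p y : 0 <= fp p y by rewrite /fp le_max lexx orbT.
have fn0 p y : 0 <= fn p y by rewrite /fn le_max lexx orbT.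
have [ip ep] := ge0 fp fp0 cfp ifp.
have [im em] := ge0 fn fn0 cfn ifn.
have KE w : Kmean (f (path k w)) (X k w) =
    Kmean (fp (path k w)) (X k w) + (-1) * Kmean (fn (path k w)) (X k w).
  rewrite -KmeanZ// -KmeanD//; last exact: cubicZ.
  by apply: eq_mean => w'; exact: fE.
split.
  by rewrite (funext KE); apply: integD => //; exact: integZ.
under eq_mean do rewrite fE; under [RHS]eq_mean do rewrite KE.
rewrite !meanD//; try exact: integZ.
by rewrite !meanZ// ep em.
Qed.

Lemma integ_X3 k : integ P (fun w => (X k w)%:R ^+ 3).
Proof.
have mX n j : measurable_fun setT (fun w => (X n w)%:R ^+ j : R).
  exact: (measurable_rv (fun u => u%:R ^+ j) (discrete_inar H n)).
elim: k => [|k ih].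
  by apply/ge0_integP; [exact: mX|move=> w; exact: exprn_ge0|exact: inar_X03 H].
apply/ge0_integP; [exact: mX|by move=> w; exact: exprn_ge0|].
have h0 (p : seq nat) (y : nat) : 0 <= y%:R ^+ 3 :> R by exact: exprn_ge0.
rewrite (ge0_markov H k h0).
have c3 := @cubic_pow 3 isT.
rewrite (eq_integral (fun w => (Kmean (fun y => y%:R ^+ 3) (X k w))%:E)); last first.
  by move=> w _; rewrite Kop_integral// meanE//; exact: (integ_step (X k w) c3).
rewrite meanE ?ltry//.
under [X in integ _ X]eq_fun do rewrite Kmean_cube.
have i2 : integ P (fun w => (X k w)%:R ^+ 2) by apply: (@integ_le_pow _ 2 3) => //; exact: (mX k 1%N).
have i1 : integ P (fun w => (X k w)%:R) by apply: (@integ_le_pow _ 1 3) => //; exact: (mX k 1%N).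
exact: (integD (integD (integD (integZ _ ih) (integZ _ i2)) (integZ _ i1)) (integ_cst _ _)).
Qed.

Lemma integ_X k n : (n <= 3)%N -> integ P (fun w => (X k w)%:R ^+ n).
Proof.
move=> n3; apply: (integ_le_pow n3) => //; last exact: integ_X3.
exact: (measurable_rv (fun u => u%:R) (discrete_inar H k)).
Qed.

Lemma integ_cubic k f : cubic f -> integ P (fun w => f (X k w)).
Proof.
move=> [C fC]; apply: (@integ_le _ _ _ _ (fun w => C * ((X k w)%:R + 1%:R) ^+ 3)).
- exact: (measurable_rv f (discrete_inar H k)).
- by move=> w; exact: fC.
- by apply: integZ; apply: integ_addc3; [exact: discrete_inar H k|exact: integ_X3].
Qed.

Lemma markov_mean1 k f : cubic f -> E (fun w => f (X k.+1 w)) = E (fun w => Kmean f (X k w)).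
Proof.
move=> cf; have [] := @markov_mean k (fun _ => f) (fun _ => cf); last by [].
exact: integ_cubic.
Qed.

Lemma rec_bounded (u : nat -> R) r c : 0 <= r < 1 ->
  (forall n, u n.+1 <= r * u n + c) -> exists C, forall n, u n <= C.
Proof.
(* [c / (1 - r)] is the fixed point of the affine map [u -> r * u + c]. *)
move=> /andP[r0 r1] h; exists (Num.max (u 0%N) (c / (1 - r))) => n.
elim: n => [|n ih]; first by rewrite le_max lexx.
have r1' : 0 < 1 - r by lra.
apply: le_trans (h n) _; set C := Num.max _ _ in ih *.
have : c / (1 - r) <= C by rewrite le_max lexx orbT.
rewrite ler_pdivrMr// => cC.
have := ler_wpM2l r0 ih; lra.
Qed.

Lemma mean_X_rec k : E (fun w => (X k.+1 w)%:R) = alpha * E (fun w => (X k w)%:R) + mu.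
Proof.
have i1 := @integ_X k 1 isT.
rewrite (markov_mean1 k (f := fun y => y%:R)); last exact: (@cubic_pow 1).
under eq_mean do rewrite Kmean_id.
by rewrite (meanD (integZ _ i1) (integ_cst _ _)) (meanZ _ i1) mean_cst.
Qed.

Lemma mean_X2_rec k : E (fun w => (X k.+1 w)%:R ^+ 2) =
  alpha ^+ 2 * E (fun w => (X k w)%:R ^+ 2) + ker2 * E (fun w => (X k w)%:R) +
  (sig2 + mu ^+ 2).
Proof.
have i1 := @integ_X k 1 isT; have i2 := @integ_X k 2 isT.
rewrite (markov_mean1 k (f := fun y => y%:R ^+ 2)); last exact: (@cubic_pow 2).
under eq_mean do rewrite Kmean_sqr.
rewrite (meanD (integD (integZ _ i2) (integZ _ i1)) (integ_cst _ _)).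
by rewrite (meanD (integZ _ i2) (integZ _ i1)) (meanZ _ i1) (meanZ _ i2) mean_cst.
Qed.

Lemma mean_X3_rec k : E (fun w => (X k.+1 w)%:R ^+ 3) =
  alpha ^+ 3 * E (fun w => (X k w)%:R ^+ 3) + ker3.1.1 * E (fun w => (X k w)%:R ^+ 2) +
  ker3.1.2 * E (fun w => (X k w)%:R) + ker3.2.
Proof.
have i1 := @integ_X k 1 isT; have i2 := @integ_X k 2 isT; have i3 := @integ_X k 3 isT.
rewrite (markov_mean1 k (f := fun y => y%:R ^+ 3)); last exact: (@cubic_pow 3).
under eq_mean do rewrite Kmean_cube.
have j1 := integZ ker3.1.2 i1; have j2 := integZ ker3.1.1 i2.
have j3 := integZ (alpha ^+ 3) i3.
rewrite (meanD (integD (integD j3 j2) j1) (integ_cst _ _)) (meanD (integD j3 j2) j1).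
by rewrite (meanD j3 j2) (meanZ _ i1) (meanZ _ i2) (meanZ _ i3) mean_cst.
Qed.

Lemma alpha_exp n : (0 < n)%N -> 0 <= alpha ^+ n < 1.
Proof.
by move=> n0; have /andP[a0 a1] := inar_alpha H; rewrite exprn_ge0 ?exprn_ilt1 ?ltW// -lt0n.
Qed.

(** The three moment recursions are triangular with contraction factors [alpha ^+ n], so a bound in
    each degree follows from those in lower degrees. *)
Lemma mean_X_bounded : exists C, forall k n, (n <= 3)%N -> E (fun w => (X k w)%:R ^+ n) <= C.
Proof.
have bnd c (u : nat -> R) C : (forall n, 0 <= u n) -> (forall n, u n <= C) ->
    forall n, c * u n <= `|c| * C.
  move=> u0 uC n; apply: le_trans (ler_norm _) _.
  by rewrite normrM (ger0_norm (u0 n)) ler_wpM2l.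
pose u j k := E (fun w => (X k w)%:R ^+ j).
have u0 j k : 0 <= u j k by apply: mean_ge0 => w; exact: exprn_ge0.
have [C1 h1] : exists C, forall k, u 1%N k <= C.
  apply: (@rec_bounded _ alpha mu); first by rewrite -[alpha]expr1; exact: alpha_exp.
  by move=> n; rewrite /u mean_X_rec.
have [C2 h2] : exists C, forall k, u 2%N k <= C.
  apply: (@rec_bounded _ (alpha ^+ 2) (`|ker2| * C1 + (sig2 + mu ^+ 2))).
    exact: alpha_exp.
  by move=> n; rewrite /u mean_X2_rec -addrA lerD2l lerD2r; exact: (bnd _ (u 1%N)).
have [C3 h3] : exists C, forall k, u 3%N k <= C.
  apply: (@rec_bounded _ (alpha ^+ 3) (`|ker3.1.1| * C2 + `|ker3.1.2| * C1 + ker3.2)).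
    exact: alpha_exp.
  move=> n; rewrite /u mean_X3_rec -!addrA lerD2l !addrA lerD2r.
  by apply: lerD; [exact: (bnd _ (u 2%N))|exact: (bnd _ (u 1%N))].
have M c : c <= Num.max 1 (Num.max C1 (Num.max C2 C3)) <-> c <= 1 \/ c <= C1 \/ c <= C2 \/ c <= C3.
  by rewrite !le_max; split => [/or4P[]|]; [left|right; left|right; right; left|right; right; right|case=> [->|[->|[->|->]]]; rewrite ?orbT].
exists (Num.max 1 (Num.max C1 (Num.max C2 C3))) => k [|[|[|[|//]]]] _; apply/M.
- by left; under eq_mean do rewrite expr0; rewrite mean_cst.
- by right; left; exact: h1.
- by right; right; left; exact: h2.
- by right; right; right; exact: h3.
Qed.

End inar_moments.

(** * Binomial thinning as an operator on functions *)

Section thinning.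
Context {R : realType}.
Variable a : R.

(** The mean of [f] under the binomial law with parameters [x] and [a], given by Pascal's rule and
    hence a polynomial in [a]. It serves twice: for the survivors in a transition, and as the
    Bernstein operator in the approximation of test functions. *)
Fixpoint thin (f : nat -> R) (x : nat) : R :=
  if x is x'.+1 then (1 - a) * thin f x' + a * thin (fun y => f y.+1) x' else f 0%N.

Lemma thinD f g x : thin (fun y => f y + g y) x = thin f x + thin g x.
Proof. by elim: x f g => [|x ih] f g //=; rewrite !ih; ring. Qed.

Lemma thinZ c f x : thin (fun y => c * f y) x = c * thin f x.
Proof. by elim: x f => [|x ih] f //=; rewrite !ih; ring. Qed.

Lemma thin_cst c x : thin (fun=> c) x = c.
Proof. by elim: x => [|x ih] //=; rewrite !ih; ring. Qed.

Lemma thin_id x : thin (fun y => y%:R) x = a * x%:R.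
Proof.
elim: x => [|x ih] /=; first by rewrite mulr0.
have -> : (fun y : nat => y.+1%:R : R) = (fun y => y%:R + 1).
  by apply/funext => y; rewrite natr1.
by rewrite thinD thin_cst ih -natr1; ring.
Qed.

Lemma le_thin f g x : 0 <= a <= 1 -> (forall y, (y <= x)%N -> f y <= g y) ->
  thin f x <= thin g x.
Proof.
move=> /andP[a0 a1]; elim: x f g => [|x ih] f g fg /=; first exact: fg.
apply: lerD; apply: ler_wpM2l; rewrite ?subr_ge0//.
  by apply: ih => y yx; apply: fg; exact: leqW.
by apply: ih => y yx; exact: fg.
Qed.

End thinning.

(** * Uniform integrability of the cubes of the chain *)

Section tails.
Context {R : realType} {d : measure_display} {T : measurableType d}.
Variables (P : probability T R) (alpha : R) (X0 : T -> nat) (eps : nat -> T -> nat).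
Variables (xi : nat -> nat -> T -> nat) (mu sig2 : R).
Hypothesis H : inar_model P alpha X0 eps xi mu sig2.
Local Notation X := (inar X0 eps xi).
Local Notation E := (mean P).
Local Notation K := (Kmean P eps xi).

Lemma cubicS (f : nat -> R) : cubic f -> cubic (fun y => f y.+1).
Proof.
move=> [C fC]; exists (`|C| * 8) => y; apply: le_trans (fC _) _.
have y0 : 0 <= y%:R :> R by [].
apply: (@le_trans _ _ (`|C| * (y.+1%:R + 1) ^+ 3)).
  by rewrite ler_wpM2r ?ler_norm// exprn_ge0// addr_ge0.
rewrite -mulrA ler_wpM2l// (_ : 8 = 2 ^+ 3); last by ring.
by rewrite -exprMn lerXn2r ?nnegrE -?natr1; lra.
Qed.

(** Both sides obey the same recursion in [x]. The formula separates survivors from innovation,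
    which lets the innovation be integrated before thinning. *)
Lemma Kmean_thin f x : (forall y, 0 <= f y) -> cubic f ->
  K f x = thin alpha (fun i => E (fun w => f (i + eps 0%N w)%N)) x.
Proof.
elim: x f => [|x ih] f f0 cf /=.
  by rewrite Kmean0; apply: eq_mean => w; rewrite add0n.
rewrite (KmeanS H)//; last exact: cubicS.
rewrite !ih//; last exact: cubicS.
Qed.

(** A tail of [y ^+ 3] cut off by a positive part instead of an indicator: the positive part is
    subadditive, so a threshold [2 * M] can be shared between survivors and innovation. *)
Definition excess (N : R) (y : nat) : R := y%:R ^+ 2 * Num.max (y%:R - N) 0.

Lemma excess_ge0 N y : 0 <= excess N y.
Proof. by rewrite mulr_ge0 ?sqr_ge0// le_max lexx orbT. Qed.

Lemma le_excess M N y : M <= N -> excess N y <= excess M y.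
Proof.
move=> MN; rewrite ler_wpM2l ?sqr_ge0// ge_max !le_max lexx orbT andbT.
by rewrite lerD2l lerN2 MN.
Qed.

Lemma excess_cube N y : 0 <= N -> excess N y <= y%:R ^+ 3.
Proof.
move=> N0; rewrite (_ : _ ^+ 3 = y%:R ^+ 2 * y%:R); last by ring.
by rewrite ler_wpM2l ?sqr_ge0// ge_max ler0n andbT lerBlDr lerDl.
Qed.

Lemma cubic_excess N : 0 <= N -> cubic (excess N).
Proof.
move=> N0; apply: cubic_dom (@cubic_pow R 3 isT) _ => y.
by rewrite !ger0_norm ?exprn_ge0 ?excess_ge0 ?excess_cube.
Qed.

(** Each of [b] and [e] receives the threshold [M]. Cross terms with [max (b - M) 0] are non-zero
    only for [b >= M], where one power of [b] can be traded for the factor [M^-1]. *)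
Lemma excess_split (M b e : R) : 1 <= M -> 0 <= b -> 0 <= e ->
  (b + e) ^+ 2 * Num.max (b + e - 2 * M) 0 <=
  b ^+ 2 * Num.max (b - M) 0 + (2 * e + e ^+ 2) * (M^-1 * b ^+ 3) +
  2 * (b ^+ 2 + e ^+ 2) * Num.max (e - M) 0.
Proof.
move=> M1 b0 e0; have M0 : 0 < M by apply: lt_le_trans M1.
set p := Num.max (b - M) 0; set q := Num.max (e - M) 0.
have p0 : 0 <= p by rewrite le_max lexx orbT.
have q0 : 0 <= q by rewrite le_max lexx orbT.
have pq : Num.max (b + e - 2 * M) 0 <= p + q.
  have : b - M <= p by rewrite le_max lexx.
  have : e - M <= q by rewrite le_max lexx.
  by rewrite ge_max addr_ge0// andbT; lra.
have [bp pb] : b * p <= M^-1 * b ^+ 3 /\ p <= M^-1 * b ^+ 3.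
  rewrite /p; case: (leP (b - M) 0) => bM.
    by rewrite mulr0 mulr_ge0 ?exprn_ge0// invr_ge0 ltW.
  have Mb : M <= b by lra.
  have b1 : 1 <= b by lra.
  have h1 : b ^+ 2 <= M^-1 * b ^+ 3.
    rewrite ler_pdivlMl// (_ : b ^+ 3 = b * b ^+ 2); last by ring.
    by rewrite ler_wpM2r// sqr_ge0.
  have h2 : b * (b - M) <= b ^+ 2 by rewrite expr2 ler_wpM2l//; lra.
  have h3 : b <= b ^+ 2 by rewrite expr2 ler_peMr.
  by split; lra.
apply: le_trans (ler_wpM2l (sqr_ge0 _) pq) _.
have h : (b + e) ^+ 2 * p <= b ^+ 2 * p + (2 * e + e ^+ 2) * (M^-1 * b ^+ 3).
  have e20 : 0 <= 2 * e by lra.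
  have := ler_wpM2l e20 bp.
  have := ler_wpM2l (sqr_ge0 e) pb.
  rewrite -!mulrA; nra.
have h' : (b + e) ^+ 2 * q <= 2 * (b ^+ 2 + e ^+ 2) * q.
  by rewrite ler_wpM2r// -subr_ge0 (_ : _ - _ = (b - e) ^+ 2) ?sqr_ge0//; ring.
by rewrite mulrDr lerD.
Qed.

(** What the innovation adds to the tail in one transition, relative to [1 + x ^+ 3]. The first term
    decays like [M^-1], the second by dominated convergence from the third moment of the
    innovation. *)
Definition drift_error (M : R) : R :=
  M^-1 * E (fun w => 2 * (eps 0%N w)%:R + (eps 0%N w)%:R ^+ 2) +
  2 * E (fun w => (1 + (eps 0%N w)%:R ^+ 2) * Num.max ((eps 0%N w)%:R - M) 0).

Lemma discrete_eps : discrete_rv (eps 0%N).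
Proof. exact: nat_rv_discrete (inar_meps H 0%N). Qed.

Lemma integ_eps_cubic f : cubic f -> integ P (fun w => f (eps 0%N w)).
Proof.
move=> [C fC]; apply: (@integ_le _ _ _ _ (fun w => C * ((eps 0%N w)%:R + 1%:R) ^+ 3)).
- exact: (measurable_rv f discrete_eps).
- by move=> w; exact: fC.
- by apply: integZ; apply: integ_addc3; [exact: discrete_eps|exact: integ_eps3 H].
Qed.

Lemma cubic_tail M : 0 <= M ->
  cubic (fun y => (1 + y%:R ^+ 2) * Num.max (y%:R - M) 0 : R).
Proof.
move=> M0; apply: (@cubic_dom _ _ (fun y => y%:R ^+ 1 + y%:R ^+ 3)).
  by apply: cubicD; exact: cubic_pow.
move=> y; have m0 : 0 <= Num.max (y%:R - M) 0 by rewrite le_max lexx orbT.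
have y0 : 0 <= y%:R :> R by [].
rewrite !ger0_norm ?addr_ge0 ?exprn_ge0//; last first.
  by rewrite mulr_ge0 ?addr_ge0 ?sqr_ge0.
rewrite (_ : y%:R ^+ 1 + _ = (1 + y%:R ^+ 2) * y%:R); last by ring.
by rewrite ler_wpM2l ?addr_ge0 ?sqr_ge0// ge_max y0 andbT; lra.
Qed.

Lemma max_tail_cvg0 (x : nat) : Num.max (x%:R - n.+1%:R) 0 @[n --> \oo] --> (0 : R).
Proof.
apply: cvg_near_cst; exists x => // n /= xn.
by apply/max_idPr; rewrite subr_le0 ler_nat ltnW.
Qed.

Lemma drift_error_cvg0 : drift_error n.+1%:R @[n --> \oo] --> (0 : R).
Proof.
rewrite -[0](addr0 0) -{1}[0](mul0r (E (fun w => 2 * (eps 0%N w)%:R + (eps 0%N w)%:R ^+ 2))).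
rewrite -[X in _ --> _ + X](mulr0 2).
apply: cvgD; first by apply: cvgMr_tmp; exact: cvg_harmonic.
apply: cvgMl_tmp; rewrite -[X in _ --> X](mean_cst P 0).
apply: (@mean_dominated _ _ _ P (fun n w => (1 + (eps 0%N w)%:R ^+ 2) *
  Num.max ((eps 0%N w)%:R - n.+1%:R) 0) _ _ _ (integ_eps_cubic (cubic_tail (lexx 0)))).
- move=> n; exact: (measurable_rv (fun y => (1 + y%:R ^+ 2) * Num.max (y%:R - n.+1%:R) 0) discrete_eps).
- move=> n w; rewrite ger0_norm; last by rewrite mulr_ge0 ?addr_ge0 ?sqr_ge0// le_max lexx orbT.
  rewrite ler_wpM2l ?addr_ge0 ?sqr_ge0// ge_max !le_max lexx orbT andbT subr0.
  by rewrite lerBlDr lerDl ler0n.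
- move=> w; rewrite -[X in _ --> X](mulr0 (1 + (eps 0%N w)%:R ^+ 2)); apply: cvgMl_tmp.
  exact: max_tail_cvg0.
Qed.

(** Thinning multiplies the tail by at most [alpha], up to the innovation error, at the price of
    doubling the threshold. As the constant is strictly below one, iteration drives the tail to zero
    uniformly in time. *)
Lemma Kmean_excess M x : 1 <= M ->
  K (excess (2 * M)) x <= alpha * excess M x + drift_error M * (1 + x%:R ^+ 3).
Proof.
move=> M1; have M0 : 0 <= M by lra.
have /andP[a0 a1] := inar_alpha H.
have M20 : 0 <= 2 * M by lra.
rewrite Kmean_thin; [|exact: excess_ge0|exact: cubic_excess].
have iA : integ P (fun w => 2 * (eps 0%N w)%:R + (eps 0%N w)%:R ^+ 2).
  apply: (@integ_eps_cubic (fun y => 2 * y%:R + y%:R ^+ 2)); apply: cubicD; last exact: cubic_pow.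
  by apply: cubicZ; exact: (@cubic_pow _ 1).
have iB := integ_eps_cubic (cubic_tail M0).
have dE0 : 0 <= drift_error M.
  rewrite addr_ge0// mulr_ge0 ?invr_ge0//; apply: mean_ge0 => w.
    by rewrite addr_ge0 ?sqr_ge0// mulr_ge0.
  by rewrite mulr_ge0 ?addr_ge0 ?sqr_ge0// le_max lexx orbT.
have D_le i : E (fun w => excess (2 * M) (i + eps 0%N w)%N) <=
    excess M i + drift_error M * (1 + i%:R ^+ 3).
  have i0 : 0 <= i%:R :> R by [].
  pose g w := excess M i + M^-1 * i%:R ^+ 3 * (2 * (eps 0%N w)%:R + (eps 0%N w)%:R ^+ 2) +
     2 * (1 + i%:R ^+ 3) * ((1 + (eps 0%N w)%:R ^+ 2) * Num.max ((eps 0%N w)%:R - M) 0).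
  have i1 : integ P (fun w => excess M i + M^-1 * i%:R ^+ 3 * (2 * (eps 0%N w)%:R + (eps 0%N w)%:R ^+ 2)).
    by apply: integD; [exact: integ_cst|exact: integZ].
  have i2 := integZ (2 * (1 + i%:R ^+ 3)) iB.
  have ig : integ P g by exact: integD.
  have gE : E g <= excess M i + drift_error M * (1 + i%:R ^+ 3).
    rewrite /g (meanD i1 i2) (meanZ _ iB) (meanD (integ_cst _ _) (integZ _ iA)) (meanZ _ iA) mean_cst.
    rewrite /drift_error -subr_ge0; set EA := E _; set EB := E _.
    rewrite (_ : _ - _ = M^-1 * EA); last by ring.
    rewrite mulr_ge0 ?invr_ge0//; apply: mean_ge0 => w.
    by rewrite addr_ge0 ?sqr_ge0// mulr_ge0.
  have exg w : excess (2 * M) (i + eps 0%N w)%N <= g w.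
    rewrite /excess natrD (le_trans (excess_split M1 i0 (ler0n _ _)))// /g /excess -!addrA lerD2l.
    apply: lerD; first by rewrite mulrC.
    have m0 : 0 <= Num.max ((eps 0%N w)%:R - M) 0 by rewrite le_max lexx orbT.
    rewrite !mulrA ler_wpM2r// -!mulrA ler_wpM2l// mulrDr mulr1 mulrDl mul1r.
    have e2 := sqr_ge0 ((eps 0%N w)%:R : R); have i3 := exprn_ge0 3 i0.
    have i23 : i%:R ^+ 2 <= 1 + i%:R ^+ 3 :> R.
      have [i1'|i1'] := leP (i%:R : R) 1.
        by have := exprn_ile1 2 i0 i1'; lra.
      have := ler_weXn2l (ltW i1') (isT : (2 <= 3)%N); lra.
    have := mulr_ge0 i3 e2; lra.
  apply: le_trans gE; apply: le_mean => //.
  apply: (@integ_le _ _ _ _ g) => //.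
    exact: (measurable_rv (fun y => excess (2 * M) (i + y)) discrete_eps).
  by move=> w; rewrite ger0_norm ?excess_ge0.
have a01 : 0 <= alpha <= 1 by rewrite !ltW.
apply: le_trans (le_thin a01 (fun i _ => D_le i)) _.
rewrite thinD; apply: lerD; last first.
  rewrite thinZ ler_wpM2l// thinD thin_cst lerD2l.
  rewrite (le_trans (le_thin (g := fun=> x%:R ^+ 3) a01 _)) ?thin_cst// => y yx.
  by rewrite lerXn2r ?nnegrE// ler_nat.
have x0 : 0 <= x%:R :> R by [].
(* For [y <= x] the function [excess M y] is at most [c * y], linear in [y], and the thinned value
   of this bound is exactly [alpha * excess M x]. *)
pose c := x%:R * Num.max (x%:R - M) 0.
have c0 : 0 <= c by rewrite mulr_ge0// le_max lexx orbT.
apply: (@le_trans _ _ (thin alpha (fun y => c * y%:R) x)).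
  apply: le_thin => // y yx; rewrite /excess /c expr2.
  have yx' : y%:R <= x%:R :> R by rewrite ler_nat.
  rewrite -mulrA [leRHS]mulrC ler_wpM2l//; apply: ler_pM => //.
    by rewrite le_max lexx orbT.
  by rewrite ge_max !le_max lexx orbT andbT lerD2r yx'.
rewrite [leLHS](_ : _ = alpha * excess M x)// thinZ thin_id /c /excess.
by ring.
Qed.

Lemma integ_excess N k : 0 <= N -> integ P (fun w => excess N (X k w)).
Proof. by move=> N0; apply: (integ_cubic H); exact: cubic_excess. Qed.

Lemma mean_excess_cvg0 k e : 0 < e ->
  exists N0 : nat, forall n, (N0 <= n)%N -> E (fun w => excess n.+1%:R (X k w)) <= e.
Proof.
move=> e0.
have : E (fun w => excess n.+1%:R (X k w)) @[n --> \oo] --> (0 : R).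
  rewrite -[X in _ --> X](mean_cst P 0).
  apply: (@mean_dominated _ _ _ P (fun n w => excess n.+1%:R (X k w)) _ _ _ (integ_X H k (leqnn 3))).
  - move=> n; exact: (measurable_rv (excess n.+1%:R) (discrete_inar H k)).
  - by move=> n w; rewrite ger0_norm ?excess_ge0// excess_cube.
  - move=> w; rewrite -[X in _ --> X](mulr0 ((X k w)%:R ^+ 2)); apply: cvgMl_tmp.
    exact: max_tail_cvg0.
move=> /cvgrPdist_le /(_ e e0)[N0 _ hN]; exists N0 => n /hN.
by rewrite sub0r normrN ger0_norm// mean_ge0// => w; exact: excess_ge0.
Qed.

(* The optimal uniform tail bound [c] satisfies [c <= alpha * c]. *)
Lemma excess_uniform e : 0 < e ->
  exists2 N : R, 1 <= N & forall k, E (fun w => excess N (X k w)) <= e.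
Proof.
move=> e0; have /andP[a0 a1] := inar_alpha H.
have [C0 hC0] := mean_X_bounded H.
pose C : R := Num.max 0 C0.
have C0' : 0 <= C by rewrite le_max lexx.
have hC k : E (fun w => (X k w)%:R ^+ 3 : R) <= C by rewrite le_max hC0// orbT.
pose A (c : R) := exists2 N : R, 1 <= N & forall k, E (fun w => excess N (X k w)) <= c.
have A0 : A C.
  exists 1 => // k; apply: le_trans (hC k); apply: le_mean.
  - exact: integ_excess.
  - exact: (integ_X H k (leqnn 3)).
  - by move=> w; exact: excess_cube.
(* One transition turns a uniform bound [c] into [alpha * c + e']; the new threshold [2 * M] is
   taken so large that [X 0] and the drift error each cost at most [e']. *)
have AS c e' : 0 < e' -> A c -> A (alpha * c + e').
  move=> e'0 [N N1 hN].
  have c0 : 0 <= c by apply: le_trans (hN 0%N); apply: mean_ge0 => w; exact: excess_ge0.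
  have [N0 hN0] := mean_excess_cvg0 0 e'0.
  have C1 : 0 < 1 + C by lra.
  have /cvgrPdist_le/(_ (e' / (1 + C))) := drift_error_cvg0.
  rewrite divr_gt0// => /(_ isT)[N2 _ hN2].
  pose n := maxn (Num.truncn N) (maxn N0 N2).
  have nN0 : (N0 <= n)%N by rewrite !leq_max leqnn orbT.
  have nN2 : (N2 <= n)%N by rewrite !leq_max leqnn !orbT.
  have nN : N <= n.+1%:R.
    have /ltW/le_trans := truncnS_gt N; apply.
    by rewrite ler_nat ltnS leq_max leqnn.
  pose M : R := n.+1%:R.
  have M1 : 1 <= M by exact: le_trans N1 nN.
  exists (2 * M); first by lra.
  case=> [|k].
    apply: (@le_trans _ _ e'); last by rewrite lerDr mulr_ge0// ltW.
    apply: le_trans (hN0 _ nN0); apply: le_mean; try (apply: integ_excess; lra).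
    by move=> w; apply: le_excess; rewrite -/M; lra.
  have M0 : 0 <= M by lra.
  have M20 : 0 <= 2 * M by lra.
  rewrite (markov_mean1 H k (cubic_excess M20)).
  have ie := integ_excess k M0; have i3 := integ_X H k (leqnn 3).
  have dE : drift_error M <= e' / (1 + C).
    by have := hN2 _ nN2; rewrite sub0r normrN; apply: le_trans; exact: ler_norm.
  have i13 := integD (integ_cst P 1) i3.
  apply: (@le_trans _ _ (E (fun w => alpha * excess M (X k w) + drift_error M * (1 + (X k w)%:R ^+ 3)))).
    apply: le_mean => [||w]; last exact: Kmean_excess.
      have [] // := @markov_mean _ _ _ P _ _ _ _ _ _ H k (fun _ => excess (2 * M)) (fun _ => cubic_excess M20).
      exact: integ_excess.
    by apply: integD; exact: integZ.
  rewrite (meanD (integZ _ ie) (integZ _ i13)) (meanZ _ ie) (meanZ _ i13).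
  rewrite (meanD (integ_cst _ _) i3) mean_cst; apply: lerD.
    rewrite ler_wpM2l ?(ltW a0)//; apply: le_trans (hN k); apply: le_mean => [||w].
    - exact: ie.
    - by apply: integ_excess; lra.
    - exact: le_excess.
  rewrite -[leRHS](divfK (lt0r_neq0 C1)).
  have E3 : 0 <= E (fun w => (X k w)%:R ^+ 3) by apply: mean_ge0 => w; exact: exprn_ge0.
  apply: (@le_trans _ _ (e' / (1 + C) * (1 + E (fun w => (X k w)%:R ^+ 3)))).
    by rewrite ler_wpM2r// addr_ge0.
  by rewrite ler_wpM2l ?lerD2l// divr_ge0// ltW.
pose e2 := e / 2.
have e20 : 0 < e2 by rewrite divr_gt0.
have iter n : A (alpha ^+ n * C + e2).
  elim: n => [|n ih].
    have [N N1 hN] := A0; exists N => // k.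
    by apply: le_trans (hN k) _; rewrite expr0 mul1r lerDl ltW.
  (* The error [(1 - alpha) * e2] is chosen so that [e2] is the fixed point of the iteration. *)
  have : A (alpha * (alpha ^+ n * C + e2) + (1 - alpha) * e2).
    by apply: AS ih; rewrite mulr_gt0// subr_gt0.
  by congr A; rewrite exprS; ring.
have : alpha ^+ n * C @[n --> \oo] --> (0 * C).
  by apply: cvgMr_tmp; apply: cvg_expr; rewrite ger0_norm// ltW.
rewrite mul0r => /cvgrPdist_le/(_ e2 e20)[n _ /(_ n (leqnn n))].
rewrite sub0r normrN => /(le_trans (ler_norm _)) hn.
have [N N1 hN] := iter n; exists N => // k.
by apply: le_trans (hN k) _; rewrite /e2 in hn *; lra.
Qed.

End tails.

(** * Martingale increments: conditional moments and Lindeberg estimates *)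

Section increments.
Context {R : realType} {d : measure_display} {T : measurableType d}.
Variables (P : probability T R) (alpha : R) (X0 : T -> nat) (eps : nat -> T -> nat).
Variables (xi : nat -> nat -> T -> nat) (mu sig2 : R).
Hypothesis H : inar_model P alpha X0 eps xi mu sig2.
Local Notation X := (inar X0 eps xi).
Local Notation path := (path_to X0 eps xi).
Local Notation E := (mean P).
Local Notation K := (Kmean P eps xi).

Definition incr k w : R := (X k w)%:R * ((X k.+1 w)%:R - alpha * (X k w)%:R - mu).

Definition cond_var (x : nat) : R := x%:R ^+ 2 * (alpha * (1 - alpha) * x%:R + sig2).

Lemma last_path k w : last 0%N (path k w) = X k w.
Proof. by rewrite (last_nth 0%N) size_map size_iota /= -[RHS](path_to_nth X0 eps xi w (leqnn k)). Qed.

Lemma measurable_path2 k (f : seq nat -> nat -> R) :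
  measurable_fun setT (fun w => f (path k w) (X k.+1 w)).
Proof.
apply: (measurable_rv (Z := fun w => (path k w, X k.+1 w)) (fun z => f z.1 z.2)).
by apply: discrete_rv_pair; [exact: discrete_path H k|exact: discrete_inar H k.+1].
Qed.

Lemma measurable_path1 k (f : seq nat -> R) : measurable_fun setT (fun w => f (path k w)).
Proof. exact: (measurable_path2 k (fun p _ => f p)). Qed.

Lemma sig2_ge0 : 0 <= sig2.
Proof.
have := inar_eps_var H; rewrite /Exp => h.
by rewrite -lee_fin -h; apply: integral_ge0 => w _; rewrite lee_fin sqr_ge0.
Qed.

Lemma mu_ge0 : 0 <= mu.
Proof.
have := inar_eps_mean H; rewrite /Exp => h.
by rewrite -lee_fin -h; apply: integral_ge0 => w _; rewrite lee_fin.
Qed.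

Lemma cond_var_ge0 x : 0 <= cond_var x.
Proof.
have /andP[a0 a1] := inar_alpha H; have s0 := sig2_ge0.
by rewrite mulr_ge0 ?sqr_ge0// addr_ge0// mulr_ge0// mulr_ge0 ?subr_ge0 ?ltW.
Qed.

Lemma cubic_cond_var : cubic cond_var.
Proof.
rewrite (_ : cond_var = fun x => (alpha * (1 - alpha)) * x%:R ^+ 3 + sig2 * x%:R ^+ 2).
  by apply: cubicD; apply: cubicZ; exact: cubic_pow.
by apply/funext => x; rewrite /cond_var; ring.
Qed.

Definition incr_at (p : seq nat) (y : nat) : R :=
  (last 0%N p)%:R * (y%:R - alpha * (last 0%N p)%:R - mu).

Lemma incr_atE k w : incr k w = incr_at (path k w) (X k.+1 w).
Proof. by rewrite /incr_at last_path. Qed.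

Lemma measurable_incr k : measurable_fun setT (incr k).
Proof. by rewrite (funext (incr_atE k)); exact: (measurable_path2 k incr_at). Qed.

Lemma cubic_incr_at p : cubic (incr_at p).
Proof.
rewrite (_ : incr_at p = fun y => (last 0%N p)%:R * y%:R ^+ 1 +
  (last 0%N p)%:R * (- alpha * (last 0%N p)%:R - mu)).
  by apply: cubicD; [apply: cubicZ; exact: cubic_pow|exact: cubic_cst].
by apply/funext => y; rewrite /incr_at; ring.
Qed.

Lemma cubic_incr_at2 p : cubic (fun y => incr_at p y ^+ 2).
Proof.
set x : R := (last 0%N p)%:R.
rewrite (_ : (fun y => _) = fun y => x ^+ 2 * y%:R ^+ 2 +
  ((2 * x ^+ 2 * (- alpha * x - mu)) * y%:R ^+ 1 + x ^+ 2 * (- alpha * x - mu) ^+ 2)).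
  apply: cubicD; first by apply: cubicZ; exact: cubic_pow.
  by apply: cubicD; [apply: cubicZ; exact: cubic_pow|exact: cubic_cst].
by apply/funext => y; rewrite /incr_at -/x; ring.
Qed.

Lemma Kmean_incr p : K (incr_at p) (last 0%N p) = 0.
Proof.
set x := last 0%N p.
rewrite (_ : incr_at p = fun y => x%:R * y%:R + x%:R * (- alpha * x%:R - mu)); last first.
  by apply/funext => y; rewrite /incr_at -/x; ring.
have c1 : cubic (fun y => y%:R : R) by exact: (@cubic_pow _ 1).
rewrite (KmeanD H); [|by apply: cubicZ|exact: cubic_cst].
by rewrite (KmeanZ H)// Kmean_cst (Kmean_id H); ring.
Qed.

Lemma Kmean_incr2 p : K (fun y => incr_at p y ^+ 2) (last 0%N p) = cond_var (last 0%N p).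
Proof.
set x := last 0%N p; rewrite /cond_var -(Kmean_var H) -(KmeanZ H); last first.
  rewrite (_ : (fun y => _) = fun y : nat => y%:R ^+ 2 + ((2 * (- alpha * x%:R - mu)) * y%:R ^+ 1 +
    (- alpha * x%:R - mu) ^+ 2)); last by apply/funext => y; ring.
  apply: cubicD; first exact: cubic_pow.
  by apply: cubicD; [apply: cubicZ; exact: cubic_pow|exact: cubic_cst].
by congr Kmean; apply/funext => y; rewrite /incr_at -/x; ring.
Qed.

Lemma integ_incr2 k : integ P (fun w => incr k w ^+ 2).
Proof.
apply/ge0_integP; [exact: measurable_funX (measurable_incr k)|by move=> w; exact: sqr_ge0|].
under eq_integral do rewrite incr_atE.
rewrite (ge0_markov (f := fun p y => incr_at p y ^+ 2) H k); last by move=> p y; exact: sqr_ge0.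
rewrite (eq_integral (fun w => (cond_var (X k w))%:E)); last first.
  move=> w _; rewrite (Kop_integral H); last by move=> y; exact: sqr_ge0.
  by rewrite (meanE (integ_step H _ (cubic_incr_at2 _))) -[in RHS](last_path k) -Kmean_incr2 last_path.
by rewrite (meanE (integ_cubic H k cubic_cond_var)) ltry.
Qed.

Lemma integ_incr k : integ P (incr k).
Proof.
apply: (@integ_le _ _ _ _ (fun w => 1 + incr k w ^+ 2)).
- exact: measurable_incr.
- move=> w; have := sqr_ge0 (`|incr k w| - 1); rewrite sqrrB expr1n mulr1 -normrX ger0_norm ?sqr_ge0//.
  have := normr_ge0 (incr k w); lra.
- by apply: integD; [exact: integ_cst|exact: integ_incr2].
Qed.

(** Conditional expectations are used in weak form, tested against bounded functions [g] of the
    path; here this is the martingale property. *)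
Lemma mean_incr k (g : seq nat -> R) C : (forall p, `|g p| <= C) ->
  E (fun w => g (path k w) * incr k w) = 0.
Proof.
move=> gC; have mg := measurable_path1 k g.
have := @markov_mean _ _ _ P _ _ _ _ _ _ H k (fun p y => g p * incr_at p y)
  (fun p => cubicZ (g p) (cubic_incr_at p)).
case.
  rewrite (_ : (fun w => _) = fun w => g (path k w) * incr k w).
    by apply: (integMb mg (C := C)) => //; exact: integ_incr.
  by apply/funext => w; rewrite incr_atE.
move=> _ h; transitivity (E (fun=> 0)); last exact: mean_cst.
rewrite (eq_mean P (g := fun w => g (path k w) * incr_at (path k w) (X k.+1 w))); last first.
  by move=> w; rewrite incr_atE.
rewrite h; apply: eq_mean => w; rewrite (KmeanZ H); last exact: cubic_incr_at.
by rewrite -[X in K _ X](last_path k) Kmean_incr mulr0.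
Qed.

Lemma mean_incr2 k (g : seq nat -> R) C : (forall p, `|g p| <= C) ->
  E (fun w => g (path k w) * incr k w ^+ 2) = E (fun w => g (path k w) * cond_var (X k w)).
Proof.
move=> gC; have mg := measurable_path1 k g.
have := @markov_mean _ _ _ P _ _ _ _ _ _ H k (fun p y => g p * incr_at p y ^+ 2)
  (fun p => cubicZ (g p) (cubic_incr_at2 p)).
case.
  rewrite (_ : (fun w => _) = fun w => g (path k w) * incr k w ^+ 2).
    by apply: (integMb mg (C := C)) => //; exact: integ_incr2.
  by apply/funext => w; rewrite incr_atE.
move=> _ h.
rewrite (eq_mean P (g := fun w => g (path k w) * incr_at (path k w) (X k.+1 w) ^+ 2)); last first.
  by move=> w; rewrite incr_atE.
rewrite h; apply: eq_mean => w; rewrite (KmeanZ H); last exact: cubic_incr_at2.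
by rewrite -[X in K _ X](last_path k) Kmean_incr2 last_path.
Qed.

Lemma mean_next k (g : seq nat -> R) C (f : nat -> R) : (forall p, `|g p| <= C) -> cubic f ->
  E (fun w => g (path k w) * f (X k.+1 w)) = E (fun w => g (path k w) * K f (X k w)).
Proof.
move=> gC cf; have mg := measurable_path1 k g.
have := @markov_mean _ _ _ P _ _ _ _ _ _ H k (fun p y => g p * f y) (fun p => cubicZ (g p) cf).
case; first by apply: (integMb mg (C := C)) => //; exact: integ_cubic H _ _ cf.
by move=> _ ->; apply: eq_mean => w; rewrite (KmeanZ H).
Qed.

Definition tail3 (N : R) (x : nat) : R := (N < x%:R)%R%:R * x%:R ^+ 3.

Lemma tail3_ge0 N x : 0 <= tail3 N x.
Proof. by rewrite mulr_ge0// exprn_ge0. Qed.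

Lemma tail3_cube N x : tail3 N x <= x%:R ^+ 3.
Proof. by rewrite /tail3; case: ltP => _; rewrite ?mul1r// mul0r exprn_ge0. Qed.

Lemma cubic_tail3 N : cubic (tail3 N).
Proof.
apply: cubic_dom (@cubic_pow R 3 isT) _ => y.
by rewrite !ger0_norm ?tail3_ge0 ?tail3_cube ?exprn_ge0.
Qed.

(** Above the threshold [2 * M] one has [x <= 2 * (x - M)], so the sharp tail is at most twice
    [excess M]. *)
Lemma tail3_uniform (e : R) : 0 < e ->
  exists2 N : R, 1 <= N & forall k, E (fun w => tail3 N (X k w)) <= e.
Proof.
move=> e0; have e20 : 0 < e / 2 by lra.
have [M M1 hM] := excess_uniform H e20; exists (2 * M); first by lra.
have M0 : 0 <= M by lra.
move=> k; have ie := integ_excess H k M0.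
apply: (@le_trans _ _ (E (fun w => 2 * excess M (X k w)))).
  apply: le_mean; [exact: integ_cubic H _ _ (cubic_tail3 _)|exact: integZ|].
  move=> w; rewrite /tail3; case: ltP => [h|_]; last first.
    by rewrite mul0r mulr_ge0// excess_ge0.
  rewrite mul1r /excess (max_idPl _); last by lra.
  rewrite (_ : _ ^+ 3 = (X k w)%:R ^+ 2 * (X k w)%:R); last by ring.
  by rewrite mulrCA ler_wpM2l ?sqr_ge0//; lra.
by rewrite (meanZ _ ie); have := hM k; lra.
Qed.

Lemma cond_var_tail (e : R) : 0 < e -> exists2 N : R, 1 <= N &
  forall k, E (fun w => (N < (X k w)%:R)%R%:R * cond_var (X k w)) <= e.
Proof.
move=> e0; pose c := alpha * (1 - alpha) + sig2 + 1.
have /andP[a0 a1] := inar_alpha H; have s0 := sig2_ge0.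
have aa : 0 <= alpha * (1 - alpha) by rewrite mulr_ge0 ?subr_ge0 ?ltW.
have c0 : 0 < c by rewrite /c; lra.
have [N N1 hN] := tail3_uniform (divr_gt0 e0 c0).
exists N => // k; have it := integ_cubic H k (cubic_tail3 N).
apply: (@le_trans _ _ (E (fun w => c * tail3 N (X k w)))); last first.
  by rewrite (meanZ _ it) -ler_pdivlMl// mulrC; exact: hN.
have hp w : (N < (X k w)%:R)%R%:R * cond_var (X k w) <= c * tail3 N (X k w).
  rewrite /tail3; case: ltP => [h|_]; last by rewrite !mul0r mulr0.
  rewrite !mul1r /cond_var /c; set x : R := (X k w)%:R in h *.
  have x1 : 1 <= x by lra.
  have x23 : x ^+ 2 <= x ^+ 3 by apply: ler_weXn2l.
  have x3 : 0 <= x ^+ 3 by rewrite exprn_ge0//; lra.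
  by have := ler_wpM2l s0 x23; lra.
apply: le_mean => //; last exact: integZ.
apply: (@integ_le _ _ _ _ (fun w => c * tail3 N (X k w))).
- exact: (measurable_rv (fun x => (N < x%:R)%R%:R * cond_var x) (discrete_inar H k)).
- by move=> w; rewrite ger0_norm// mulr_ge0// cond_var_ge0.
- exact: integZ.
Qed.

Lemma incr_bound (L N : R) k w : 0 <= L -> (X k w)%:R <= L -> (X k.+1 w)%:R <= N ->
  `|incr k w| <= L * (N + alpha * L + mu).
Proof.
move=> L0 xL yN; rewrite /incr normrM normr_nat ler_pM//.
have /andP[a0 a1] := inar_alpha H; have m0 := mu_ge0.
have x0 : 0 <= (X k w)%:R :> R by []; have y0 : 0 <= (X k.+1 w)%:R :> R by [].
rewrite ler_norml.
have := ler_wpM2l (ltW a0) xL; have := mulr_ge0 (ltW a0) x0; move=> *.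
by apply/andP; split; lra.
Qed.

(** The increment is large because of [X k] or because of [X k.+1]. If [X k > L], its conditional
    second moment is a tail of [cond_var]. If only [X k.+1 > N], its square is at most a multiple of
    [y ^+ 2 <= y ^+ 3 / N] with [y] the next state. Otherwise it is bounded by [B] and the cubic
    branch gains a factor [|t|]. All bounds are uniform in [k], hence so is [tau]. *)
Lemma lindeberg (e : R) : 0 < e -> exists2 tau : R, 0 < tau & forall t k, `|t| <= tau ->
  E (fun w => Num.min ((t * incr k w) ^+ 2) (`|t * incr k w| ^+ 3)) <= e * t ^+ 2.
Proof.
move=> e0; have e3 : 0 < e / 3 by lra.
have /andP[a0 a1] := inar_alpha H; have m0 := mu_ge0.
have [L L1 hL] := cond_var_tail e3.
have L0 : 0 <= L by lra.
have [C hC] := mean_X_bounded H.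
pose c := 2 * L ^+ 2 * (1 + (alpha * L + mu) ^+ 2) * (1 + `|C|).
have c0 : 0 < c by rewrite /c !mulr_gt0 ?exprn_gt0 ?ltr_wpDr ?sqr_ge0//; lra.
pose N := Num.max 1 (c / (e / 3)).
have N1 : 1 <= N by rewrite le_max lexx.
have cN : c / N <= e / 3.
  rewrite ler_pdivrMr; last by lra.
  by rewrite mulrC -ler_pdivrMr// le_max lexx orbT.
pose B := L * (N + alpha * L + mu).
have aL : 0 <= alpha * L by exact: (mulr_ge0 (ltW a0) L0).
have B0 : 0 < B by rewrite /B mulr_gt0//; lra.
have B3 : 0 < B ^+ 3 by rewrite exprn_gt0.
exists (e / 3 / B ^+ 3); first by rewrite divr_gt0.
move=> t k ht.
(* [u] majorises the squared increment when [X k] exceeds [L], and [v] does so when only [X k.+1]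
   exceeds [N]; [c] was chosen to make [c / N] a bound for the mean of [v]. *)
pose u w : R := (L < (X k w)%:R)%R%:R * incr k w ^+ 2.
pose v w : R := 2 * L ^+ 2 * (1 + (alpha * L + mu) ^+ 2) / N * (X k.+1 w)%:R ^+ 3.
have iu : integ P u.
  apply: (integMb _ (C := 1)); last exact: integ_incr2.
    exact: (measurable_rv (fun x => (L < x%:R)%R%:R) (discrete_inar H k)).
  by move=> w; case: (_ < _); rewrite ?normr1 ?normr0.
have Eu : E u <= e / 3.
  apply: le_trans (hL k); rewrite /u.
  rewrite (eq_mean P (g := fun w => (L < (last 0%N (path k w))%:R)%R%:R * incr k w ^+ 2)); last first.
    by move=> w; rewrite last_path.
  rewrite (@mean_incr2 k (fun p => (L < (last 0%N p)%:R)%R%:R) 1); last first.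
    by move=> p; case: (_ < _); rewrite ?normr1 ?normr0.
  by under eq_mean do rewrite last_path.
have iv : integ P v by apply: integZ; exact: (integ_X H k.+1 (leqnn 3)).
have Ev : E v <= e / 3.
  apply: le_trans cN; rewrite /v (meanZ _ (integ_X H k.+1 (leqnn 3))).
  rewrite /c [leRHS]mulrAC ler_wpM2l//.
    rewrite divr_ge0 ?mulr_ge0 ?addr_ge0 ?sqr_ge0//; lra.
  by have := hC k.+1 3%N isT; have := ler_norm C; lra.
pose g w := t ^+ 2 * (u w + v w + e / 3).
have ig : integ P g by apply: integZ; apply: integD; [exact: integD|exact: integ_cst].
apply: (@le_trans _ _ (E g)); last first.
  rewrite /g (meanZ _ (integD (integD iu iv) (integ_cst _ _))).
  rewrite (meanD (integD iu iv) (integ_cst _ _)) (meanD iu iv) mean_cst mulrC.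
  by rewrite ler_wpM2r ?sqr_ge0//; lra.
have u0 w : 0 <= u w by rewrite mulr_ge0 ?sqr_ge0.
have v0 w : 0 <= v w.
  by rewrite mulr_ge0 ?exprn_ge0// divr_ge0 ?mulr_ge0 ?addr_ge0 ?sqr_ge0//; lra.
have hg w : Num.min ((t * incr k w) ^+ 2) (`|t * incr k w| ^+ 3) <= g w.
  rewrite ge_min /g exprMn; apply/orP.
  have t2 : 0 <= t ^+ 2 by exact: sqr_ge0.
  have [xL|xL] := ltP L (X k w)%:R.
    left; rewrite ler_wpM2l//.
    have uE : u w = incr k w ^+ 2 by rewrite /u xL mul1r.
    have := v0 w; rewrite -uE; lra.
  have [yN|yN] := ltP N (X k.+1 w)%:R.
    left; rewrite ler_wpM2l//; apply: (@le_trans _ _ (v w)); last by have := u0 w; lra.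
    set y : R := (X k.+1 w)%:R in yN *.
    have y1 : 1 <= y by lra.
    have h1 : `|incr k w| <= L * (y + alpha * L + mu) by exact: incr_bound.
    have h2 : incr k w ^+ 2 <= (L * (y + alpha * L + mu)) ^+ 2.
      rewrite -(ger0_norm (sqr_ge0 (incr k w))) normrX lerXn2r ?nnegrE//.
      by rewrite mulr_ge0//; lra.
    apply: le_trans h2 _; rewrite exprMn.
    have h3 : (y + alpha * L + mu) ^+ 2 <= 2 * (1 + (alpha * L + mu) ^+ 2) * y ^+ 2.
      have := sqr_ge0 (y - (alpha * L + mu)).
      have y2 : 1 <= y ^+ 2 by rewrite exprn_ege1.
      have := ler_wpM2l (sqr_ge0 (alpha * L + mu)) y2.
      rewrite mulr1 => h4 h5.
      rewrite -subr_ge0 (_ : _ - _ = (y - (alpha * L + mu)) ^+ 2 +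
        2 * ((alpha * L + mu) ^+ 2 * y ^+ 2 - (alpha * L + mu) ^+ 2)); last by ring.
      lra.
    have h4 : y ^+ 2 <= N^-1 * y ^+ 3.
      rewrite ler_pdivlMl; last by lra.
      rewrite (_ : y ^+ 3 = y * y ^+ 2); last by ring.
      by rewrite ler_wpM2r ?sqr_ge0// ltW.
    apply: le_trans (ler_wpM2l (sqr_ge0 L) h3) _.
    rewrite /v -/y (_ : _ / N * _ = L ^+ 2 * (2 * (1 + (alpha * L + mu) ^+ 2)) * (N^-1 * y ^+ 3)); last by ring.
    by rewrite [leLHS]mulrA ler_wpM2l// mulr_ge0 ?sqr_ge0// mulr_ge0// addr_ge0// sqr_ge0.
  right; have h1 := incr_bound L0 xL yN.
  rewrite normrM exprMn (_ : `|t| ^+ 3 = t ^+ 2 * `|t|); last first.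
    by rewrite -(ger0_norm t2) normrX; ring.
  rewrite -mulrA ler_wpM2l//.
  apply: (@le_trans _ _ (`|t| * B ^+ 3)).
    by rewrite ler_wpM2l// lerXn2r ?nnegrE// ltW.
  apply: (@le_trans _ _ (e / 3)); last by have := u0 w; have := v0 w; lra.
  by rewrite -ler_pdivlMr.
apply: le_mean => //; apply: (integ_le _ _ ig).
  apply: measurable_minr; first by apply: measurable_funX; apply: measurable_funM => //; exact: measurable_incr.
  apply: measurable_funX; apply: measurableT_comp => //.
  by apply: measurable_funM => //; exact: measurable_incr.
by move=> w; rewrite ger0_norm// le_min sqr_ge0 exprn_ge0.
Qed.

(** Controls the price of moving the cosine by one increment in front of the cubic function
    [g (X k.+1)]. The product of the increment with a cubic function need not be integrable, so the
    factor is capped at one and large states are charged to the uniform tails. *)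
Lemma increment_tail (e : R) : 0 < e -> exists2 tau : R, 0 < tau & forall t k, `|t| <= tau ->
  E (fun w => Num.min 1 `|t * incr k w| * (1 + (X k.+1 w)%:R ^+ 3)) <= e.
Proof.
move=> e0; have e4 : 0 < e / 4 by lra.
have /andP[a0 a1] := inar_alpha H; have m0 := mu_ge0.
have [C hC] := mean_X_bounded H.
pose C' := 1 + `|C|.
have C'0 : 0 < C' by have := normr_ge0 C; rewrite /C'; lra.
have C'1 k : E (fun w => (X k w)%:R ^+ 3) <= C'.
  by have := hC k 3%N isT; have := ler_norm C; rewrite /C'; lra.
have e8 : 0 < e / 8 by lra.
have [N N1 hN] := tail3_uniform e8.
have N3 : 0 < N ^+ 3 by rewrite exprn_gt0//; lra.
pose c := 2 * N ^+ 3 * C'.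
have c0 : 0 < c by rewrite /c mulr_gt0// mulr_gt0.
pose L := Num.max 1 (c / (e / 4)).
have L1 : 1 <= L by rewrite le_max lexx.
have cL : c / L <= e / 4.
  rewrite ler_pdivrMr; last by lra.
  by rewrite mulrC -ler_pdivrMr// le_max lexx orbT.
pose B := L * (N + alpha * L + mu).
have L0 : 0 <= L by lra.
have aL : 0 <= alpha * L by exact: (mulr_ge0 (ltW a0) L0).
have B0 : 0 < B by rewrite /B mulr_gt0//; lra.
have BN : 0 < B * (2 * N ^+ 3) by rewrite mulr_gt0// mulr_gt0.
exists (e / 4 / (B * (2 * N ^+ 3))); first by rewrite divr_gt0.
move=> t k ht.
have i3 := integ_X H k (leqnn 3); have it := integ_cubic H k.+1 (cubic_tail3 N).
have NL0 : 0 <= 2 * N ^+ 3 / L by apply: divr_ge0 => //; lra.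
pose g w := 2 * tail3 N (X k.+1 w) + 2 * N ^+ 3 / L * (X k w)%:R ^+ 3 + e / 4.
have ig : integ P g by apply: integD; [apply: integD; exact: integZ|exact: integ_cst].
apply: (@le_trans _ _ (E g)); last first.
  rewrite /g (meanD (integD (integZ _ it) (integZ _ i3)) (integ_cst _ _)).
  rewrite (meanD (integZ _ it) (integZ _ i3)) (meanZ _ it) (meanZ _ i3) mean_cst.
  have h1 : 2 * N ^+ 3 / L * E (fun w => (X k w)%:R ^+ 3) <= e / 4.
    by apply: le_trans cL; rewrite /c [leRHS]mulrAC ler_wpM2l.
  by have := hN k.+1; lra.
have hg w : Num.min 1 `|t * incr k w| * (1 + (X k.+1 w)%:R ^+ 3) <= g w.
  set y : R := (X k.+1 w)%:R.
  have y0 : 0 <= y by [].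
  have y3 : 0 <= y ^+ 3 by rewrite exprn_ge0.
  have t0 := tail3_ge0 N (X k.+1 w).
  have q0 : 0 <= 2 * N ^+ 3 / L * (X k w)%:R ^+ 3.
    by rewrite mulr_ge0 ?exprn_ge0.
  have m1 : Num.min 1 `|t * incr k w| <= 1 by rewrite ge_min lexx.
  have m2 : Num.min 1 `|t * incr k w| <= `|t * incr k w| by rewrite ge_min lexx orbT.
  have [yN|yN] := ltP N y.
    apply: (@le_trans _ _ (1 + y ^+ 3)); first by rewrite ler_piMl// addr_ge0.
    have : tail3 N (X k.+1 w) = y ^+ 3 by rewrite /tail3 -/y yN mul1r.
    rewrite /g => ->; have : 1 <= y ^+ 3 by rewrite exprn_ege1//; lra.
    lra.
  have hy : 1 + y ^+ 3 <= 2 * N ^+ 3.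
    have : y ^+ 3 <= N ^+ 3 by rewrite lerXn2r ?nnegrE//; lra.
    have : 1 <= N ^+ 3 by rewrite exprn_ege1.
    lra.
  have [xL|xL] := ltP L (X k w)%:R.
    apply: (@le_trans _ _ (2 * N ^+ 3)).
      by apply: le_trans hy; rewrite ler_piMl// addr_ge0.
    have : 2 * N ^+ 3 <= 2 * N ^+ 3 / L * (X k w)%:R ^+ 3.
      rewrite -[leRHS]mulrA ler_peMr//; first by lra.
      rewrite ler_pdivlMl; last by lra.
      rewrite mulr1; apply: le_trans (ltW xL) _.
      by rewrite -[leLHS]expr1 ler_weXn2l//; lra.
    by rewrite /g; lra.
  have h1 := incr_bound L0 xL yN.
  apply: (@le_trans _ _ (`|t| * B * (2 * N ^+ 3))).
    apply: ler_pM => //; rewrite ?le_min ?addr_ge0//=.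
    by apply: le_trans m2 _; rewrite normrM ler_wpM2l.
  by move: ht; rewrite ler_pdivlMr// mulrA /g; lra.
apply: le_mean => //; apply: (integ_le _ _ ig).
  apply: measurable_funM.
    apply: measurable_minr => //; apply: measurableT_comp => //.
    by apply: measurable_funM => //; exact: measurable_incr.
  exact: (measurable_rv (fun x => 1 + x%:R ^+ 3) (discrete_inar H k.+1)).
by move=> w; rewrite ger0_norm// mulr_ge0 ?addr_ge0 ?exprn_ge0// le_min ler01/=.
Qed.

End increments.

(** * Integrability of pointwise limits *)

Section fatou_mean.
Context {R : realType} {d : measure_display} {T : measurableType d}.
Variable P : probability T R.

Lemma integ_fatou (f : nat -> T -> R) (g : T -> R) C :
  (forall n, integ P (f n)) -> (forall n w, 0 <= f n w) ->
  (forall w, f n w @[n --> \oo] --> g w) -> (forall n, mean P (f n) <= C) ->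
  integ P g.
Proof.
move=> fi f0 fg fC.
have mf n := integ_measurable (fi n).
have mg : measurable_fun setT g.
  by apply: (measurable_fun_cvg mf) => w _; exact: fg.
have g0 w : 0 <= g w.
  rewrite -(cvg_lim (@Rhausdorff R) (fg w)); apply: limr_ge; last exact: nearW.
  by apply/cvg_ex; exists (g w); exact: fg.
apply/ge0_integP => //.
have mf' n : measurable_fun setT (fun w => (f n w)%:E) by exact/measurable_EFinP.
have f0' n w : setT w -> (0 <= (f n w)%:E)%E by rewrite lee_fin.
have := fatou P measurableT mf' f0'.
rewrite (eq_integral (fun w => (g w)%:E)); last first.
  move=> w _; have h : (f n w)%:E @[n --> \oo] --> (g w)%:E.
    by apply: cvg_EFin; [exact: nearW|exact: fg].
  by rewrite is_cvg_limn_einfE; [exact: cvg_lim h|apply/cvg_ex; exists (g w)%:E].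
move=> /le_lt_trans; apply; apply: (@le_lt_trans _ _ C%:E); last exact: ltry.
rewrite limn_einf_lim; apply: lime_le; first exact: is_cvg_einfs.
apply: nearW => n; apply: (@le_trans _ _ (\int[P]_w (f n w)%:E)%E).
  by apply: ereal_inf_lbound; exists n => /=.
by rewrite (meanE (fi n)) lee_fin.
Qed.

End fatou_mean.

(** * The stationary law as a probability measure on the integers *)

Section stationary_measure.
Context {R : realType}.
Variables (pi : nat -> R) (pi0 : forall n, 0 <= pi n).
Hypothesis pi1 : (\sum_(n <oo) (pi n)%:E = 1)%E.

(** A mixture of Dirac masses, built so that the expectation calculus above applies to the
    stationary law as well. *)
Definition pmf_measure : set nat -> \bar R :=
  mseries (fun n => mscale (NngNum (pi0 n)) (\d_n : {measure set nat -> \bar R})) 0.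

HB.instance Definition _ := Measure.on pmf_measure.

Let pmf_measureT : pmf_measure setT = 1%E.
Proof.
rewrite /pmf_measure /mseries -pi1; apply: eq_eseriesr => n _.
by rewrite -[LHS]/((pi n)%:E * \d_n setT)%E diracT mule1.
Qed.

HB.instance Definition _ := Measure_isProbability.Build _ _ _ pmf_measure pmf_measureT.

Definition pmf_prob : probability nat R := pmf_measure.

Lemma measurable_nat (f : nat -> R) : measurable_fun setT f.
Proof. by move=> _ B _; exact: measurableI. Qed.

Lemma integral_pmf (f : nat -> \bar R) : (forall n, 0 <= f n)%E ->
  (\int[pmf_prob]_n f n = \sum_(n <oo) (pi n)%:E * f n)%E.
Proof.
move=> f0; have mf : measurable_fun setT f by move=> _ B _; exact: measurableI.
rewrite [LHS]ge0_integral_measure_series//; apply: eq_eseriesr => n _.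
by rewrite ge0_integral_mscale//= integral_dirac// diracT mul1e.
Qed.

End stationary_measure.

(** * Moments of the stationary law and Poisson equations *)

Section stationary.
Context {R : realType} {d : measure_display} {T : measurableType d}.
Variables (P : probability T R) (alpha : R) (X0 : T -> nat) (eps : nat -> T -> nat).
Variables (xi : nat -> nat -> T -> nat) (mu sig2 : R).
Hypothesis H : inar_model P alpha X0 eps xi mu sig2.
Variable pi : nat -> R.
Hypothesis S : is_stationary alpha (eps_pmf P eps) pi.
Local Notation K := (Kmean P eps xi).
Local Notation b32 := (ker3 P alpha eps mu sig2).1.1.
Local Notation b31 := (ker3 P alpha eps mu sig2).1.2.
Local Notation b30 := (ker3 P alpha eps mu sig2).2.
Local Notation b21 := (ker2 alpha mu).
Local Notation Q := (pmf_prob S.1 S.2.1).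

Lemma stationary_integral (f : nat -> R) : (forall n, 0 <= f n) ->
  (\int[Q]_n (f n)%:E = \int[Q]_n Kop alpha (eps_pmf P eps) f n)%E.
Proof.
move=> f0; have a01 := inar_alpha H; have pm0 := eps_pmf_ge0 P eps.
have pi0 := S.1; have k0 n m := inar_kernel_ge0 a01 pm0 n m.
rewrite !integral_pmf; [|by move=> n; exact: Kop_ge0|by move=> n; rewrite lee_fin].
transitivity (\sum_(m <oo) \sum_(n <oo) (pi n * inar_kernel alpha (eps_pmf P eps) n m * f m)%:E)%E.
  apply: eq_eseriesr => m _; rewrite (S.2.2 m) muleC -nneseriesZl; last first.
    by move=> n _; rewrite lee_fin mulr_ge0.
  by apply: eq_eseriesr => n _; rewrite -EFinM mulrC.
rewrite nneseries_interchange; last by move=> n m; rewrite lee_fin !mulr_ge0.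
apply: eq_eseriesr => n _; rewrite /Kop -nneseriesZl; last first.
  by move=> m _; rewrite lee_fin mulr_ge0.
by apply: eq_eseriesr => m _; rewrite -EFinM; congr (_%:E); ring.
Qed.

Lemma stationary_mean (f : nat -> R) : (forall n, 0 <= f n) -> cubic f ->
  integ Q f -> integ Q (K f) /\ mean Q f = mean Q (K f).
Proof.
move=> f0 cf i; have := stationary_integral f0; rewrite (meanE i).
rewrite (eq_integral (fun n => (K f n)%:E)); last first.
  by move=> n _; rewrite (Kop_integral H)// (meanE (integ_step H n cf)).
move=> h; have iK : integ Q (K f).
  apply/ge0_integP; [exact: measurable_nat|by move=> n; exact: mean_ge0|].
  by rewrite -h ltry.
by split => //; move: h; rewrite (meanE iK) => -[].
Qed.

(* Truncating [f] at [N] commutes with the drift inequality by concavity, and the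
   truncated function is integrable, so stationarity can be used before
   integrability of [f] is known. *)
Lemma stationary_drift (f c : nat -> R) r : 0 <= r < 1 -> cubic f ->
  (forall n, 0 <= f n) -> (forall n, 0 <= c n) -> integ Q c ->
  (forall n, K f n <= r * f n + c n) -> integ Q f.
Proof.
move=> /andP[r0 r1] cf f0 c0 ic fc.
pose F N n := Num.min (f n) N%:R; pose G N n := Num.min (r * f n) N%:R.
have F0 N n : 0 <= F N n by rewrite le_min f0 ler0n.
have FN N n : F N n <= N%:R by rewrite ge_min lexx orbT.
have G0 N n : 0 <= G N n by rewrite le_min mulr_ge0 ?ler0n.
have GN N n : G N n <= N%:R by rewrite ge_min lexx orbT.
have iF N : integ Q (F N).
  by apply: (@integ_bounded _ _ _ _ N%:R); [exact: measurable_nat|move=> n; rewrite ger0_norm].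
have iG N : integ Q (G N).
  by apply: (@integ_bounded _ _ _ _ N%:R); [exact: measurable_nat|move=> n; rewrite ger0_norm].
have cF N : cubic (F N).
  by apply: cubic_dom cf _ => n; rewrite !ger0_norm// ge_min lexx.
have GF N n : G N n <= F N n.
  rewrite le_min GN andbT ge_min; apply/orP; left.
  by rewrite ler_piMl// ltW.
have KF N n : K (F N) n <= G N n + c n.
  have h1 : K (F N) n <= K f n.
    apply: le_mean; [exact: (integ_step H)|exact: (integ_step H)|].
    by move=> w; rewrite ge_min lexx.
  have h2 : K (F N) n <= N%:R.
    rewrite -(mean_cst P N%:R); apply: le_mean; [exact: (integ_step H)|exact: integ_cst|].
    by move=> w.
  have := fc n; have := c0 n; rewrite /G; case: (leP (r * f n) N%:R) => _; lra.
suff : integ Q (fun n => (1 - r) * f n).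
  move=> /(integZ (1 - r)^-1); congr integ; apply/funext => n.
  by rewrite mulKf// subr_eq0 gt_eqF.
apply: (@integ_fatou _ _ _ Q (fun N n => F N n - G N n) _ (mean Q c)).
(* [F N - G N] is non-negative and eventually equal to [(1 - r) * f]; by stationarity and [KF] its
   mean is at most that of [c], so Fatou's lemma concludes. *)
- by move=> N; exact: integB.
- by move=> N n; rewrite subr_ge0.
- move=> n; apply: cvg_near_cst; exists (Num.truncn (f n)).+1 => // N /= hN.
  have fN : f n <= N%:R.
    by have /ltW/le_trans := truncnS_gt (f n); apply; rewrite ler_nat.
  rewrite /F /G (min_idPl _)// (min_idPl _); last first.
    by apply: le_trans fN; rewrite ler_piMl// ltW.
  by ring.
- move=> N; rewrite (meanB (iF N) (iG N)).
  have [iK e] := stationary_mean (F0 N) (cF N) (iF N).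
  rewrite lerBlDl e -(meanD (iG N) ic); apply: le_mean => //.
  exact: integD.
Qed.

Let coef_bound (x y : R) : 0 <= y -> x * y <= `|x| * y.
Proof. by move=> y0; rewrite ler_wpM2r// ler_norm. Qed.

Lemma stationary_integ1 : integ Q (fun n => n%:R).
Proof.
apply: (@stationary_drift _ (fun=> `|mu|) alpha) => //.
- by rewrite -[alpha]expr1; exact: (alpha_exp H).
- exact: (@cubic_pow _ 1).
- exact: integ_cst.
- by move=> n; rewrite (Kmean_id H) lerD2l ler_norm.
Qed.

Lemma stationary_integ2 : integ Q (fun n => n%:R ^+ 2).
Proof.
have i1 := stationary_integ1.
have c0 (n : nat) : 0 <= `|b21| * n%:R + `|sig2 + mu ^+ 2| by rewrite addr_ge0// mulr_ge0.
have ic := integD (integZ `|b21| i1) (integ_cst Q `|sig2 + mu ^+ 2|).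
apply: (stationary_drift (alpha_exp H (isT : (0 < 2)%N)) _ _ c0 ic).
- exact: (@cubic_pow _ 2).
- by move=> n; exact: sqr_ge0.
- by move=> n; rewrite (Kmean_sqr H) -addrA lerD2l lerD ?ler_norm// coef_bound.
Qed.

Lemma stationary_integ3 : integ Q (fun n => n%:R ^+ 3).
Proof.
have i1 := stationary_integ1; have i2 := stationary_integ2.
have c0 (n : nat) : 0 <= `|b32| * n%:R ^+ 2 + `|b31| * n%:R + `|b30|.
  by rewrite !addr_ge0// mulr_ge0// sqr_ge0.
have ic := integD (integD (integZ `|b32| i2) (integZ `|b31| i1)) (integ_cst Q `|b30|).
apply: (stationary_drift (alpha_exp H (isT : (0 < 3)%N)) _ _ c0 ic).
- exact: (@cubic_pow _ 3).
- by move=> n; exact: exprn_ge0.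
- move=> n; rewrite (Kmean_cube H) -!addrA lerD2l !addrA.
  by rewrite !lerD ?ler_norm// coef_bound// sqr_ge0.
Qed.

Lemma momentE k : (k <= 3)%N -> moment pi k = mean Q (fun n => n%:R ^+ k).
Proof.
move=> _; rewrite /moment /mean /Rintegral; congr fine.
rewrite integral_pmf; last by move=> n; rewrite lee_fin exprn_ge0.
by apply: eq_eseriesr => n _; rewrite -EFinM mulrC.
Qed.

Lemma moment1E : moment pi 1 = mean Q (fun n => n%:R).
Proof. exact: (@momentE 1). Qed.

Lemma moment1_eq : moment pi 1 = alpha * moment pi 1 + mu.
Proof.
have i1 := stationary_integ1; have c1 : cubic (fun y => y%:R : R) by exact: (@cubic_pow _ 1).
rewrite {1}moment1E (stationary_mean _ c1 i1).2//.
under eq_mean do rewrite (Kmean_id H).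
by rewrite (meanD (integZ _ i1) (integ_cst _ _)) (meanZ _ i1) mean_cst moment1E.
Qed.

Lemma moment2_eq : moment pi 2 = alpha ^+ 2 * moment pi 2 + b21 * moment pi 1 + (sig2 + mu ^+ 2).
Proof.
have i1 := stationary_integ1; have i2 := stationary_integ2.
have n0 (n : nat) : 0 <= n%:R ^+ 2 :> R by exact: sqr_ge0.
rewrite {1}momentE// {1}(stationary_mean n0 (@cubic_pow _ 2 isT) i2).2//.
under eq_mean do rewrite (Kmean_sqr H).
rewrite (meanD (integD (integZ _ i2) (integZ _ i1)) (integ_cst _ _)).
by rewrite (meanD (integZ _ i2) (integZ _ i1)) (meanZ _ i2) (meanZ _ i1) mean_cst moment1E momentE.
Qed.

Lemma moment3_eq : moment pi 3 = alpha ^+ 3 * moment pi 3 + b32 * moment pi 2 +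
  b31 * moment pi 1 + b30.
Proof.
have i1 := stationary_integ1; have i2 := stationary_integ2; have i3 := stationary_integ3.
have n0 (n : nat) : 0 <= n%:R ^+ 3 :> R by exact: exprn_ge0.
rewrite {1}momentE// {1}(stationary_mean n0 (@cubic_pow _ 3 isT) i3).2//.
under eq_mean do rewrite (Kmean_cube H).
have j := integD (integZ (alpha ^+ 3) i3) (integZ b32 i2).
rewrite (meanD (integD j (integZ _ i1)) (integ_cst _ _)) (meanD j (integZ _ i1)).
rewrite (meanD (integZ _ i3) (integZ _ i2)) (meanZ _ i3) (meanZ _ i2) (meanZ _ i1) mean_cst.
by rewrite moment1E !momentE.
Qed.

Let poly1 x : x%:R - moment pi 1 = x%:R / (1 - alpha) - K (fun y => y%:R / (1 - alpha)) x.
Proof.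
have /andP[a0 a1] := inar_alpha H.
rewrite (_ : (fun y : nat => _) = fun y => (1 - alpha)^-1 * y%:R); last first.
  by apply/funext => y; rewrite mulrC.
rewrite (KmeanZ H); last exact: (@cubic_pow _ 1).
rewrite (Kmean_id H); have := moment1_eq; set m := moment pi 1 => e.
have -> : mu = (1 - alpha) * m by lra.
by field; rewrite subr_eq0 gt_eqF.
Qed.

(** The operator maps a monomial of degree [n] to [alpha ^+ n] times itself plus lower degrees. A
    Poisson equation is therefore solved degree by degree: divide by [1 - alpha ^+ n], correct with
    the solutions of lower degree, and cancel the constants by the stationary moment identities. *)
Lemma poisson1 : exists A, forall x, x%:R - moment pi 1 = A * x%:R - K (fun y => A * y%:R) x.
Proof.
exists (1 - alpha)^-1 => x; rewrite poly1 mulrC.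
have -> : (fun y : nat => y%:R / (1 - alpha)) = (fun y => (1 - alpha)^-1 * y%:R).
  by apply/funext => y; rewrite mulrC.
by [].
Qed.

Lemma poisson2 : exists A B, forall x, x%:R ^+ 2 - moment pi 2 =
  (A * x%:R ^+ 2 + B * x%:R) - K (fun y => A * y%:R ^+ 2 + B * y%:R) x.
Proof.
have /andP[a0 a1] := inar_alpha H; have /andP[_ a2] := alpha_exp H (isT : (0 < 2)%N).
have [A1 h1] := poisson1.
pose c := (1 - alpha ^+ 2)^-1.
have cK : c * (1 - alpha ^+ 2) = 1 by rewrite mulVf// subr_eq0 gt_eqF.
exists c, (c * b21 * A1) => x.
have c1 : cubic (fun y => y%:R : R) by exact: (@cubic_pow _ 1).
have c2 := @cubic_pow R 2 isT.
rewrite (KmeanD H); [|exact: cubicZ|exact: cubicZ].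
rewrite !(KmeanZ H)// (Kmean_sqr H) (Kmean_id H).
have := h1 x; rewrite (KmeanZ H)// (Kmean_id H) => h1'.
have := moment2_eq; set m2 := moment pi 2; set m1 := moment pi 1 in h1' * => e.
have -> : sig2 + mu ^+ 2 = (1 - alpha ^+ 2) * m2 - b21 * m1 by lra.
transitivity (c * (1 - alpha ^+ 2) * (x%:R ^+ 2 - m2) - c * b21 * (x%:R - m1) +
  c * b21 * (A1 * x%:R - A1 * (alpha * x%:R + mu))); last by ring.
by rewrite -h1' cK; ring.
Qed.

Lemma poisson3 : exists2 g, cubic g & forall x, x%:R ^+ 3 - moment pi 3 = g x - K g x.
Proof.
have /andP[_ a3] := alpha_exp H (isT : (0 < 3)%N).
have [A1 h1] := poisson1; have [A [B h2]] := poisson2.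
pose c := (1 - alpha ^+ 3)^-1.
have cK : c * (1 - alpha ^+ 3) = 1 by rewrite mulVf// subr_eq0 gt_eqF.
have c1 : cubic (fun y => y%:R : R) by exact: (@cubic_pow _ 1).
have c2 := @cubic_pow R 2 isT; have c3 := @cubic_pow R 3 isT.
pose g2 (y : nat) := A * y%:R ^+ 2 + B * y%:R; pose g1 (y : nat) := A1 * y%:R.
have cg2 : cubic g2 by apply: cubicD; exact: cubicZ.
have cg1 : cubic g1 by exact: cubicZ.
have cd1 := cubicZ (c * b32) cg2; have cd2 := cubicZ (c * b31) cg1.
have cd3 := cubicZ c c3; have cd4 := cubicD cd1 cd2.
exists (fun y => c * y%:R ^+ 3 + (c * b32 * g2 y + c * b31 * g1 y)).
  exact: cubicD cd3 cd4.
move=> x; rewrite !(KmeanD H)// (KmeanZ H _ x c3) (KmeanZ H _ x cg2) (KmeanZ H _ x cg1) (Kmean_cube H).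
have h1' : x%:R - moment pi 1 = g1 x - K g1 x by exact: h1.
have h2' : x%:R ^+ 2 - moment pi 2 = g2 x - K g2 x by exact: h2.
have := moment3_eq; set m3 := moment pi 3; set m2 := moment pi 2 in h2' *;
  set m1 := moment pi 1 in h1' * => e.
have -> : b30 = (1 - alpha ^+ 3) * m3 - b32 * m2 - b31 * m1 by lra.
transitivity (c * (1 - alpha ^+ 3) * (x%:R ^+ 3 - m3) - c * b32 * (x%:R ^+ 2 - m2)
  - c * b31 * (x%:R - m1) + c * b32 * (g2 x - K g2 x) + c * b31 * (g1 x - K g1 x)); last by ring.
by rewrite -h1' -h2' cK; ring.
Qed.

(** The stationary mean of [cond_var], equal to [sigma2_ae] times the square of the second
    moment. *)
Definition incr_var : R := alpha * (1 - alpha) * moment pi 3 + sig2 * moment pi 2.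

Lemma poisson_cond_var : exists2 g, cubic g &
  forall x, cond_var alpha sig2 x - incr_var = g x - K g x.
Proof.
have [A [B h2]] := poisson2; have [g3 cg3 h3] := poisson3.
pose g2 (y : nat) := A * y%:R ^+ 2 + B * y%:R.
have cg2 : cubic g2.
  by apply: cubicD; apply: cubicZ; [exact: cubic_pow|exact: (@cubic_pow _ 1)].
have d3 := cubicZ (alpha * (1 - alpha)) cg3; have d2 := cubicZ sig2 cg2.
exists (fun y => alpha * (1 - alpha) * g3 y + sig2 * g2 y); first exact: cubicD d3 d2.
move=> x; rewrite (KmeanD H)// (KmeanZ H _ x cg3) (KmeanZ H _ x cg2).
have h2' : x%:R ^+ 2 - moment pi 2 = g2 x - K g2 x by exact: h2.
rewrite /cond_var /incr_var.
transitivity (alpha * (1 - alpha) * (x%:R ^+ 3 - moment pi 3) + sig2 * (x%:R ^+ 2 - moment pi 2)).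
  by ring.
by rewrite h3 h2'; ring.
Qed.

(** The indicator of a non-zero innovation is at most the innovation. Positivity of [mu] makes the
    stationary second moment positive, by which the score is divided. *)
Lemma mu_gt0 : 0 < mu.
Proof.
have m0 := mu_ge0 H; rewrite lt_neqAle m0 andbT; apply/eqP => e0.
have mA : measurable (eps 0%N @^-1` [set n | n != 0%N]).
  by apply: discrete_rv_set; exact: discrete_eps H.
have := inar_eps_neq0 H; apply/negP; rewrite -leNgt.
have i1 := integ_eps H (isT : (1 <= 3)%N).
rewrite -(@fineK _ (P _)) ?fin_num_measure// -mean_indic// lee_fin e0 -(eps_moment1 H).
apply: le_mean => //.
  apply: (@integ_bounded _ _ _ _ 1); first exact: measurable_indic.
  by move=> w; rewrite indicE; case: (_ \in _); rewrite ?normr1 ?normr0.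
move=> w; rewrite expr1 indicE; case: (boolP (w \in _)) => //.
by rewrite inE /= -lt0n => h; rewrite ler1n.
Qed.

Lemma moment2_gt0 : 0 < moment pi 2.
Proof.
have /andP[a0 a1] := inar_alpha H; have mu0 := mu_gt0.
have m1 : 0 < moment pi 1.
  have := moment1_eq; set m := moment pi 1 => e.
  have : 0 < (1 - alpha) * m by lra.
  by rewrite pmulr_rgt0// subr_gt0.
apply: lt_le_trans m1 _; rewrite !momentE//; apply: le_mean.
- exact: stationary_integ1.
- exact: stationary_integ2.
- by move=> n; rewrite expr1 -natrX ler_nat; case: n => // n; rewrite leq_pmulr.
Qed.

Lemma incr_var_ge0 : 0 <= incr_var.
Proof.
have /andP[a0 a1] := inar_alpha H.
have ? : 0 <= moment pi 3 by rewrite momentE//; apply: mean_ge0 => n; exact: exprn_ge0.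
rewrite addr_ge0 ?mulr_ge0 ?(sig2_ge0 H) ?(ltW moment2_gt0) ?subr_ge0 ?(ltW a0) ?(ltW a1)//.
Qed.

End stationary.

(** * Inequalities for the cosine, the exponential and a smoothed absolute value *)

Section elementary.
Context {R : realType}.
Implicit Types x s d : R.

Lemma norm_sin_le x : `|sin x| <= `|x|.
Proof.
wlog x0 : x / 0 <= x => [h|].
  by have [/h//|/ltW x0] := leP 0 x; rewrite -normrN -sinN -[`|x|]normrN h// oppr_ge0.
have [|c _] := @MVT_segment R (@sin R) (@cos R) 0 x x0.
  by apply: continuous_subspaceT => y; exact: continuous_sin.
by rewrite sin0 !subr0 => ->; rewrite normrM ler_piMl// cos_max.
Qed.

Lemma onem_cosE x : 1 - cos x = 2 * sin (x / 2) ^+ 2.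
Proof.
rewrite {1}(_ : x = (x / 2) *+ 2); last by rewrite -mulr_natr; field.
by rewrite cos_mulr2n cos2sin2; ring.
Qed.

Lemma onem_cos_ge0 x : 0 <= 1 - cos x.
Proof. by rewrite onem_cosE mulr_ge0// sqr_ge0. Qed.

Lemma onem_cos_le x : 1 - cos x <= x ^+ 2 / 2.
Proof.
rewrite onem_cosE; have := norm_sin_le (x / 2).
have h : sin (x / 2) ^+ 2 = `|sin (x / 2)| ^+ 2 by rewrite -normrX ger0_norm ?sqr_ge0.
have h' : (x / 2) ^+ 2 = `|x / 2| ^+ 2 by rewrite -normrX ger0_norm ?sqr_ge0.
rewrite -(@ler_pXn2r _ 2)// ?nnegrE// -h -h'; nra.
Qed.

Lemma norm_sinB_le x : `|x - sin x| <= `|x| ^+ 3 / 2.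
Proof.
wlog x0 : x / 0 <= x => [h|].
  have [/h//|/ltW x0] := leP 0 x; rewrite -normrN -[`|x|]normrN.
  rewrite (_ : - (x - sin x) = - x - sin (- x)); first by apply: h; rewrite oppr_ge0.
  by rewrite sinN; ring.
have [|c] := @MVT_segment R (fun y => y - sin y) (fun y => 1 - cos y) 0 x x0.
  apply: continuous_subspaceT => y; apply: cvgB; first exact: cvg_id.
  exact: continuous_sin.
rewrite in_itv /= => /andP[c0 cx]; rewrite sin0 !subr0 => ->.
rewrite ger0_norm; last by rewrite mulr_ge0// onem_cos_ge0.
rewrite ger0_norm//; have := onem_cos_le c.
have : c ^+ 2 <= x ^+ 2 by rewrite lerXn2r ?nnegrE.
move=> h1 h2; have : (1 - cos c) * x <= x ^+ 2 / 2 * x by rewrite ler_wpM2r//; lra.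
by move=> /le_trans; apply; rewrite le_eqVlt; apply/orP; left; apply/eqP; ring.
Qed.

Lemma cos_quad_ge0 x : 0 <= cos x - 1 + x ^+ 2 / 2.
Proof. by have := onem_cos_le x; lra. Qed.

Lemma cos_quad_le4 x : cos x - 1 + x ^+ 2 / 2 <= `|x| ^+ 4 / 8.
Proof.
rewrite (_ : cos x - 1 + _ = x ^+ 2 / 2 - (1 - cos x)); last by ring.
rewrite onem_cosE.
rewrite (_ : _ - _ = 2 * ((x / 2 - sin (x / 2)) * (x / 2 + sin (x / 2)))); last by field.
apply: le_trans (ler_norm _) _; rewrite normrM normrM (ger0_norm (ler0n _ _)).
have h1 := norm_sinB_le (x / 2).
have h2 : `|x / 2 + sin (x / 2)| <= 2 * `|x / 2|.
  by apply: le_trans (ler_normD _ _) _; have := norm_sin_le (x / 2); lra.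
have := ler_pM (normr_ge0 _) (normr_ge0 _) h1 h2.
rewrite normrM (ger0_norm (_ : 0 <= 2^-1 :> R))// => h.
apply: (@le_trans _ _ (2 * ((`|x| / 2) ^+ 3 / 2 * (2 * (`|x| / 2))))).
  by rewrite ler_wpM2l.
by rewrite le_eqVlt; apply/orP; left; apply/eqP; field.
Qed.

Lemma le_min_pow23 x c : (`|x| <= 1 -> c <= `|x| ^+ 3) -> (1 < `|x| -> c <= x ^+ 2) ->
  c <= Num.min (x ^+ 2) (`|x| ^+ 3).
Proof.
have e : x ^+ 2 = `|x| ^+ 2 by rewrite -normrX ger0_norm ?sqr_ge0.
rewrite le_min; have [x1 h _|x1 _ h] := leP `|x| 1; apply/andP; split; try exact: h.
  by rewrite e; apply: le_trans (h isT) _; rewrite ler_wiXn2l.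
by apply: le_trans (h isT) _; rewrite e ler_weXn2l// ltW.
Qed.

(** Near zero the remainder is cubic; for large [d] only a quadratic bound may be paid for, because
    increments have two moments. The constant is [1] from the cosine part plus [2] from the sine
    part of the addition formula. *)
Lemma cos_taylor s d : `|cos (s + d) - (cos s - d * sin s - d ^+ 2 / 2 * cos s)| <=
  3 * Num.min (d ^+ 2) (`|d| ^+ 3).
Proof.
set m := Num.min _ _.
have e : d ^+ 2 = `|d| ^+ 2 by rewrite -normrX ger0_norm ?sqr_ge0.
rewrite cosD (_ : _ - _ = cos s * (cos d - 1 + d ^+ 2 / 2) + sin s * (d - sin d)); last by ring.
apply: le_trans (ler_normD _ _) _; rewrite !normrM.
have h1 : `|cos d - 1 + d ^+ 2 / 2| <= m.
  rewrite ger0_norm ?cos_quad_ge0//; apply: le_min_pow23 => d1.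
    have := cos_quad_le4 d; have : `|d| ^+ 4 <= `|d| ^+ 3 by rewrite ler_wiXn2l.
    have : 0 <= `|d| ^+ 3 by rewrite exprn_ge0.
    lra.
  by have := cos_le1 d; have := sqr_ge0 d; lra.
have h2 : `|d - sin d| <= 2 * m.
  rewrite -ler_pdivrMl//; apply: le_min_pow23 => d1.
    have := norm_sinB_le d; have : 0 <= `|d| ^+ 3 by rewrite exprn_ge0.
    lra.
  have := ler_normB d (sin d); have := norm_sin_le d.
  have : `|d| <= `|d| ^+ 2 by rewrite expr2 ler_peMl// ltW.
  rewrite e; lra.
have := ler_pM (normr_ge0 _) (normr_ge0 _) (cos_max s) h1.
have := ler_pM (normr_ge0 _) (normr_ge0 _) (sin_max s) h2.
rewrite !mul1r; lra.
Qed.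

Lemma cos_lipschitz s d : `|cos (s + d) - cos s| <= 2 * Num.min 1 `|d|.
Proof.
have e : d ^+ 2 = `|d| ^+ 2 by rewrite -normrX ger0_norm ?sqr_ge0.
case: (leP 1 `|d|) => d1.
  by have := ler_normB (cos (s + d)) (cos s); have := cos_max (s + d); have := cos_max s; lra.
rewrite cosD (_ : _ - _ = - (cos s * (1 - cos d) + sin s * sin d)); last by ring.
rewrite normrN; apply: le_trans (ler_normD _ _) _; rewrite !normrM.
have h1 : `|1 - cos d| <= `|d|.
  rewrite ger0_norm ?onem_cos_ge0//; have := onem_cos_le d.
  have : `|d| ^+ 2 <= `|d| by rewrite expr2 ler_piMl// ltW.
  have := normr_ge0 d; rewrite e; lra.
have := ler_pM (normr_ge0 _) (normr_ge0 _) (cos_max s) h1.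
have := ler_pM (normr_ge0 _) (normr_ge0 _) (sin_max s) (norm_sin_le d).
rewrite !mul1r; lra.
Qed.

Lemma expRN_quad x : 0 <= x -> `|expR (- x) - (1 - x)| <= x ^+ 2.
Proof.
move=> x0; have x1 : 0 < 1 + x by lra.
have h1 := expR_ge1Dx (- x).
rewrite ger0_norm; last by lra.
have h2 : expR (- x) <= (1 + x)^-1.
  by rewrite expRN lef_pV2 ?posrE ?expR_gt0// expR_ge1Dx.
have h3 : (1 + x)^-1 <= 1 - x + x ^+ 2.
  rewrite -[leLHS]mul1r ler_pdivrMr// (_ : _ * _ = 1 + x ^+ 3); last by ring.
  by rewrite lerDl exprn_ge0.
lra.
Qed.

(** Smooth and comparable to [|s|]. Its second-order remainder is quadratic for small and linear for
    large displacements, which suits martingale differences without a second moment. *)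
Definition psi (s : R) : R := Num.sqrt (1 + s ^+ 2).
Definition dpsi (s : R) : R := s / psi s.

Lemma psi_sqr s : psi s ^+ 2 = 1 + s ^+ 2.
Proof. by rewrite sqr_sqrtr// addr_ge0// sqr_ge0. Qed.

Lemma psi_ge1 s : 1 <= psi s.
Proof.
rewrite -(@ler_pXn2r _ 2)// ?nnegrE ?sqrtr_ge0// psi_sqr expr1n.
by have := sqr_ge0 s; lra.
Qed.

Lemma norm_le_psi s : `|s| <= psi s.
Proof.
rewrite -(@ler_pXn2r _ 2)// ?nnegrE ?sqrtr_ge0// psi_sqr -normrX ger0_norm ?sqr_ge0//.
by lra.
Qed.

Lemma psi_le s : psi s <= 1 + `|s|.
Proof.
rewrite -(@ler_pXn2r _ 2)// ?nnegrE ?sqrtr_ge0 ?addr_ge0// psi_sqr.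
have e : s ^+ 2 = `|s| ^+ 2 by rewrite -normrX ger0_norm ?sqr_ge0.
by have := normr_ge0 s; rewrite sqrrD e expr1n mul1r -mulr_natr; lra.
Qed.

Lemma le_psi s t : `|s| <= `|t| -> psi s <= psi t.
Proof.
move=> st; rewrite /psi ler_wsqrtr// lerD2l -[s ^+ 2]ger0_norm ?sqr_ge0//.
by rewrite -[t ^+ 2]ger0_norm ?sqr_ge0// !normrX lerXn2r ?nnegrE.
Qed.

Lemma dpsi_le1 s : `|dpsi s| <= 1.
Proof.
have p1 := psi_ge1 s; rewrite normrM normfV (ger0_norm (_ : 0 <= psi s)); last by lra.
by rewrite ler_pdivrMr ?mul1r ?norm_le_psi//; lra.
Qed.

(** The quadratic bound is the inequality [2 * psi s * psi (s + d) <= psi s ^+ 2 + psi (s + d) ^+ 2]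
    divided by [psi s >= 1]; the linear one uses that [psi] is 1-Lipschitz. *)
Lemma psi_taylor s d : psi (s + d) <= psi s + dpsi s * d + Num.min (d ^+ 2) (2 * `|d|).
Proof.
have p1 := psi_ge1 s; have p0 : 0 < psi s by lra.
case: (leP (d ^+ 2) (2 * `|d|)) => _.
  have h : 2 * psi s * psi (s + d) <= psi s ^+ 2 + psi (s + d) ^+ 2.
    by have := sqr_ge0 (psi s - psi (s + d)); nra.
  rewrite -(ler_pM2l p0) /dpsi.
  rewrite (_ : psi s * (_ + _) = psi s ^+ 2 + s * d + psi s * d ^+ 2); last first.
    by field; rewrite gt_eqF.
  have : d ^+ 2 <= psi s * d ^+ 2 by rewrite ler_peMl ?sqr_ge0.
  move: h; rewrite !psi_sqr; have := sqr_ge0 d; nra.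
have h1 : psi (s + d) <= psi s + `|d|.
  rewrite -(@ler_pXn2r _ 2)// ?nnegrE ?sqrtr_ge0 ?addr_ge0 ?sqrtr_ge0//.
  have e : d ^+ 2 = `|d| ^+ 2 by rewrite -normrX ger0_norm ?sqr_ge0.
  have h2 : s * d <= psi s * `|d|.
    by apply: le_trans (ler_norm _) _; rewrite normrM ler_wpM2r// norm_le_psi.
  rewrite [leRHS]sqrrD !psi_sqr -e -mulr_natr sqrrD -mulr_natr; lra.
have h2 : - `|d| <= dpsi s * d.
  rewrite lerNl; apply: le_trans (ler_norm _) _; rewrite normrN normrM.
  by rewrite ler_piMl// dpsi_le1.
lra.
Qed.

End elementary.

(** The factor is at most one, so errors add up without amplification. *)
Lemma exp_recursion (R : realType) (u : nat -> R) q err m : 0 <= q ->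
  (forall k, (k < m)%N -> `|u k.+1 - expR (- q) * u k| <= err) ->
  `|u m - expR (- (q * m%:R)) * u 0%N| <= m%:R * err.
Proof.
move=> q0; elim: m => [|m ih] h.
  by rewrite mulr0 oppr0 expR0 mul1r subrr normr0 mul0r.
have e1 : expR (- q) <= 1 by rewrite -expR0 ler_expR oppr_le0.
have {}ih := ih (fun k km => h k (leqW km)).
have hm := h m (ltnSn m).
rewrite (_ : _ - _ = (u m.+1 - expR (- q) * u m) +
    expR (- q) * (u m - expR (- (q * m%:R)) * u 0%N)); last first.
  rewrite -natr1 mulrDr mulr1 opprD expRD; ring.
apply: le_trans (ler_normD _ _) _; rewrite normrM (ger0_norm (expR_ge0 _)).
rewrite -natr1 mulrDl mul1r addrC; apply: lerD => //.
by apply: le_trans ih; rewrite ler_piMl.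
Qed.

Lemma invn_cvg0 (R : realType) k0 : (m + k0)%:R^-1 @[m --> \oo] --> (0 : R).
Proof.
rewrite (cvg_shiftn k0 (fun m : nat => (m%:R : R)^-1)).
rewrite -(cvg_shiftS (fun m : nat => (m%:R : R)^-1)); exact: cvg_harmonic.
Qed.

Lemma sqrt_invn_cvg0 (R : realType) (th : R) k0 :
  th / Num.sqrt (m + k0)%:R @[m --> \oo] --> (0 : R).
Proof.
rewrite -[X in _ --> X](mulr0 th); apply: cvgMl_tmp.
rewrite -[X in _ --> X](@sqrtr0 R).
under eq_fun do rewrite -sqrtrV//.
exact: (continuous_cvg _ (@sqrt_continuous R 0) (invn_cvg0 k0)).
Qed.

(** * Convergence of the weighted cosine transforms *)

Section limit_theorems.
Context {R : realType} {d : measure_display} {T : measurableType d}.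
Variables (P : probability T R) (alpha : R) (X0 : T -> nat) (eps : nat -> T -> nat).
Variables (xi : nat -> nat -> T -> nat) (mu sig2 : R).
Hypothesis H : inar_model P alpha X0 eps xi mu sig2.
Variable pi : nat -> R.
Hypothesis S : is_stationary alpha (eps_pmf P eps) pi.
Local Notation X := (inar X0 eps xi).
Local Notation path := (path_to X0 eps xi).
Local Notation E := (mean P).
Local Notation K := (Kmean P eps xi).
Local Notation D := (incr alpha X0 eps xi mu).
Local Notation v := (incr_var alpha sig2 pi).

(** Measurability with respect to the first [k] steps, in factorised form: a function of the
    path. *)
Definition adapted k (f : T -> R) := exists h : seq nat -> R, forall w, f w = h (path k w).

Lemma adapted_measurable k f : adapted k f -> measurable_fun setT f.
Proof. by move=> [h fh]; rewrite (funext fh); exact: (measurable_path1 H k h). Qed.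

Lemma adaptedW k k' f : (k <= k')%N -> adapted k f -> adapted k' f.
Proof.
move=> kk' [h fh]; exists (fun p => h (take k.+1 p)) => w; rewrite fh; congr h.
by rewrite /path_to -map_take take_iota (minn_idPl _).
Qed.

Lemma adapted2 k (op : R -> R -> R) f g : adapted k f -> adapted k g ->
  adapted k (fun w => op (f w) (g w)).
Proof.
by move=> [h fh] [h' gh']; exists (fun p => op (h p) (h' p)) => w; rewrite fh gh'.
Qed.

Lemma adapted1 k (op : R -> R) f : adapted k f -> adapted k (fun w => op (f w)).
Proof. by move=> [h fh]; exists (fun p => op (h p)) => w; rewrite fh. Qed.

Lemma adapted_X k j (f : nat -> R) : (j <= k)%N -> adapted k (fun w => f (X j w)).
Proof. by move=> jk; exists (fun p => f (nth 0%N p j)) => w; rewrite path_to_nth. Qed.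

Lemma adapted_sum k (f : nat -> T -> R) n : (forall j, (j < n)%N -> adapted k (f j)) ->
  adapted k (fun w => \sum_(j < n) f j w).
Proof.
elim: n => [|n ih] h.
  by exists (fun=> 0) => w; rewrite big_ord0.
rewrite (_ : (fun w => _) = fun w => \sum_(j < n) f j w + f n w); last first.
  by apply/funext => w; rewrite big_ord_recr.
by apply: (adapted2 +%R); [apply: ih => j jn; apply: h; exact: leqW|exact: h].
Qed.

(** The bound is known only at realised paths, while the Markov lemmas want it at every list; the
    factor is reset to zero wherever it is too large. *)
Lemma adapted_bounded k f C : adapted k f -> (forall w, `|f w| <= C) ->
  exists2 h : seq nat -> R, (forall w, f w = h (path k w)) & forall p, `|h p| <= `|C|.
Proof.
move=> [h fh] fC; exists (fun p => if `|h p| <= C then h p else 0) => [w|p].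
  by rewrite -fh fC.
case: ifP => [hp|_]; last by rewrite normr0.
exact: le_trans hp (ler_norm _).
Qed.

Lemma adapted_incr k j : (j < k)%N -> adapted k (D j).
Proof.
move=> jk; apply: (adapted2 (fun x y => x * (y - alpha * x - mu))).
  exact: (adapted_X (fun x => x%:R) (ltnW jk)).
exact: (adapted_X (fun x => x%:R) jk).
Qed.

Lemma mean_adapted_incr k f C : adapted k f -> (forall w, `|f w| <= C) ->
  E (fun w => f w * D k w) = 0.
Proof.
move=> af fC; have [h fh hC] := adapted_bounded af fC.
by rewrite -(mean_incr H k hC); apply: eq_mean => w; rewrite fh.
Qed.

Lemma mean_adapted_incr2 k f C : adapted k f -> (forall w, `|f w| <= C) ->
  E (fun w => f w * D k w ^+ 2) = E (fun w => f w * cond_var alpha sig2 (X k w)).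
Proof.
move=> af fC; have [h fh hC] := adapted_bounded af fC.
have := mean_incr2 H k hC; rewrite (eq_mean P (g := fun w => f w * D k w ^+ 2)).
  by move=> ->; apply: eq_mean => w; rewrite fh.
by move=> w; rewrite fh.
Qed.

Lemma mean_adapted_next k f C (g : nat -> R) : adapted k f -> (forall w, `|f w| <= C) ->
  cubic g -> E (fun w => f w * g (X k.+1 w)) = E (fun w => f w * K g (X k w)).
Proof.
move=> af fC cg; have [h fh hC] := adapted_bounded af fC.
have := mean_next H k hC cg; rewrite (eq_mean P (g := fun w => f w * g (X k.+1 w))).
  by move=> ->; apply: eq_mean => w; rewrite fh.
by move=> w; rewrite fh.
Qed.

Definition martingale n w : R := \sum_(k < n) D k w.

Lemma adapted_martingale n : adapted n (martingale n).
Proof. by apply: adapted_sum => j jn; exact: adapted_incr. Qed.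

Section cosine.
Variables (k0 : nat) (a : T -> R).
Hypotheses (aa : adapted k0 a) (a1 : forall w, `|a w| <= 1).
Variable g : nat -> R.
Hypotheses (cg : cubic g) (gP : forall x, cond_var alpha sig2 x - v = g x - K g x).

Let char t phi k := E (fun w => a w * cos (t * martingale k w + phi)).
Let corrected t phi k := E (fun w => a w * cos (t * martingale k w + phi) *
  (1 - t ^+ 2 / 2 * g (X k w))).

Let norm_aM w x : `|x| <= 1 -> `|a w * x| <= 1.
Proof. by move=> x1; rewrite normrM -[leRHS]mulr1 ler_pM. Qed.

Let adapted_char t phi k : (k0 <= k)%N ->
  adapted k (fun w => a w * cos (t * martingale k w + phi)).
Proof.
move=> k0k; apply: (adapted2 *%R); first exact: adaptedW aa.
exact: (adapted1 (fun s => cos (t * s + phi)) (adapted_martingale k)).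
Qed.

Let correctedE t phi k : (k0 <= k)%N -> corrected t phi k = char t phi k -
  t ^+ 2 / 2 * E (fun w => a w * cos (t * martingale k w + phi) * g (X k w)).
Proof.
move=> k0k; have ac := adapted_char t phi k0k.
have mc := adapted_measurable ac.
have ic : integ P (fun w => a w * cos (t * martingale k w + phi)).
  by apply: (@integ_bounded _ _ _ _ 1) => // w; exact/norm_aM/cos_max.
have ig : integ P (fun w => a w * cos (t * martingale k w + phi) * g (X k w)).
  apply: (@integMb _ _ _ _ 1) => //; first by move=> w; exact/norm_aM/cos_max.
  exact: (integ_cubic H).
rewrite /char -(meanZ _ ig) -(meanB ic (integZ _ ig)).
by apply: eq_mean => w; ring.
Qed.

(** Expand the cosine around [s]. The linear term vanishes, and the quadratic one yields [v] times
    the transform plus [g (X k) - K g (X k)], where [K g (X k)] may be replaced by [g (X k.+1)].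
    These [g] terms are the difference of the corrections at times [k] and [k.+1], except that the
    cosine in front of [g (X k.+1)] still sits at the old position ([R2]). [R1] is the Taylor
    remainder, and a term of order [t ^+ 4] comes from multiplying the correction by the factor. *)
Lemma clt_step t phi e C C' k : (k0 <= k)%N -> 0 <= C ->
  (forall y, `|g y| <= C * (1 + y%:R ^+ 3)) ->
  (forall k, E (fun w => `|g (X k w)|) <= C') ->
  E (fun w => Num.min ((t * D k w) ^+ 2) (`|t * D k w| ^+ 3)) <= e * t ^+ 2 ->
  E (fun w => Num.min 1 `|t * D k w| * (1 + (X k.+1 w)%:R ^+ 3)) <= e ->
  `|corrected t phi k.+1 - (1 - t ^+ 2 / 2 * v) * corrected t phi k| <=
    t ^+ 2 / 2 * ((6 + 2 * C) * e + t ^+ 2 / 2 * v * C').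
Proof.
move=> k0k C0 gC gC' lind tail.
rewrite (correctedE _ _ k0k) (correctedE _ _ (leqW k0k)).
pose s w := t * martingale k w + phi.
have sS w : t * martingale k.+1 w + phi = s w + t * D k w.
  by rewrite /martingale big_ord_recr /= /s /martingale; ring.
have ac := adapted_char t phi k0k.
have asn : adapted k (fun w => a w * sin (s w)).
  apply: (adapted2 *%R); first exact: adaptedW aa.
  exact: (adapted1 (fun s => sin (t * s + phi)) (adapted_martingale k)).
have nc w : `|a w * cos (s w)| <= 1 by exact/norm_aM/cos_max.
have ns w : `|a w * sin (s w)| <= 1 by exact/norm_aM/sin_max.
have mc := adapted_measurable ac; have ms := adapted_measurable asn.
have acS := adapted_char t phi (leqW k0k); have mcS := adapted_measurable acS.
have iD := integ_incr H k; have iD2 := integ_incr2 H k.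
have icg := integ_cubic H k cg; have icgS := integ_cubic H k.+1 cg.
have i1 : integ P (fun w => a w * cos (s w)) by exact: (@integ_bounded _ _ _ _ 1).
have i2 := integMb ms ns iD.
have i3 := integMb mc nc iD2.
have i4 := integMb mc nc icg.
have i5 := integMb mc nc icgS.
have iS : integ P (fun w => a w * cos (t * martingale k.+1 w + phi)).
  by apply: (@integ_bounded _ _ _ _ 1) => // w; exact/norm_aM/cos_max.
have iSg : integ P (fun w => a w * cos (t * martingale k.+1 w + phi) * g (X k.+1 w)).
  by apply: (@integMb _ _ _ _ 1) => // w; exact/norm_aM/cos_max.
have cV := cubic_cond_var alpha sig2.
have iV := integMb mc nc (integ_cubic H k cV).
set R1 := E (fun w => a w * cos (t * martingale k.+1 w + phi)) -
  (char t phi k - t * E (fun w => a w * sin (s w) * D k w) -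
   t ^+ 2 / 2 * E (fun w => a w * cos (s w) * D k w ^+ 2)).
set R2 := E (fun w => a w * cos (t * martingale k.+1 w + phi) * g (X k.+1 w)) -
  E (fun w => a w * cos (s w) * g (X k.+1 w)).
have t2 : 0 <= t ^+ 2 / 2 by rewrite divr_ge0// sqr_ge0.
have R1le : `|R1| <= 3 * (e * t ^+ 2).
  have j := integB (integB i1 (integZ t i2)) (integZ (t ^+ 2 / 2) i3).
  rewrite /R1 /char -(meanZ _ i2) -(meanZ _ i3) -(meanB i1 (integZ t i2)).
  rewrite -(meanB (integB i1 (integZ t i2)) (integZ (t ^+ 2 / 2) i3)) -(meanB iS j).
  have im : integ P (fun w => Num.min ((t * D k w) ^+ 2) (`|t * D k w| ^+ 3)).
    apply: (@integ_le _ _ _ _ (fun w => t ^+ 2 * D k w ^+ 2)); last exact: integZ.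
      apply: (adapted_measurable (k := k.+1)).
      exact: (adapted1 (fun y => Num.min ((t * y) ^+ 2) (`|t * y| ^+ 3)) (adapted_incr (ltnSn k))).
    move=> w; rewrite ger0_norm; first by rewrite ge_min exprMn lexx.
    by rewrite le_min sqr_ge0 exprn_ge0.
  apply: (@le_trans _ _ (E (fun w => 3 * Num.min ((t * D k w) ^+ 2) (`|t * D k w| ^+ 3)))).
    apply: norm_mean_le; [exact: integB|exact: integZ|].
    move=> w; rewrite sS.
    have := cos_taylor (s w) (t * D k w); set m := Num.min _ _ => h.
    rewrite (_ : _ - _ = a w * (cos (s w + t * D k w) - (cos (s w) - t * D k w * sin (s w) -
      (t * D k w) ^+ 2 / 2 * cos (s w)))); last by rewrite -/(s w); ring.
    by rewrite normrM -[leRHS]mul1r ler_pM.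
  by rewrite (meanZ _ im) ler_wpM2l.
have R2le : `|R2| <= 2 * C * e.
  rewrite /R2 -(meanB iSg i5).
  pose m w := Num.min 1 `|t * D k w| * (1 + (X k.+1 w)%:R ^+ 3).
  have im : integ P m.
    have i3X := integD (integ_cst P 1) (integ_X H k.+1 (leqnn 3)).
    apply: (@integMb _ _ _ _ 1 _ _ _ _ i3X).
      apply: (adapted_measurable (k := k.+1)).
      exact: (adapted1 (fun y => Num.min 1 `|t * y|) (adapted_incr (ltnSn k))).
    by move=> w; rewrite ger0_norm ?ge_min ?lexx// le_min ler01 /=.
  apply: (@le_trans _ _ (E (fun w => 2 * C * m w))).
    apply: norm_mean_le; [exact: integB|exact: integZ|].
    move=> w; rewrite sS -/(s w).
    rewrite (_ : _ - _ = a w * ((cos (s w + t * D k w) - cos (s w)) * g (X k.+1 w))); last by ring.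
    rewrite normrM -[leRHS]mul1r ler_pM// normrM.
    rewrite (_ : 2 * C * m w = (2 * Num.min 1 `|t * D k w|) * (C * (1 + (X k.+1 w)%:R ^+ 3))).
      by rewrite ler_pM// cos_lipschitz.
    by rewrite /m; ring.
  by rewrite (meanZ _ im) ler_wpM2l// mulr_ge0.
have e1 : E (fun w => a w * sin (s w) * D k w) = 0 by exact: (mean_adapted_incr asn ns).
have e2 : E (fun w => a w * cos (s w) * D k w ^+ 2) =
    v * char t phi k + E (fun w => a w * cos (s w) * g (X k w)) -
    E (fun w => a w * cos (s w) * g (X k.+1 w)).
  rewrite (mean_adapted_incr2 ac nc).
  rewrite /char -(meanZ _ i1) -(meanD (integZ _ i1) i4).
  rewrite (mean_adapted_next ac nc cg).
  have iK : integ P (fun w => a w * cos (s w) * K g (X k w)).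
    have eK w : a w * cos (s w) * K g (X k w) = a w * cos (s w) * g (X k w) -
        a w * cos (s w) * (cond_var alpha sig2 (X k w)) + v * (a w * cos (s w)).
      have := gP (X k w) => h; have -> : K g (X k w) = g (X k w) - (cond_var alpha sig2 (X k w) - v) by rewrite h; ring.
      by ring.
    rewrite (funext eK); exact: (integD (integB i4 iV) (integZ v i1)).
  rewrite -(meanB (integD (integZ _ i1) i4) iK); apply: eq_mean => w.
  have h := gP (X k w).
  have -> : cond_var alpha sig2 (X k w) = v + (g (X k w) - K g (X k w)) by rewrite -h; ring.
  by rewrite -/(s w); ring.
have e3 : `|E (fun w => a w * cos (s w) * g (X k w))| <= C'.
  apply: le_trans (gC' k); apply: norm_mean_le => //; first exact: integ_norm.
  by move=> w; rewrite normrM -[leRHS]mul1r ler_pM.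
set u := char t phi k in R1 R1le e2 *.
set Eg := E (fun w => a w * cos (s w) * g (X k w)) in e2 e3 *.
set EgS := E (fun w => a w * cos (s w) * g (X k.+1 w)) in e2 R2 R2le *.
set A := E (fun w => a w * cos (t * martingale k.+1 w + phi)) in R1 R1le *.
set B := E (fun w => a w * cos (t * martingale k.+1 w + phi) * g (X k.+1 w)) in R2 R2le *.
rewrite -/A.
have -> : char t phi k.+1 = A by [].
rewrite (_ : _ - _ = R1 - t ^+ 2 / 2 * R2 - (t ^+ 2 / 2) ^+ 2 * v * Eg); last first.
  by rewrite /R1 /R2 e1 e2; field.
have v0 : 0 <= v := incr_var_ge0 H S.
apply: le_trans (ler_normB _ _) _; apply: le_trans (lerD (ler_normB _ _) (lexx _)) _.
have tv : 0 <= (t ^+ 2 / 2) ^+ 2 * v by rewrite mulr_ge0// sqr_ge0.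
rewrite (normrM (t ^+ 2 / 2)) (normrM ((t ^+ 2 / 2) ^+ 2 * v)) (ger0_norm t2) (ger0_norm tv).
have h2 := ler_wpM2l t2 R2le.
have h3 := ler_wpM2l tv e3.
rewrite (_ : t ^+ 2 / 2 * (_ + _) = 3 * (e * t ^+ 2) + t ^+ 2 / 2 * (2 * C * e) +
  (t ^+ 2 / 2) ^+ 2 * v * C'); last by field.
by apply: lerD => //; exact: lerD.
Qed.

Theorem cos_clt th phi :
  char (th / Num.sqrt n%:R) phi n @[n --> \oo] -->
    E a * cos phi * expR (- (th ^+ 2 / 2 * v)).
Proof.
rewrite -(cvg_shiftn k0) /=.
have v0 : 0 <= v := incr_var_ge0 H S.
have [C1 gC1] := cg.
pose C := 4 * `|C1|.
have C0 : 0 <= C by rewrite mulr_ge0.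
have gC y : `|g y| <= C * (1 + y%:R ^+ 3).
  apply: le_trans (gC1 y) _; apply: (@le_trans _ _ (`|C1| * (y%:R + 1) ^+ 3)).
    by rewrite ler_wpM2r ?ler_norm// exprn_ge0// addr_ge0.
  rewrite /C (mulrC 4) -mulrA ler_wpM2l//.
  by have := cube_split (ler0n R y) (@ler01 R); rewrite expr1n; lra.
have [C2 hC2] := mean_X_bounded H.
pose C' := C * (1 + C2).
have gC' k : E (fun w => `|g (X k w)|) <= C'.
  have i3 := integ_X H k (leqnn 3); have i13 := integD (integ_cst P 1) i3.
  apply: (@le_trans _ _ (E (fun w => C * (1 + (X k w)%:R ^+ 3)))).
    apply: le_mean; [by apply: integ_norm; exact: (integ_cubic H k cg)|exact: integZ|].
    by move=> w; exact: gC.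
  rewrite (meanZ _ i13) (meanD (integ_cst _ _) i3) mean_cst ler_wpM2l// lerD2l.
  exact: hC2.
have C'0 : 0 <= C' by apply: le_trans (gC' 0%N); apply: mean_ge0.
pose t m := th / Num.sqrt (m + k0)%:R.
pose kap m := th ^+ 2 / 2 * (m + k0)%:R^-1.
have tE m : t m ^+ 2 / 2 = kap m.
  by rewrite /t /kap exprMn exprVn sqr_sqrtr//; ring.
have kap0 m : 0 <= kap m by rewrite -tE divr_ge0// sqr_ge0.
have kapc : kap m @[m --> \oo] --> (0 : R).
  by rewrite -[X in _ --> X](mulr0 (th ^+ 2 / 2)); apply: cvgMl_tmp; exact: invn_cvg0.
have kapm m : m%:R * kap m <= th ^+ 2 / 2.
  rewrite /kap mulrCA ler_piMr// ?divr_ge0 ?sqr_ge0//.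
  have [->|m0] := posnP (m + k0); first by rewrite invr0 mulr0.
  by rewrite ler_pdivrMr ?ltr0n// mul1r ler_nat leq_addr.
have kapn m : kap m * m%:R = th ^+ 2 / 2 * (m + k0)%:R * (m + k0)%:R^-1 - kap m * k0%:R.
  by rewrite /kap natrD; ring.
(* The value predicted by the exact geometric recursion from time [k0]; its second factor tends to
   the mean of [a] times [cos phi] because [martingale k0] is fixed while [t m] tends to zero. *)
pose z m := expR (- (kap m * v * m%:R)) * char (t m) phi k0.
have zc : z m @[m --> \oo] --> E a * cos phi * expR (- (th ^+ 2 / 2 * v)).
  rewrite mulrC; apply: cvgM.
    apply: continuous_cvg; first exact: continuous_expR.
    apply: cvgN; under eq_fun do rewrite mulrAC kapn.
    apply: cvgMr_tmp; rewrite -[X in _ --> X]subr0; apply: cvgB; last first.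
      by rewrite -[X in _ --> X](mul0r k0%:R); exact: cvgMr_tmp.
    apply: cvg_near_cst; exists 1%N => // m /= m1.
    by rewrite mulfK// pnatr_eq0 -lt0n addn_gt0 m1.
  have ma := adapted_measurable aa.
  have ia : integ P a by exact: (@integ_bounded _ _ _ _ 1).
  rewrite -[E a * _]mulrC -(meanZ _ ia).
  apply: (@mean_dominated _ _ _ P (fun m w => a w * cos (t m * martingale k0 w + phi))
    _ (fun=> 1)).
  - by move=> m; exact: adapted_measurable (adapted_char (t m) phi (leqnn k0)).
  - exact: integ_cst.
  - by move=> m w; exact/norm_aM/cos_max.
  - move=> w; rewrite mulrC; apply: cvgMl_tmp.
    apply: continuous_cvg; first exact: continuous_cos.
    rewrite -[X in _ --> X]add0r; apply: cvgD; last exact: cvg_cst.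
    rewrite -[X in _ --> X](mul0r (martingale k0 w)); apply: cvgMr_tmp.
    exact: sqrt_invn_cvg0.
suff dz : (char (t m) phi (m + k0)%N - z m) @[m --> \oo] --> (0 : R).
  have h := cvgD dz zc; rewrite add0r in h.
  have e : (fun m => char (t m) phi (m + k0)%N) =
      (fun m => char (t m) phi (m + k0)%N - z m) + z.
    by apply/funext => m; rewrite fctE subrK.
  by rewrite /t in e *; rewrite e; exact: h.
apply/cvgrPdist_le => e e0.
pose c := th ^+ 2 / 2 * (6 + 2 * C) + 1.
have th0 : 0 <= th ^+ 2 / 2 by rewrite divr_ge0// sqr_ge0.
have c0 : 0 < c by rewrite /c ltr_wpDl// mulr_ge0//; lra.
pose e' := e / 2 / c.
have e'0 : 0 < e' by rewrite !divr_gt0.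
have [tau1 tau10 lind] := lindeberg H e'0.
have [tau2 tau20 tail] := increment_tail H e'0.
(* Collects the coefficients of all errors of order [kap m]: the [t ^+ 4] terms, the replacement of
   [1 - q] by [exp (- q)], and [2 * C'] for removing the correction at both ends. *)
pose M := th ^+ 2 / 2 * v * C' + th ^+ 2 / 2 * v ^+ 2 * (1 + C') + 2 * C' + 1.
have M0 : 0 < M.
  have p1 : 0 <= th ^+ 2 / 2 * v * C' by exact: (mulr_ge0 (mulr_ge0 th0 v0) C'0).
  have p2 : 0 <= th ^+ 2 / 2 * v ^+ 2 * (1 + C').
    exact: (mulr_ge0 (mulr_ge0 th0 (sqr_ge0 v)) (addr_ge0 ler01 C'0)).
  by rewrite /M; lra.
have tc : t m @[m --> \oo] --> (0 : R) by exact: sqrt_invn_cvg0.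
have small (u : nat -> R) b : u m @[m --> \oo] --> (0 : R) -> 0 < b ->
    \forall m \near \oo, `|u m| <= b.
  move=> /cvgrPdist_le uc /uc; apply: filterS => m; by rewrite sub0r normrN.
have n1 := small _ _ tc tau10; have n2 := small _ _ tc tau20.
have n3 := small _ _ kapc ltr01.
have n4 := small _ _ kapc (divr_gt0 (divr_gt0 e0 (ltr0n R 2)) M0).
near=> m.
have tm1 : `|t m| <= tau1 by near: m.
have tm2 : `|t m| <= tau2 by near: m.
have km1 : kap m <= 1 by rewrite -[kap m]ger0_norm//; near: m.
have km2 : kap m * M <= e / 2.
  by rewrite -ler_pdivlMr// -[kap m]ger0_norm//; near: m.
rewrite sub0r normrN.
have gE k : (k0 <= k)%N ->
    `|E (fun w => a w * cos (t m * martingale k w + phi) * g (X k w))| <= C'.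
  move=> k0k; apply: le_trans (gC' k); apply: norm_mean_le.
  - apply: (@integMb _ _ _ _ 1) => //; last exact: (integ_cubic H k cg).
      exact: adapted_measurable (adapted_char (t m) phi k0k).
    by move=> w; exact/norm_aM/cos_max.
  - by apply: integ_norm; exact: (integ_cubic H k cg).
  - by move=> w; rewrite normrM -[leRHS]mul1r ler_pM//; exact/norm_aM/cos_max.
have charle k : (k0 <= k)%N -> `|char (t m) phi k| <= 1.
  move=> k0k; rewrite -[leRHS](mean_cst P); apply: norm_mean_le; last first.
  - by move=> w; exact/norm_aM/cos_max.
  - exact: integ_cst.
  - apply: (@integ_bounded _ _ _ _ 1); last by move=> w; exact/norm_aM/cos_max.
    exact: adapted_measurable (adapted_char (t m) phi k0k).
have cchar k : (k0 <= k)%N -> `|corrected (t m) phi k - char (t m) phi k| <= kap m * C'.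
  move=> k0k; rewrite correctedE// tE addrAC subrr sub0r normrN normrM ger0_norm//.
  by rewrite ler_wpM2l// gE.
have corle k : (k0 <= k)%N -> `|corrected (t m) phi k| <= 1 + C'.
  move=> k0k; have := cchar k k0k; have := charle k k0k.
  have := ler_normD (corrected (t m) phi k - char (t m) phi k) (char (t m) phi k).
  rewrite subrK; have : kap m * C' <= C' by rewrite ler_piMl.
  by lra.
pose err := kap m * ((6 + 2 * C) * e' + kap m * v * C') + (kap m * v) ^+ 2 * (1 + C').
have q0 : 0 <= kap m * v by rewrite mulr_ge0.
have stp k : (k < m)%N -> `|corrected (t m) phi (k.+1 + k0)%N -
    expR (- (kap m * v)) * corrected (t m) phi (k + k0)%N| <= err.
  move=> _; have := @clt_step (t m) phi e' C C' (k + k0)%N (leq_addl _ _) C0 gC gC'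
    (lind _ _ tm1) (tail _ _ tm2); rewrite tE => h.
  rewrite addSn (_ : _ - _ = (corrected (t m) phi (k + k0).+1 -
     (1 - kap m * v) * corrected (t m) phi (k + k0)%N) -
     (expR (- (kap m * v)) - (1 - kap m * v)) * corrected (t m) phi (k + k0)%N); last by ring.
  apply: le_trans (ler_normB _ _) _; apply: lerD => //.
  by rewrite normrM ler_pM// ?expRN_quad// corle// leq_addl.
have := exp_recursion (u := fun k => corrected (t m) phi (k + k0)%N) q0 stp.
rewrite add0n => h.
have p1 : 0 <= v * C' by exact: mulr_ge0.
have p2 : 0 <= v ^+ 2 * (1 + C') by rewrite mulr_ge0 ?sqr_ge0 ?addr_ge0.
have p3 : 0 <= kap m * (v * C' + v ^+ 2 * (1 + C')) by rewrite mulr_ge0// addr_ge0.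
have p4 : 0 <= (6 + 2 * C) * e' by rewrite mulr_ge0 ?(ltW e'0)// addr_ge0// mulr_ge0.
have merr : m%:R * err <= e / 2 + kap m * (M - 2 * C').
  rewrite /err (_ : m%:R * _ = m%:R * kap m * ((6 + 2 * C) * e' + kap m * (v * C' + v ^+ 2 * (1 + C')))); last by ring.
  have nn : 0 <= (6 + 2 * C) * e' + kap m * (v * C' + v ^+ 2 * (1 + C')).
    exact: addr_ge0.
  apply: le_trans (ler_wpM2r nn (kapm m)) _.
  have ce : c * e' = e / 2 by rewrite /e' mulrC divfK// gt_eqF.
  have : th ^+ 2 / 2 * (6 + 2 * C) * e' <= c * e' by rewrite ler_wpM2r ?(ltW e'0)// /c; lra.
  by rewrite ce /M; have := kap0 m; lra.
have h1 := cchar _ (leq_addl m k0); have h2 := cchar _ (leqnn k0).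
have h3 : `|expR (- (kap m * v * m%:R)) * (corrected (t m) phi k0 - char (t m) phi k0)| <= kap m * C'.
  rewrite normrM (ger0_norm (expR_ge0 _)); apply: le_trans h2; rewrite ler_piMl//.
  by rewrite -expR0 ler_expR oppr_le0 mulr_ge0.
rewrite (_ : _ - z m = - (corrected (t m) phi (m + k0)%N - char (t m) phi (m + k0)%N) +
  (corrected (t m) phi (m + k0)%N - expR (- (kap m * v * m%:R)) * corrected (t m) phi k0) +
  expR (- (kap m * v * m%:R)) * (corrected (t m) phi k0 - char (t m) phi k0)); last first.
  by rewrite /z; ring.
apply: le_trans (ler_normD _ _) _; apply: le_trans (lerD (ler_normD _ _) (lexx _)) _.
rewrite normrN; move: km2 merr h h1 h3; rewrite mulrBr; lra.
Unshelve. all: by end_near. Qed.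

End cosine.

End limit_theorems.

(** * Tightness of the score and the law of large numbers for squares *)

Section law_of_large_numbers.
Context {R : realType} {d : measure_display} {T : measurableType d}.
Variables (P : probability T R) (alpha : R) (X0 : T -> nat) (eps : nat -> T -> nat).
Variables (xi : nat -> nat -> T -> nat) (mu sig2 : R).
Hypothesis H : inar_model P alpha X0 eps xi mu sig2.
Variable pi : nat -> R.
Hypothesis S : is_stationary alpha (eps_pmf P eps) pi.
Local Notation X := (inar X0 eps xi).
Local Notation E := (mean P).
Local Notation K := (Kmean P eps xi).
Local Notation D := (incr alpha X0 eps xi mu).
Local Notation mart := (martingale alpha X0 eps xi mu).
Local Notation adapted := (adapted X0 eps xi).

Lemma measurable_psi : measurable_fun setT (psi : R -> R).
Proof.
apply: continuous_measurable_fun => x; apply: (@continuous_comp _ _ _ (fun s : R => 1 + s ^+ 2)).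
  by apply: cvgD; [exact: cvg_cst|exact: exprn_continuous].
exact: sqrt_continuous.
Qed.

(** Add one difference at a time: the linear term of [psi_taylor] has zero mean because [dpsi] of
    the past is bounded and adapted, so only remainders accumulate. The leading [1] is [psi 0]. *)
Lemma mean_psi_le (dl : nat -> T -> R) n b : (forall k, adapted k.+1 (dl k)) ->
  (forall k, integ P (dl k)) ->
  (forall k f C, adapted k f -> (forall w, `|f w| <= C) -> E (fun w => f w * dl k w) = 0) ->
  (forall k, E (fun w => Num.min (dl k w ^+ 2) (2 * `|dl k w|)) <= b) ->
  integ P (fun w => psi (\sum_(k < n) dl k w)) /\
  E (fun w => psi (\sum_(k < n) dl k w)) <= 1 + n%:R * b.
Proof.
move=> ad id od bd.
have isum n' : integ P (fun w => \sum_(k < n') dl k w) by exact: integ_sum.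
have asum n' : adapted n' (fun w => \sum_(k < n') dl k w).
  by apply: adapted_sum => j jn; exact: adaptedW (ad j).
have ipsi n' : integ P (fun w => psi (\sum_(k < n') dl k w)).
  apply: (@integ_le _ _ _ _ (fun w => 1 + `|\sum_(k < n') dl k w|)).
  - by apply: measurableT_comp; [exact: measurable_psi|exact: integ_measurable].
  - by move=> w; rewrite ger0_norm ?sqrtr_ge0 ?psi_le.
  - by apply: integD; [exact: integ_cst|exact/integ_norm/isum].
split => //; elim: n => [|n ih].
  under eq_mean do rewrite big_ord0 /psi expr0n /= addr0 sqrtr1.
  by rewrite mean_cst mul0r addr0.
have ag : adapted n (fun w => dpsi (\sum_(k < n) dl k w)) by exact: (adapted1 _ (asum n)).
have ig : integ P (fun w => dpsi (\sum_(k < n) dl k w) * dl n w).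
  apply: (integMb _ (C := 1)) => //; first exact: (adapted_measurable H ag).
  by move=> w; exact: dpsi_le1.
have im : integ P (fun w => Num.min (dl n w ^+ 2) (2 * `|dl n w|)).
  apply: (@integ_le _ _ _ _ (fun w => 2 * `|dl n w|)).
  - apply: (adapted_measurable H (k := n.+1)).
    exact: (adapted1 (fun x => Num.min (x ^+ 2) (2 * `|x|)) (ad n)).
  - by move=> w; rewrite ger0_norm ?ge_min ?lexx ?orbT// le_min sqr_ge0 mulr_ge0.
  - by apply: integZ; exact: integ_norm.
apply: (@le_trans _ _ (E (fun w => psi (\sum_(k < n) dl k w) +
    dpsi (\sum_(k < n) dl k w) * dl n w + Num.min (dl n w ^+ 2) (2 * `|dl n w|)))).
  apply: le_mean; [exact: ipsi|exact: (integD (integD (ipsi n) ig) im)|].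
  by move=> w; rewrite big_ord_recr /=; exact: psi_taylor.
rewrite (meanD (integD (ipsi n) ig) im) (meanD (ipsi n) ig).
rewrite (od n _ 1 ag); last by move=> w; exact: dpsi_le1.
by have := bd n; rewrite -natr1; lra.
Qed.

(** Squared increments have uniformly bounded means and [n * t ^+ 2 <= 1] for [t] the inverse root
    of [n], so the mean of [psi] stays bounded; Markov's inequality with [|s| <= psi s] gives the
    tail. *)
Lemma martingale_tight e : 0 < e -> exists2 B : R, 0 < B & forall n,
  E (fun w => (B < `|mart n w / Num.sqrt n%:R|)%R%:R) <= e.
Proof.
move=> e0; have [C0 hC0] := mean_X_bounded H.
have cV := cubic_cond_var alpha sig2; have [C1 hC1] := cV.
pose C := `|C1| * (4 * `|C0| + 4).
have C_ge0 : 0 <= C by rewrite mulr_ge0 ?addr_ge0 ?mulr_ge0.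
have hD k : E (fun w => D k w ^+ 2) <= C.
  have i3 := integ_X H k (leqnn 3).
  rewrite (eq_mean P (g := fun w => 1 * D k w ^+ 2)); last by move=> w; rewrite mul1r.
  rewrite (mean_adapted_incr2 H (k := k) (f := fun=> 1) (C := 1)); last 2 first.
  - by exists (fun=> 1).
  - by move=> w; rewrite normr1.
  apply: (@le_trans _ _ (E (fun w => `|C1| * (4 * (X k w)%:R ^+ 3 + 4)))).
    apply: le_mean.
    - under eq_fun do rewrite mul1r; exact: (integ_cubic H k cV).
    - exact: (integZ _ (integD (integZ _ i3) (integ_cst _ _))).
    - move=> w; rewrite mul1r; apply: le_trans (ler_norm _) _.
      apply: le_trans (hC1 _) _; apply: (@le_trans _ _ (`|C1| * ((X k w)%:R + 1) ^+ 3)).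
        by rewrite ler_wpM2r ?ler_norm// exprn_ge0// addr_ge0.
      by rewrite ler_wpM2l//; have := cube_split (ler0n R (X k w)) (@ler01 R); rewrite expr1n mulr1.
  rewrite (meanZ _ (integD (integZ _ i3) (integ_cst _ _))) (meanD (integZ _ i3) (integ_cst _ _)).
  rewrite (meanZ _ i3) mean_cst ler_wpM2l// lerD2r ler_wpM2l//.
  exact: le_trans (hC0 _ 3%N isT) (ler_norm _).
exists ((1 + C) / e); first by rewrite divr_gt0//; lra.
move=> n; pose t : R := (Num.sqrt n%:R)^-1.
have nt : n%:R * t ^+ 2 <= 1.
  rewrite /t exprVn sqr_sqrtr//; have [->|n0] := posnP n; first by rewrite mul0r.
  by rewrite mulfV// pnatr_eq0 -lt0n.
have [||||i le1] := @mean_psi_le (fun k w => t * D k w) n (t ^+ 2 * C).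
- by move=> k; exact: (adapted1 (fun x => t * x) (adapted_incr _ _ _ _ _ (ltnSn k))).
- by move=> k; apply: integZ; exact: (integ_incr H).
- move=> k f c af fc; under eq_mean do rewrite mulrCA.
  rewrite meanZ; first by rewrite (mean_adapted_incr H af fc) mulr0.
  by apply: (integMb (adapted_measurable H af) fc); exact: (integ_incr H).
- move=> k; have i2 := integ_incr2 H k.
  apply: (@le_trans _ _ (E (fun w => t ^+ 2 * D k w ^+ 2))).
    apply: le_mean; [|exact: integZ|by move=> w; rewrite ge_min exprMn lexx].
    apply: (@integ_le _ _ _ _ (fun w => t ^+ 2 * D k w ^+ 2)); last exact: integZ.
      apply: (adapted_measurable H (k := k.+1)).
      exact: (adapted1 (fun x => Num.min ((t * x) ^+ 2) (2 * `|t * x|)) (adapted_incr _ _ _ _ _ (ltnSn k))).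
    move=> w; rewrite ger0_norm; first by rewrite ge_min exprMn lexx.
    by rewrite le_min sqr_ge0 mulr_ge0.
  by rewrite (meanZ _ i2) ler_wpM2l ?sqr_ge0.
have hle : E (fun w => psi (\sum_(k < n) t * D k w)) <= 1 + C.
  by apply: le_trans le1 _; rewrite lerD2l mulrA ler_piMl.
pose B := (1 + C) / e.
have B0 : 0 < B by rewrite divr_gt0//; lra.
apply: (@le_trans _ _ (E (fun w => B^-1 * psi (\sum_(k < n) t * D k w)))).
  apply: le_mean; [|exact: integZ|].
    apply: (@integ_bounded _ _ _ _ 1).
      apply: (adapted_measurable H (k := n)).
      exact: (adapted1 (fun x => (B < `|x / Num.sqrt n%:R|)%R%:R) (adapted_martingale _ _ _ _ _ n)).
    by move=> w; case: (_ < _); rewrite ?normr1 ?normr0.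
  move=> w; rewrite -mulr_sumr -/(mart n w) (mulrC t); case: ltP => [h|_]; last first.
    by rewrite mulr_ge0 ?sqrtr_ge0 ?invr_ge0// ltW.
  by rewrite ler_pdivlMl// mulr1; apply: le_trans (ltW h) _; exact: norm_le_psi.
rewrite (meanZ _ i) -ler_pdivlMl ?invr_gt0// invrK; apply: le_trans hle _.
by rewrite /B divfK// gt_eqF.
Qed.

(** Put [r = q / sqrt n], so that [|x| <= C * r ^+ 2]. The quadratic branch gives [r ^+ 4] when
    [r <= 1], the linear one [r ^+ 2] when [r > 1], and both are at most [r ^+ 3]. Third moments of
    [q] then give [n] terms of size [n] to the power [-3/2]. *)
Lemma lln_weight (C q : R) n (x : R) : 0 <= C -> 0 <= q -> (0 < n)%N -> `|x| <= C * q ^+ 2 / n%:R ->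
  Num.min (x ^+ 2) (2 * `|x|) <= (C ^+ 2 + 2 * C) * (q ^+ 3 * (Num.sqrt n%:R)^-1 ^+ 3).
Proof.
move=> C0 q0 n0 xC.
pose s : R := (Num.sqrt n%:R)^-1; pose r := q * s.
have s0 : 0 <= s by rewrite invr_ge0 sqrtr_ge0.
have r0 : 0 <= r by rewrite mulr_ge0.
have s2 : s ^+ 2 = n%:R^-1 by rewrite /s exprVn sqr_sqrtr.
have xr : `|x| <= C * r ^+ 2 by rewrite exprMn s2 mulrA.
rewrite -exprMn -/s -/r [leRHS]mulrDl ge_min.
have r3 : 0 <= r ^+ 3 by rewrite exprn_ge0.
have t1 : 0 <= 2 * C * r ^+ 3 by rewrite mulr_ge0// mulr_ge0.
have t2 : 0 <= C ^+ 2 * r ^+ 3 by rewrite mulr_ge0// sqr_ge0.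
have [r1|r1] := leP r 1; apply/orP.
  left; apply: (@le_trans _ _ (C ^+ 2 * r ^+ 3)); last by lra.
  rewrite -[x ^+ 2]ger0_norm ?sqr_ge0// normrX.
  apply: (@le_trans _ _ ((C * r ^+ 2) ^+ 2)).
    by rewrite lerXn2r ?nnegrE// mulr_ge0// sqr_ge0.
  by rewrite exprMn ler_wpM2l ?sqr_ge0// -exprM ler_wiXn2l.
right; apply: (@le_trans _ _ (2 * C * r ^+ 3)); last by lra.
rewrite -[leRHS]mulrA ler_wpM2l//; apply: le_trans xr _.
by rewrite ler_wpM2l// ler_weXn2l// ltW.
Qed.

(** The Poisson equation writes the centred sum of squares as a martingale minus the telescoping
    difference [g (X n) - g (X 0)]. After division by [n] the boundary terms vanish in mean, and the
    martingale part is handled through [psi]. *)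
Theorem lln_sqr e : 0 < e ->
  E (fun w => (e < `|(\sum_(k < n) (X k w)%:R ^+ 2) / n%:R - moment pi 2|)%R%:R)
    @[n --> \oo] --> (0 : R).
Proof.
move=> e0; have [A [B hAB]] := poisson2 H S.
pose g (y : nat) := A * y%:R ^+ 2 + B * y%:R.
have cg : cubic g.
  by apply: cubicD; apply: cubicZ; [exact: cubic_pow|exact: (@cubic_pow _ 1)].
pose dl k w := g (X k.+1 w) - K g (X k w).
pose m2 := moment pi 2.
have Kg x : K g x = g x - (x%:R ^+ 2 - m2) by rewrite hAB /g; ring.
pose C := `|A| + `|B|.
have C0 : 0 <= C by rewrite addr_ge0.
have gC x : `|g x| <= C * (x%:R + 1) ^+ 2.
  apply: le_trans (ler_normD _ _) _; rewrite (normrM A) (normrM B) normrX normr_nat.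
  have x0 : 0 <= x%:R :> R by [].
  rewrite /C [leRHS]mulrDl; apply: lerD; apply: ler_wpM2l => //.
    by rewrite lerXn2r ?nnegrE ?addr_ge0// lerDl.
  by rewrite sqrrD expr1n mulr1; have := sqr_ge0 (x%:R : R); lra.
(* [2 * C] bounds the two values of [g], and [1 + |m2|] the centred square. *)
pose C' := 2 * C + 1 + `|m2|.
have C'0 : 0 <= C' by rewrite /C' !addr_ge0// mulr_ge0.
pose q k w : R := 1 + (X k w)%:R + (X k.+1 w)%:R.
have q0 k w : 0 <= q k w by rewrite /q !addr_ge0.
have dlC k w : `|dl k w| <= C' * q k w ^+ 2.
  rewrite /dl Kg; set x : R := (X k w)%:R; set y : R := (X k.+1 w)%:R.
  have x0 : 0 <= x by []. have y0 : 0 <= y by [].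
  have h1 := gC (X k.+1 w); have h2 := gC (X k w).
  have q1 : 1 <= q k w ^+ 2 by rewrite exprn_ege1// /q -/x -/y; lra.
  have hx : (x + 1) ^+ 2 <= q k w ^+ 2 by rewrite lerXn2r ?nnegrE ?addr_ge0// /q -/x -/y; lra.
  have hy : (y + 1) ^+ 2 <= q k w ^+ 2 by rewrite lerXn2r ?nnegrE ?addr_ge0// /q -/x -/y; lra.
  have hx2 : x ^+ 2 <= q k w ^+ 2 by rewrite lerXn2r ?nnegrE ?addr_ge0// /q -/x -/y; lra.
  have h3 := ler_wpM2l C0 hx; have h4 := ler_wpM2l C0 hy.
  have h5 := ler_wpM2l (normr_ge0 m2) q1.
  rewrite (_ : _ - _ = g (X k.+1 w) - g (X k w) + (x ^+ 2 - m2)); last by rewrite /x; ring.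
  apply: le_trans (ler_normD _ _) _.
  have h6 := ler_normB (g (X k.+1 w)) (g (X k w)).
  have h7 := ler_normB (x ^+ 2) m2; rewrite (ger0_norm (sqr_ge0 x)) in h7.
  by rewrite /C'; lra.
have [C3 hC3] := mean_X_bounded H.
have C31 : 0 <= C3 by apply: le_trans (hC3 0%N 3%N isT); apply: mean_ge0 => w; exact: exprn_ge0.
have qle k w : q k w ^+ 3 <= 16 + 16 * (X k w)%:R ^+ 3 + 4 * (X k.+1 w)%:R ^+ 3.
  have h1 := cube_split (addr_ge0 (@ler01 R) (ler0n R (X k w))) (ler0n R (X k.+1 w)).
  have h2 := cube_split (@ler01 R) (ler0n R (X k w)).
  by rewrite expr1n in h2; rewrite /q; lra.
have iq' k : integ P (fun w => 16 + 16 * (X k w)%:R ^+ 3 + 4 * (X k.+1 w)%:R ^+ 3).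
  exact: (integD (integD (integ_cst P 16) (integZ 16 (integ_X H k (leqnn 3)))) (integZ 4 (integ_X H k.+1 (leqnn 3)))).
have mq k (f : R -> R) : measurable_fun setT (fun w => f (q k w)).
  apply: (adapted_measurable H (k := k.+1)); apply: (adapted1 f).
  apply: (adapted2 +%R); last exact: (adapted_X _ _ _ (fun x => x%:R) (leqnn k.+1)).
  exact: (adapted_X _ _ _ (fun x => 1 + x%:R) (leqnSn k)).
have iq k : integ P (fun w => q k w ^+ 3).
  apply: (integ_le _ _ (iq' k)); first exact: (mq k (fun x => x ^+ 3)).
  by move=> w; rewrite ger0_norm ?exprn_ge0.
pose Cq := 16 + 20 * C3.
have qC k : E (fun w => q k w ^+ 3) <= Cq.
  apply: le_trans (le_mean (iq k) (iq' k) (qle k)) _.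
  have i1 := integ_X H k (leqnn 3); have i2 := integ_X H k.+1 (leqnn 3).
  rewrite (meanD (integD (integ_cst _ _) (integZ _ i1)) (integZ _ i2)).
  rewrite (meanD (integ_cst _ _) (integZ _ i1)) (meanZ _ i1) (meanZ _ i2) mean_cst.
  by have := hC3 k 3%N isT; have := hC3 k.+1 3%N isT; rewrite /Cq; lra.
have adl k : adapted k.+1 (dl k).
  apply: (adapted2 (fun x y => x - y)); first exact: (adapted_X _ _ _ g (leqnn k.+1)).
  exact: (adapted_X _ _ _ (K g) (leqnSn k)).
have idl k : integ P (dl k).
  apply: (@integ_le _ _ _ _ (fun w => C' * q k w ^+ 3)); last exact: integZ.
    exact: (adapted_measurable H (adl k)).
  move=> w; apply: le_trans (dlC k w) _; rewrite ler_wpM2l// ler_weXn2l//.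
  by rewrite /q -addrA lerDl addr_ge0.
have odl k f c : adapted k f -> (forall w, `|f w| <= c) -> E (fun w => f w * dl k w) = 0.
  move=> af fc; have mf := adapted_measurable H af.
  have i1 := integMb mf fc (integ_cubic H k.+1 cg).
  have i2 : integ P (fun w => f w * K g (X k w)).
    apply: (integMb mf fc).
    rewrite (_ : (fun w => _) = fun w => g (X k.+1 w) - dl k w); last first.
      by apply/funext => w; rewrite /dl; ring.
    by apply: integB => //; exact: (integ_cubic H k.+1 cg).
  under eq_mean do rewrite /dl mulrBr.
  by rewrite (meanB i1 i2) (mean_adapted_next H af fc cg) subrr.
pose Cm := (C' ^+ 2 + 2 * C') * Cq.
have hpsi n : (0 < n)%N -> integ P (fun w => psi (\sum_(k < n) n%:R^-1 * dl k w)) /\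
    E (fun w => psi (\sum_(k < n) n%:R^-1 * dl k w)) <= 1 + Cm * (Num.sqrt n%:R)^-1.
  move=> n0.
  have [||||i le1] := @mean_psi_le (fun k w => n%:R^-1 * dl k w) n
     ((C' ^+ 2 + 2 * C') * (Num.sqrt n%:R)^-1 ^+ 3 * Cq).
  - by move=> k; exact: (adapted1 (fun x => n%:R^-1 * x) (adl k)).
  - by move=> k; exact: integZ.
  - move=> k f c af fc; under eq_mean do rewrite mulrCA.
    rewrite meanZ; first by rewrite (odl _ _ _ af fc) mulr0.
    exact: (integMb (adapted_measurable H af) fc (idl k)).
  - move=> k.
    have cc0 : 0 <= (C' ^+ 2 + 2 * C') * (Num.sqrt n%:R)^-1 ^+ 3.
      by rewrite mulr_ge0 ?addr_ge0 ?sqr_ge0 ?mulr_ge0 ?exprn_ge0// invr_ge0 sqrtr_ge0.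
    have hw w : Num.min ((n%:R^-1 * dl k w) ^+ 2) (2 * `|n%:R^-1 * dl k w|) <=
        (C' ^+ 2 + 2 * C') * (Num.sqrt n%:R)^-1 ^+ 3 * q k w ^+ 3.
      rewrite -mulrA (mulrC _ (q k w ^+ 3)); apply: lln_weight => //.
      by rewrite normrM ger0_norm ?invr_ge0// mulrC ler_wpM2r ?invr_ge0.
    have ir := integZ ((C' ^+ 2 + 2 * C') * (Num.sqrt n%:R)^-1 ^+ 3) (iq k).
    apply: (@le_trans _ _ (E (fun w => (C' ^+ 2 + 2 * C') * (Num.sqrt n%:R)^-1 ^+ 3 * q k w ^+ 3))).
      apply: le_mean => //; apply: (integ_le _ _ ir).
        apply: (adapted_measurable H (k := k.+1)).
        exact: (adapted1 (fun x => Num.min ((n%:R^-1 * x) ^+ 2) (2 * `|n%:R^-1 * x|)) (adl k)).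
      by move=> w; rewrite ger0_norm// le_min sqr_ge0 mulr_ge0.
    by rewrite (meanZ _ (iq k)) ler_wpM2l.
  split => //; apply: le_trans le1 _; rewrite lerD2l /Cm.
  have sn : n%:R * (Num.sqrt n%:R)^-1 ^+ 2 = 1 :> R.
    by rewrite exprVn sqr_sqrtr// mulfV// pnatr_eq0 -lt0n.
  rewrite (_ : n%:R * _ = (C' ^+ 2 + 2 * C') * (n%:R * (Num.sqrt n%:R)^-1 ^+ 2) * (Num.sqrt n%:R)^-1 * Cq); last by ring.
  by rewrite sn mulr1 mulrAC.
have tele n w : \sum_(k < n) dl k w = \sum_(k < n) (X k w)%:R ^+ 2 - n%:R * m2 +
    g (X n w) - g (X 0%N w).
  elim: n => [|n ih]; first by rewrite !big_ord0; ring.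
  by rewrite !big_ord_recr /= ih /dl Kg -natr1; ring.
have [C4 hC4] : exists C4, forall k, E (fun w => `|g (X k w)|) <= C4.
  exists (C * (4 + 4 * C3)) => k; have i3 := integ_X H k (leqnn 3).
  apply: (@le_trans _ _ (E (fun w => C * (4 + 4 * (X k w)%:R ^+ 3)))).
    apply: le_mean; [by apply: integ_norm; exact: (integ_cubic H k cg)| |].
      exact: (integZ _ (integD (integ_cst _ _) (integZ _ i3))).
    move=> w; apply: le_trans (gC _) _; rewrite ler_wpM2l//.
    have h := cube_split (ler0n R (X k w)) (@ler01 R); rewrite expr1n in h.
    have x0 : 0 <= (X k w)%:R :> R by [].
    have : ((X k w)%:R + 1) ^+ 2 <= ((X k w)%:R + 1) ^+ 3 :> R by rewrite ler_weXn2l// lerDr.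
    by lra.
  rewrite (meanZ _ (integD (integ_cst _ _) (integZ _ i3))) (meanD (integ_cst _ _) (integZ _ i3)).
  by rewrite (meanZ _ i3) mean_cst ler_wpM2l// lerD2l ler_wpM2l// hC3.
have C40 : 0 <= C4 by apply: le_trans (hC4 0%N); apply: mean_ge0.
(* The minimum of [psi - 1] over arguments of modulus at least [e / 3]; since [psi - 1] has a
   vanishing mean bound, this gives a Chebyshev inequality. *)
pose pe := psi (e / 3) - 1.
have pe0 : 0 < pe.
  rewrite /pe subr_gt0 -(@ltr_pXn2r _ 2)// ?nnegrE ?sqrtr_ge0// psi_sqr expr1n ltrDl.
  by rewrite exprn_gt0// divr_gt0.
pose bound (n : nat) := Cm / pe * (Num.sqrt n%:R)^-1 + 2 * C4 / (e / 3) * n%:R^-1.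
have bc : bound n @[n --> \oo] --> (0 : R).
  rewrite -[X in _ --> X]addr0; apply: cvgD.
    rewrite -[X in _ --> X](mulr0 (Cm / pe)); apply: cvgMl_tmp.
    by have := @sqrt_invn_cvg0 R 1 0%N; under eq_fun do rewrite mul1r addn0.
  rewrite -[X in _ --> X](mulr0 (2 * C4 / (e / 3))); apply: cvgMl_tmp.
  by have := @invn_cvg0 R 0%N; under eq_fun do rewrite addn0.
apply: (squeeze_cvgr (f := fun=> 0) (h := bound) _ (cvg_cst _) bc).
exists 1%N => // n /= n1; rewrite mean_ge0//=.
have [i le1] := hpsi n n1.
pose Z w := \sum_(k < n) n%:R^-1 * dl k w.
have np : 0 < n%:R :> R by rewrite ltr0n.
have e3 : 0 < e / 3 by rewrite divr_gt0.
(* A deviation above [e] forces the martingale or one of the two boundary terms to exceed [e / 3],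
   and then the matching summand of [W] is at least one. *)
pose W w := pe^-1 * (psi (Z w) - 1) + (e / 3)^-1 * n%:R^-1 * (`|g (X n w)| + `|g (X 0%N w)|).
have iN k : integ P (fun w => `|g (X k w)|) by apply: integ_norm; exact: (integ_cubic H k cg).
have iZ1 := integB i (integ_cst P 1).
have iNN := integD (iN n) (iN 0%N).
have iW : integ P W by apply: integD; exact: integZ.
apply: (@le_trans _ _ (E W)); last first.
  rewrite /W (meanD (integZ _ iZ1) (integZ _ iNN)) (meanZ _ iZ1) (meanZ _ iNN).
  rewrite (meanB i (integ_cst _ _)) mean_cst (meanD (iN n) (iN 0%N)) /bound.
  apply: lerD.
    rewrite (_ : Cm / pe * _ = pe^-1 * (Cm * (Num.sqrt n%:R)^-1)); last by ring.
    by rewrite ler_wpM2l ?invr_ge0 ?(ltW pe0)//; lra.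
  rewrite (_ : 2 * C4 / (e / 3) * _ = (e / 3)^-1 * n%:R^-1 * (2 * C4)); last by ring.
  rewrite ler_wpM2l//; first by rewrite mulr_ge0// invr_ge0// ltW.
  by have := hC4 n; have := hC4 0%N; lra.
apply: le_mean => //.
  apply: (@integ_bounded _ _ _ _ 1); last by move=> w; case: (_ < _); rewrite ?normr1 ?normr0.
  apply: (adapted_measurable H (k := n)).
  apply: (adapted1 (fun x => (e < `|x / n%:R - m2|)%R%:R)).
  apply: (adapted_sum (f := fun k w => (X k w)%:R ^+ 2)) => j jn.
  exact: (adapted_X _ _ _ (fun x => x%:R ^+ 2) (ltnW jn)).
move=> w; have Z1 := psi_ge1 (Z w).
have t1 : 0 <= pe^-1 * (psi (Z w) - 1) by rewrite mulr_ge0 ?invr_ge0 ?(ltW pe0)// subr_ge0.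
have t2 k : 0 <= (e / 3)^-1 * n%:R^-1 * `|g (X k w)|.
  by rewrite mulr_ge0// mulr_ge0// invr_ge0// ltW.
rewrite /W (mulrDr ((e / 3)^-1 * n%:R^-1)); case: ltP => [h|_]; last by rewrite !addr_ge0.
rewrite (_ : true%:R = 1 :> R)//.
have [hZ|hZ] := leP (e / 3) `|Z w|.
  have : 1 <= pe^-1 * (psi (Z w) - 1).
    rewrite ler_pdivlMl// mulr1 /pe lerD2r; apply: le_psi.
    by rewrite (ger0_norm (ltW e3)).
  by have := t2 n; have := t2 0%N; lra.
have big k : e / 3 <= `|n%:R^-1 * g (X k w)| -> 1 <= (e / 3)^-1 * n%:R^-1 * `|g (X k w)|.
  by rewrite normrM (ger0_norm (_ : 0 <= n%:R^-1))// => h'; rewrite -mulrA ler_pdivlMl// mulr1.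
have [h1|h1] := leP (e / 3) `|n%:R^-1 * g (X n w)|.
  by have := big _ h1; have := t2 0%N; move: t1; lra.
have [h2|h2] := leP (e / 3) `|n%:R^-1 * g (X 0%N w)|.
  by have := big _ h2; have := t2 n; move: t1; lra.
have ZE : (\sum_(k < n) (X k w)%:R ^+ 2) / n%:R - m2 = Z w - n%:R^-1 * g (X n w) +
    n%:R^-1 * g (X 0%N w).
  by rewrite /Z -mulr_sumr tele; field; rewrite gt_eqF.
move: h; rewrite -/m2 ZE.
have := ler_normD (Z w - n%:R^-1 * g (X n w)) (n%:R^-1 * g (X 0%N w)).
have := ler_normB (Z w) (n%:R^-1 * g (X n w)).
move: hZ h1 h2; lra.
Qed.

End law_of_large_numbers.

(** * Cosine transform of the standard normal law *)

Section normal_integral.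
Context {R : realType}.
Local Notation mu := (@lebesgue_measure R).
Local Notation N := (normal_prob (0 : R) 1).

Lemma integral_normal_prob m s (f : R -> \bar R) U : measurable U ->
  (normal_prob m s).-integrable U f ->
  (\int[normal_prob m s]_(x in U) f x = \int[mu]_(x in U) (f x * (normal_pdf m s x)%:E))%E.
Proof.
move=> mU intf; have mf := measurable_int _ intf.
rewrite -(Radon_Nikodym_change_of_variables (normal_prob_dominates m s) mU intf).
apply: ae_eq_integral => //.
- apply: emeasurable_funM => //; apply: (measurable_int mu).
  apply: (integrableS _ _ (@subsetT _ _)) => //=.
  by apply: Radon_Nikodym_integrable; exact: normal_prob_dominates.
- apply: emeasurable_funM => //=; apply/measurableT_comp => //=.
  by apply/measurable_funTS; exact: measurable_normal_pdf.
- apply: ae_eqe_mul2l => /=.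
  rewrite Radon_NikodymE//=; first exact: normal_prob_dominates.
  move=> abmu; case: cid => /= h [h1 h2 h3].
  apply: integral_ae_eq => //=.
  + exact: integrableS h2.
  + by apply/measurable_funTS/measurableT_comp =>//; exact: measurable_normal_pdf.
  + by move=> E E01 mE; rewrite -h3.
Qed.

Definition gauss (z : R) : R := normal_peak 1 * expR (- (z ^+ 2 / 2)).

Lemma normal_pdf01 z : normal_pdf 0 1 z = gauss z.
Proof.
rewrite normal_pdfE ?oner_neq0// /gauss /normal_fun; congr (_ * expR _).
by rewrite subr0 expr1n -mulr_natr mul1r mulNr.
Qed.

Lemma gauss_ge0 z : 0 <= gauss z.
Proof. by rewrite mulr_ge0 ?normal_peak_ge0 ?expR_ge0. Qed.

Lemma gaussN z : gauss (- z) = gauss z.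
Proof. by rewrite /gauss sqrrN. Qed.

Lemma is_derive_gauss (z : R) : is_derive z (1 : R) gauss (- z * gauss z).
Proof.
rewrite /gauss; apply: is_derive_eq; rewrite /GRing.scale /=; by field.
Qed.

Lemma continuous_gauss : continuous gauss.
Proof. by move=> z; apply/differentiable_continuous/derivable1_diffP; have := is_derive_gauss z => ?; exact: ex_derive. Qed.

Lemma gauss_cvg0 : gauss n%:R @[n --> \oo] --> (0 : R).
Proof.
have pk := normal_peak_ge0 (1 : R).
apply: (squeeze_cvgr (f := fun=> 0) (h := fun n => 2 * normal_peak 1 * n.+1%:R^-1)).
- exists 1%N => // n /= n1; rewrite gauss_ge0 /= /gauss expRN.
  rewrite (_ : 2 * _ * _ = normal_peak 1 * (2 / n.+1%:R)); last by ring.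
  rewrite ler_wpM2l// ler_pdivlMr ?ltr0n// mulrC ler_pdivrMr ?expR_gt0//.
  have n1' : 1 <= n%:R :> R by rewrite ler1n.
  have h := expR_ge1Dx (n%:R ^+ 2 / 2 : R).
  have n2 : n%:R <= n%:R ^+ 2 :> R by rewrite expr2 ler_peMl.
  by rewrite -natr1; lra.
- exact: cvg_cst.
- rewrite -[X in _ --> X](mulr0 (2 * normal_peak 1)); apply: cvgMl_tmp.
  exact: cvg_harmonic.
Qed.

Let wave th phi (z : R) := cos (th * z + phi).
(** On a bounded interval, differentiation in [th] and integration by parts are both elementary; the
    truncation leaves boundary terms carrying the factor [gauss M]. *)
Let truncated (M phi th : R) : R := Rintegral N [set` `[- M, M]] (wave th phi).

Let cont_wave th phi : continuous (wave th phi).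
Proof.
move=> z; apply: continuous_comp; last exact: continuous_cos.
by apply: cvgD; [apply: cvgMl_tmp; exact: cvg_id|exact: cvg_cst].
Qed.

Let meas_cont (f : R -> R) U : measurable U -> continuous f -> measurable_fun U f.
Proof. by move=> mU cf; apply: measurable_funTS; exact: continuous_measurable_fun. Qed.

Let N_fin (M : R) : (N `[(- M)%R, M] < +oo)%E.
Proof. by rewrite -ge0_fin_numE//; exact: fin_num_measure. Qed.

Let integ_itv (M : R) (f : R -> R) (C : R) : continuous f -> (forall z, - M <= z <= M -> `|f z| <= C) ->
  N.-integrable [set` `[- M, M]] (EFin \o f).
Proof.
move=> cf fC; apply: measurable_bounded_integrable => //.
- exact: N_fin.
- exact: meas_cont.
- exists C; split; first exact: num_real.
  move=> x Cx z /=; rewrite in_itv /= => zM.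
  exact: le_trans (fC z zM) (ltW Cx).
Qed.

Let dwave th phi (z : R) : is_derive th (1 : R) (fun t => wave t phi z) (- z * sin (th * z + phi)).
Proof.
rewrite /wave; apply: is_derive_eq; rewrite /GRing.scale /=; ring.
Qed.

(** Differentiating under the integral produces minus the integral of [z * sin]. The primitive [Hp]
    has derivative [(th * cos - z * sin) * gauss], so the fundamental theorem of calculus trades
    this for [- th] times the transform plus boundary terms. *)
Let truncated_derive (M phi th : R) : 0 < M -> is_derive th (1 : R) (truncated M phi)
  (- th * truncated M phi th +
   (sin (th * M + phi) - sin (- (th * M) + phi)) * gauss M).
Proof.
move=> M0; have mI : measurable ([set` `[- M, M]] : set (measurableTypeR R)) by exact: measurable_itv.
have iw x : N.-integrable [set` `[- M, M]] (EFin \o wave x phi).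
  by apply: (@integ_itv _ _ 1) => [|z _]; [exact: cont_wave|exact: cos_max].
have der x z : derivable (fun t => wave t phi z) x 1.
  by have h := dwave x phi z; exact: ex_derive.
have d1 x z : derive1 (fun t => wave t phi z) x = - z * sin (x * z + phi).
  by rewrite derive1E; have h := dwave x phi z; rewrite derive_val.
have iM : N.-integrable [set` `[- M, M]] (EFin \o (fun=> M)).
  by apply: (@integ_itv _ _ `|M|) => // ?; exact: cvg_cst.
have Gub (x z : R) : [set` `]th - 1, th + 1[] x -> [set` `[- M, M]] z ->
    `|partial1of2 (fun t z => wave t phi z) x z| <= M.
  move=> _; rewrite /= in_itv /= => zM; rewrite /partial1of2 d1 normrM normrN.
  rewrite -[leRHS]mulr1 ler_pM ?sin_max// ler_norml.
  by have := zM; lra.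
have Ith : [set` `]th - 1, th + 1[] (th : R) by rewrite /= in_itv /=; lra.
have dt := @derivable_under_integral _ _ _ N (fun t z => wave t phi z) [set` `[- M, M]] mI th
  (th - 1) (th + 1) Ith (fun x _ => iw x) (fun x z _ _ => der x z) (fun=> M)
  (fun=> ltW M0) iM Gub.
have dt' := @differentiation_under_integral _ _ _ N (fun t z => wave t phi z) [set` `[- M, M]] mI th
  (th - 1) (th + 1) Ith (fun x _ => iw x) (fun x z _ _ => der x z) (fun=> M)
  (fun=> ltW M0) iM Gub.
apply: DeriveDef => //; rewrite -derive1E dt'.
have cs : continuous (fun z : R => z * sin (th * z + phi)).
  move=> z; apply: cvgM; first exact: cvg_id.
  apply: continuous_comp; last exact: continuous_sin.
  by apply: cvgD; [apply: cvgMl_tmp; exact: cvg_id|exact: cvg_cst].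
have i1 : N.-integrable [set` `[- M, M]] (EFin \o (fun z => z * sin (th * z + phi))).
  apply: (@integ_itv _ _ M) => // z zM; rewrite normrM -[leRHS]mulr1 ler_pM ?sin_max// ler_norml.
  by have := zM; lra.
pose h (z : R) : R := (th * wave th phi z - z * sin (th * z + phi)) * gauss z.
pose Hp (z : R) : R := sin (th * z + phi) * gauss z.
have dH (z : R) : is_derive z (1 : R) Hp (h z).
  have := is_derive_gauss z => dg; rewrite /Hp; apply: is_derive_eq.
  by rewrite /h /wave /GRing.scale /=; ring.
have ch : continuous h.
  move=> z; apply: cvgM; last exact: continuous_gauss.
  by apply: cvgB; [apply: cvgMl_tmp; exact: cont_wave|exact: cs].
have cH : continuous Hp.
  by move=> z; apply/differentiable_continuous/derivable1_diffP; have := dH z => ?; exact: ex_derive.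
have MM : - M < M by lra.
pose I : set R := [set` `[- M, M]].
have ftc : (\int[mu]_(z in I) (h z)%:E = (Hp M)%:E - (Hp (- M)%R)%:E)%E.
  apply: continuous_FTC2 => //.
  - exact: continuous_subspaceT.
  - split; last 2 first.
    + by apply: cvg_at_right_filter; exact: cH.
    + by apply: cvg_at_left_filter; exact: cH.
    by move=> z _; have := dH z => ?; exact: ex_derive.
  - by move=> z _; rewrite derive1E; have := dH z => ?; rewrite derive_val.
have ih : N.-integrable [set` `[- M, M]] (EFin \o (fun z => th * wave th phi z - z * sin (th * z + phi))).
  have := integrableB mI (integrableZl mI th (iw th)) i1.
  by [].
have e1 : Rintegral N [set` `[- M, M]] (fun z => th * wave th phi z - z * sin (th * z + phi)) =
    Hp M - Hp (- M).
  rewrite /Rintegral (integral_normal_prob mI ih).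
  under eq_integral do rewrite /= normal_pdf01 -EFinM.
  by rewrite ftc.
have : th * truncated M phi th - Rintegral N [set` `[- M, M]] (fun z => z * sin (th * z + phi)) =
    Hp M - Hp (- M).
  rewrite -e1 /truncated -(RintegralZl th mI (iw th)) -RintegralB//.
  exact: (integrableZl mI th (iw th)).
have -> : Rintegral N [set` `[- M, M]] (partial1of2 (fun t z => wave t phi z) th) =
    - Rintegral N [set` `[- M, M]] (fun z => z * sin (th * z + phi)).
  have ez : Rintegral N [set` `[- M, M]] (fun z => -1 * (z * sin (th * z + phi))) =
      -1 * Rintegral N [set` `[- M, M]] (fun z => z * sin (th * z + phi)).
    exact: (RintegralZl (-1) mI i1).
  rewrite -[RHS]mulN1r -ez; apply: eq_Rintegral => z _.
  by rewrite /partial1of2 d1; ring.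
rewrite /Hp gaussN mulrN => e; rewrite mulrBl -e; ring.
Qed.

(** The integrating factor [expR (th ^+ 2 / 2)] removes the linear term of the differential
    equation; only the boundary terms drive the product, and the mean value theorem bounds its
    variation. *)
Lemma truncated_bound M phi th : 0 < M -> 0 <= th ->
  `|truncated M phi th * expR (th ^+ 2 / 2) - truncated M phi 0| <=
    2 * gauss M * (expR (th ^+ 2 / 2) * th).
Proof.
move=> M0 th0.
pose F x := truncated M phi x * expR (x ^+ 2 / 2).
pose dF x := (sin (x * M + phi) - sin (- (x * M) + phi)) * gauss M * expR (x ^+ 2 / 2).
have hF (x : R) : is_derive x (1 : R) F (dF x).
  have h := truncated_derive phi x M0; rewrite /F; apply: is_derive_eq.
  by rewrite /dF /GRing.scale /=; field.
have cF : {within `[0, th], continuous F}.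
  apply: continuous_subspaceT => x; apply/differentiable_continuous/derivable1_diffP.
  by have := hF x => ?; exact: ex_derive.
have [c] := MVT_segment th0 (fun x _ => hF x) cF.
rewrite in_itv /= => /andP[c0 cth].
rewrite {1 2}/F expr0n /= mul0r expR0 mulr1 subr0 => ->.
rewrite normrM (ger0_norm th0) [leRHS]mulrA ler_wpM2r// /dF.
rewrite normrM (ger0_norm (expR_ge0 _)) normrM (ger0_norm (gauss_ge0 _)).
apply: ler_pM; rewrite ?expR_ge0//.
- by rewrite mulr_ge0// gauss_ge0.
- rewrite ler_wpM2r ?gauss_ge0//; apply: le_trans (ler_normB _ _) _.
  by have := sin_max (c * M + phi); have := sin_max (- (c * M) + phi); lra.
- by rewrite ler_expR ler_pM2r ?invr_gt0// lerXn2r ?nnegrE.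
Qed.

Let truncated_cvg phi th : truncated n%:R phi th @[n --> \oo] --> mean N (wave th phi).
Proof.
have mw : measurable_fun setT (wave th phi) by apply: meas_cont => //; exact: cont_wave.
have mI (n : nat) : measurable ([set` `[- n%:R, n%:R]] : set (measurableTypeR R)).
  exact: measurable_itv.
have e n : truncated n%:R phi th = mean N (fun z => \1_([set` `[- n%:R, n%:R]]) z * wave th phi z).
  rewrite /truncated Rintegral_mkcond; apply: eq_Rintegral => z _.
  by rewrite /= patchE indicE; case: ifP => _; rewrite ?mul1r ?mul0r.
under eq_fun do rewrite e.
apply: (@mean_dominated _ _ _ N (fun n z => \1_([set` `[- n%:R, n%:R]]) z * wave th phi z) _ (fun=> 1)).
- by move=> n; apply: measurable_funM => //; exact: measurable_indic.
- exact: integ_cst.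
- move=> n z; rewrite normrM -[leRHS]mulr1 ler_pM ?cos_max//.
  by rewrite indicE; case: (_ \in _); rewrite ?normr1 ?normr0.
- move=> z; apply: cvg_near_cst; exists (Num.truncn `|z|).+1 => // n /= hn.
  rewrite indicE mem_set ?mul1r//= in_itv /= -ler_norml.
  by have /ltW/le_trans := truncnS_gt `|z|; apply; rewrite ler_nat.
Qed.

Let truncated0_cvg phi : truncated n%:R phi 0 @[n --> \oo] --> cos phi.
Proof.
have := @truncated_cvg phi 0; rewrite (_ : wave 0 phi = fun=> cos phi) ?mean_cst//.
by apply/funext => z; rewrite /wave mul0r add0r.
Qed.

Lemma mean_normal_cos_ge0 th phi : 0 <= th ->
  mean N (wave th phi) * expR (th ^+ 2 / 2) = cos phi.
Proof.
move=> th0.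
have c1 : truncated n%:R phi th * expR (th ^+ 2 / 2) - truncated n%:R phi 0 @[n --> \oo] -->
    mean N (wave th phi) * expR (th ^+ 2 / 2) - cos phi.
  by apply: cvgB; [apply: cvgMr_tmp; exact: truncated_cvg|exact: truncated0_cvg].
have c2 : truncated n%:R phi th * expR (th ^+ 2 / 2) - truncated n%:R phi 0 @[n --> \oo] --> (0 : R).
  apply: norm_cvg0.
  apply: (squeeze_cvgr (f := fun=> 0) (h := fun n => 2 * gauss n%:R * (expR (th ^+ 2 / 2) * th))).
  - exists 1%N => // n /= n1; rewrite normr_ge0 /=; apply: truncated_bound => //.
    by rewrite ltr0n.
  - exact: cvg_cst.
  - rewrite -[X in _ --> X](mul0r (expR (th ^+ 2 / 2) * th)); apply: cvgMr_tmp.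
    by rewrite -[X in _ --> X](mulr0 2); apply: cvgMl_tmp; exact: gauss_cvg0.
by apply/eqP; rewrite -subr_eq0; apply/eqP; exact: cvg_unique c1 c2.
Qed.

Theorem mean_normal_cos th phi : mean N (fun z => cos (th * z + phi)) =
  cos phi * expR (- (th ^+ 2 / 2)).
Proof.
have h t p : 0 <= t -> mean N (wave t p) = cos p * expR (- (t ^+ 2 / 2)).
  by move=> t0; rewrite -(mean_normal_cos_ge0 p t0) -mulrA -expRD subrr expR0 mulr1.
have [t0|/ltW t0] := leP 0 th; first exact: h.
(* The cosine is even, so the signs of [th] and [phi] may be flipped together. *)
rewrite -(cosN phi) -sqrrN -h ?oppr_ge0//; apply: eq_mean => z.
by rewrite /wave -cosN; congr cos; ring.
Qed.

End normal_integral.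

(** * Bernstein operators, compactness and tail estimates *)

Section bernstein.
Context {R : realType}.

Lemma thin_sqr (a : R) n : thin a (fun y => y%:R ^+ 2) n = a ^+ 2 * n%:R ^+ 2 + a * (1 - a) * n%:R.
Proof.
elim: n => [|n ih] /=; first by rewrite expr0n /=; ring.
have -> : (fun y : nat => y.+1%:R ^+ 2 : R) = (fun y => y%:R ^+ 2 + (2 * y%:R + 1)).
  by apply/funext => y; rewrite -natr1; ring.
by rewrite !thinD thinZ thin_id thin_cst ih -natr1; ring.
Qed.

Lemma thin_variance (a : R) n : thin a (fun y => (y%:R - a * n%:R) ^+ 2) n = a * (1 - a) * n%:R.
Proof.
rewrite (_ : (fun y => _) = fun y : nat => y%:R ^+ 2 +
   ((- (2 * (a * n%:R))) * y%:R + (a * n%:R) ^+ 2)); last by apply/funext => y; ring.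
by rewrite !thinD thinZ thin_id thin_cst thin_sqr; ring.
Qed.

Lemma norm_thin_le (a : R) f g n : 0 <= a <= 1 -> (forall y, (y <= n)%N -> `|f y| <= g y) ->
  `|thin a f n| <= thin a g n.
Proof.
move=> a01 fg; rewrite ler_norml; apply/andP; split.
  rewrite -mulN1r -thinZ; apply: le_thin => // y /fg.
  by rewrite mulN1r ler_norml => /andP[].
by apply: le_thin => // y /fg; rewrite ler_norml => /andP[].
Qed.

(** Here [thin u] of [F (y / n)] is the Bernstein polynomial of [F] at [u]. Binomial values within
    [dl] of [u] cost [e]; the others cost [2 * M] times their probability, estimated by Chebyshev
    with variance [u * (1 - u) / n]. *)
Lemma bernstein_error (F : R -> R) M e dl u n : 0 <= u <= 1 -> 0 < dl -> 0 <= M -> 0 <= e ->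
  (forall x, `|F x| <= M) ->
  (forall x, 0 <= x <= 1 -> `|x - u| <= dl -> `|F x - F u| <= e) ->
  (0 < n)%N ->
  `|thin u (fun y => F (y%:R / n%:R)) n - F u| <= e + 2 * M / dl ^+ 2 / n%:R.
Proof.
move=> u01 dl0 M0 e0 FM Fe n0.
have n1 : 0 < n%:R :> R by rewrite ltr0n.
have dl2 : 0 < dl ^+ 2 by rewrite exprn_gt0.
pose c := 2 * M / dl ^+ 2 / n%:R ^+ 2.
have c0 : 0 <= c by rewrite /c divr_ge0 ?sqr_ge0// divr_ge0 ?(ltW dl2)// mulr_ge0.
have h y : (y <= n)%N -> `|F (y%:R / n%:R) - F u| <= e + c * (y%:R - u * n%:R) ^+ 2.
  move=> yn; have [yu|yu] := leP `|y%:R / n%:R - u| dl.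
    apply: le_trans (Fe _ _ yu) _; last by rewrite lerDl mulr_ge0// sqr_ge0.
    by rewrite divr_ge0//= ler_pdivrMr// mul1r ler_nat.
  apply: (@le_trans _ _ (2 * M)).
    by have := ler_normB (F (y%:R / n%:R)) (F u); have := FM (y%:R / n%:R); have := FM u; lra.
  apply: (@le_trans _ _ (c * (y%:R - u * n%:R) ^+ 2)); last by rewrite lerDr.
  rewrite (_ : c * _ = 2 * M * ((y%:R / n%:R - u) ^+ 2 / dl ^+ 2)); last first.
    by rewrite /c; field; rewrite !gt_eqF.
  rewrite ler_peMr ?mulr_ge0// ler_pdivlMr// mul1r.
  rewrite -[leRHS]ger0_norm ?sqr_ge0// normrX lerXn2r ?nnegrE ?(ltW dl0) ?(ltW yu)//.
rewrite -[F u](thin_cst u _ n) -[X in _ - X]mul1r -mulNr -thinZ -thinD.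
apply: le_trans (norm_thin_le u01 (g := fun y => e + c * (y%:R - u * n%:R) ^+ 2) _) _.
  by move=> y yn; rewrite mulN1r; exact: h.
rewrite thinD thin_cst thinZ thin_variance lerD2l.
rewrite (_ : c * _ = 2 * M / dl ^+ 2 / n%:R * (u * (1 - u))); last first.
  by rewrite /c; field; rewrite !gt_eqF.
rewrite ler_piMr//; first by rewrite !divr_ge0 ?mulr_ge0// ltW.
by have /andP[u0 u1] := u01; rewrite mulr_ile1// ?subr_ge0// lerBlDr lerDl.
Qed.

End bernstein.

(** Compactness of the segment makes continuity at the unperturbed points uniform in [z]. Two
    perturbation slots are provided because the outlier estimates have two coordinates. *)
Lemma compact_perturbation (R : realType) (g : R * (R * R) -> R) (K e : R) : continuous g -> 0 < e ->
  exists2 dl : R, 0 < dl & forall z p q, `|z| <= K -> `|p| <= dl -> `|q| <= dl ->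
    `|g (z, (p, q)) - g (z, (0, 0))| <= e.
Proof.
move=> cg e0.
have /compact_near_coveringP h := @segment_compact R (- K) K.
have : \forall pq \near nbhs ((0, 0) : R * R),
    [set` `[- K, K]] `<=` [set z | `|g (z, pq) - g (z, (0, 0))| <= e].
  apply: (h _ (nbhs ((0, 0) : R * R)) (fun pq z => `|g (z, pq) - g (z, (0, 0))| <= e)).
  move=> z _; have e20 : 0 < e / 2 by rewrite divr_gt0.
  have /cvgrPdist_le/(_ _ e20) cz := cg (z, (0, 0)).
  have [[U V] [Uz V0] UV] : filter_prod (nbhs z) (nbhs ((0, 0) : R * R))
      [set y | `|g (z, (0, 0)) - g y| <= e / 2] := cz.
  exists (U, V) => // -[z' pq] [/= Uz' Vpq].
  have h1 := UV (z', pq) (conj Uz' Vpq).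
  have h2 := UV (z', (0, 0)) (conj Uz' (nbhs_singleton V0)).
  rewrite /= in h1 h2; rewrite distrC in h1.
  have := ler_normD (g (z', pq) - g (z, (0, 0))) (g (z, (0, 0)) - g (z', (0, 0))).
  rewrite addrA subrK; lra.
move=> [[U V] [/= /nbhs_ballP[r1 /= r10 hU] /nbhs_ballP[r2 /= r20 hV]] UV].
pose dl := Num.min r1 r2 / 2.
have m0 : 0 < Num.min r1 r2 by rewrite lt_min r10.
have d1 : dl < r1.
  by have : Num.min r1 r2 <= r1 by [rewrite ge_min lexx]; rewrite /dl; lra.
have d2 : dl < r2.
  by have : Num.min r1 r2 <= r2 by [rewrite ge_min lexx orbT]; rewrite /dl; lra.
exists dl; first by rewrite /dl divr_gt0.
move=> z p q zK pd qd; apply: (UV (p, q)); last by rewrite /= in_itv /= -ler_norml.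
split => /=.
  by apply: hU; rewrite /ball /= sub0r normrN; exact: le_lt_trans pd d1.
by apply: hV; rewrite /ball /= sub0r normrN; exact: le_lt_trans qd d2.
Qed.

Lemma measurable_gt_norm (R : realType) d (T : measurableType d) (f : T -> R) (b : R) :
  measurable_fun setT f -> measurable_fun setT (fun w => (b < `|f w|)%R%:R : R).
Proof.
move=> mf; apply: (measurableT_comp (f := fun b : bool => b%:R : R)) => //.
by apply: measurable_fun_ltr => //; exact: measurableT_comp.
Qed.

Lemma tail_vanishes (R : realType) d (T : measurableType d) (Q : probability T R) (Z : T -> R) (e : R) :
  measurable_fun setT Z -> 0 < e -> exists n0 : nat, forall n, (n0 <= n)%N ->
  mean Q (fun z => (n%:R < `|Z z|)%R%:R) <= e.
Proof.
move=> mZ e0.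
have h : mean Q (fun z => (n%:R < `|Z z|)%R%:R) @[n --> \oo] --> (0 : R).
  rewrite -[X in _ --> X](mean_cst Q 0).
  apply: (@mean_dominated _ _ _ Q (fun n z => (n%:R < `|Z z|)%R%:R) _ (fun=> 1)).
  - by move=> n; apply: measurable_gt_norm.
  - exact: integ_cst.
  - by move=> n z; case: (_ < _); rewrite ?normr1 ?normr0.
  - move=> z; apply: cvg_near_cst; exists (Num.truncn `|Z z|).+1 => // n /= hn.
    have : `|Z z| <= n%:R by have /ltW/le_trans := truncnS_gt `|Z z|; apply; rewrite ler_nat.
    by rewrite leNgt => /negbTE ->.
move/cvgrPdist_le : h => /(_ _ e0)[n0 _ hn]; exists n0 => n /hn.
by rewrite sub0r normrN => /(le_trans (ler_norm _)).
Qed.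

(** * From cosine transforms to bounded continuous test functions *)

Section continuity_theorem.
Context {R : realType} {d d' : measure_display} {T : measurableType d} {T' : measurableType d'}.
Variables (P : probability T R) (Q : probability T' R).
Variables (a : T -> R) (W : nat -> T -> R) (Z : T' -> R) (c : R).
Hypotheses (ma : measurable_fun setT a) (a1 : forall w, `|a w| <= 1) (c1 : `|c| <= 1).
Hypotheses (mW : forall n, measurable_fun setT (W n)) (mZ : measurable_fun setT Z).
Hypothesis cos_cvg : forall th phi, mean P (fun w => a w * cos (th * W n w + phi)) @[n --> \oo] -->
  c * mean Q (fun z => cos (th * Z z + phi)).
Hypothesis tight : forall e, 0 < e -> exists2 B : R, 0 < B & forall n,
  mean P (fun w => (B < `|W n w|)%R%:R) <= e.

(** The factor [cos (th * x + phi)] with arbitrary frequency and phase is built into the class so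
    that it is stable under multiplication by [sin (t * x)]: the product formula shifts frequencies
    by [t] and the phase by a quarter turn. *)
Let good (h : R -> R) := [/\ measurable_fun setT h, exists C, forall x, `|h x| <= C &
  forall th phi, mean P (fun w => a w * (cos (th * W n w + phi) * h (W n w))) @[n --> \oo] -->
    c * mean Q (fun z => cos (th * Z z + phi) * h (Z z))].

Let mcosW th phi n : measurable_fun setT (fun w => cos (th * W n w + phi)).
Proof.
apply: measurableT_comp; first by apply: continuous_measurable_fun; exact: continuous_cos.
by apply: measurable_funD => //; apply: measurable_funM.
Qed.

Let mcosZ th phi : measurable_fun setT (fun z => cos (th * Z z + phi)).
Proof.
apply: measurableT_comp; first by apply: continuous_measurable_fun; exact: continuous_cos.
by apply: measurable_funD => //; apply: measurable_funM.
Qed.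

Let integ_good (h : R -> R) C th phi n : measurable_fun setT h -> (forall x, `|h x| <= C) ->
  integ P (fun w => a w * (cos (th * W n w + phi) * h (W n w))).
Proof.
move=> mh hC; apply: (@integ_bounded _ _ _ _ C).
  by apply: measurable_funM => //; apply: measurable_funM => //; exact: measurableT_comp.
move=> w; rewrite normrM -[leRHS]mul1r ler_pM// normrM -[leRHS]mul1r ler_pM//.
exact: cos_max.
Qed.

Let integ_goodZ (h : R -> R) C th phi : measurable_fun setT h -> (forall x, `|h x| <= C) ->
  integ Q (fun z => cos (th * Z z + phi) * h (Z z)).
Proof.
move=> mh hC; apply: (@integ_bounded _ _ _ _ C).
  by apply: measurable_funM => //; exact: measurableT_comp.
by move=> w; rewrite normrM -[leRHS]mul1r ler_pM// cos_max.
Qed.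

Let good_cst k : good (fun=> k).
Proof.
split; [exact: measurable_cst|by exists `|k| |move=> th phi].
have i n : integ P (fun w => a w * cos (th * W n w + phi)).
  have := @integ_good (fun=> 1) 1 th phi n (measurable_cst _) (fun=> _).
  by under eq_fun do rewrite mulr1; apply; rewrite normr1.
have iz : integ Q (fun z => cos (th * Z z + phi)).
  have := @integ_goodZ (fun=> 1) 1 th phi (measurable_cst _) (fun=> _).
  by under eq_fun do rewrite mulr1; apply; rewrite normr1.
under eq_fun do (under eq_mean do rewrite mulrA mulrC; rewrite meanZ//).
under [X in _ * X]eq_mean do rewrite mulrC.
by rewrite meanZ// mulrCA; apply: cvgMl_tmp; exact: cos_cvg.
Qed.

Let goodD h1 h2 : good h1 -> good h2 -> good (fun x => h1 x + h2 x).
Proof.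
move=> [m1 [C1 b1] g1] [m2 [C2 b2] g2]; split.
- exact: measurable_funD.
- by exists (C1 + C2) => x; apply: le_trans (ler_normD _ _) _; exact: lerD.
- move=> th phi; have i1 n := integ_good th phi n m1 b1; have i2 n := integ_good th phi n m2 b2.
  have j1 := integ_goodZ th phi m1 b1; have j2 := integ_goodZ th phi m2 b2.
  under eq_fun do (under eq_mean do rewrite mulrDr mulrDr; rewrite meanD//).
  under [X in _ * X]eq_mean do rewrite mulrDr.
  by rewrite meanD// mulrDr; apply: cvgD; [exact: g1|exact: g2].
Qed.

Let goodZ k h : good h -> good (fun x => k * h x).
Proof.
move=> [m [C b] g]; split.
- exact: measurable_funM.
- by exists (`|k| * C) => x; rewrite normrM ler_wpM2l.
- move=> th phi; have i n := integ_good th phi n m b; have j := integ_goodZ th phi m b.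
  under eq_fun do (under eq_mean do rewrite (mulrCA (cos _)) (mulrCA (a _)); rewrite meanZ//).
  under [X in _ * X]eq_mean do rewrite mulrCA.
  by rewrite meanZ// mulrCA; apply: cvgMl_tmp; exact: g.
Qed.

Let cos_mul_sin (x y p : R) : cos (x + p) * sin y =
  2^-1 * cos ((x + y) + (p - pi / 2)) - 2^-1 * cos ((x - y) + (p - pi / 2)).
Proof.
have e1 : (x + y) + (p - pi / 2) = ((x + p) + y) - pi / 2 by ring.
have e2 : (x - y) + (p - pi / 2) = ((x + p) - y) - pi / 2 by ring.
by rewrite e1 e2 !cosBpihalf sinD sinB; field.
Qed.

Let good_sin t h : good h -> good (fun x => sin (t * x) * h x).
Proof.
move=> [m [C b] g]; split.
- apply: measurable_funM => //; apply: measurableT_comp; last exact: measurable_funM.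
  apply: continuous_measurable_fun; exact: continuous_sin.
- exists C => x; rewrite normrM -[leRHS]mul1r ler_pM//; exact: sin_max.
- move=> th phi; pose p := phi - pi / 2.
  have e (x k : R) : cos (th * x + phi) * (sin (t * x) * k) =
      2^-1 * (cos ((th + t) * x + p) * k) + (- 2^-1) * (cos ((th - t) * x + p) * k).
    by rewrite mulrA cos_mul_sin (mulrDl th t x) (mulrBl x th t) /p; ring.
  have i1 n := integ_good (th + t) p n m b; have i2 n := integ_good (th - t) p n m b.
  have j1 := integ_goodZ (th + t) p m b; have j2 := integ_goodZ (th - t) p m b.
  have eP n : mean P (fun w => a w * (cos (th * W n w + phi) * (sin (t * W n w) * h (W n w)))) =
      2^-1 * mean P (fun w => a w * (cos ((th + t) * W n w + p) * h (W n w))) +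
      (- 2^-1) * mean P (fun w => a w * (cos ((th - t) * W n w + p) * h (W n w))).
    rewrite -(meanZ _ (i1 n)) -(meanZ _ (i2 n)) -(meanD (integZ _ (i1 n)) (integZ _ (i2 n))).
    by apply: eq_mean => w; rewrite e; ring.
  have eQ : mean Q (fun z => cos (th * Z z + phi) * (sin (t * Z z) * h (Z z))) =
      2^-1 * mean Q (fun z => cos ((th + t) * Z z + p) * h (Z z)) +
      (- 2^-1) * mean Q (fun z => cos ((th - t) * Z z + p) * h (Z z)).
    rewrite -(meanZ _ j1) -(meanZ _ j2) -(meanD (integZ _ j1) (integZ _ j2)).
    by apply: eq_mean => w; rewrite e.
  under eq_fun do rewrite eP.
  rewrite eQ mulrDr (mulrCA c) (mulrCA c).
  by apply: cvgD; apply: cvgMl_tmp; exact: g.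
Qed.

(** A trigonometric function with values in [[0, 1]], hence usable as a thinning parameter, and
    injective on [|t * x| <= 1], hence usable as a coordinate there. *)
Definition sine_weight t (x : R) := (1 + sin (t * x)) / 2.

Lemma sine_weight01 t x : 0 <= sine_weight t x <= 1.
Proof.
have := sin_le1 (t * x); have := sin_geN1 (t * x); rewrite /sine_weight => h1 h2.
by apply/andP; split; lra.
Qed.

(** Each unfolding of [thin] multiplies by the weight or its complement, that is, by affine
    expressions in [sin (t * x)]. *)
Let good_thin t F n : good (fun x => thin (sine_weight t x) F n).
Proof.
elim: n F => [|n ih] F /=; first exact: good_cst.
have g1 := ih F; have g2 := ih (fun y => F y.+1).
have -> : (fun x => (1 - sine_weight t x) * thin (sine_weight t x) F n +
      sine_weight t x * thin (sine_weight t x) (fun y => F y.+1) n) =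
    (fun x => (2^-1 * thin (sine_weight t x) F n +
       2^-1 * thin (sine_weight t x) (fun y => F y.+1) n) +
       (2^-1 * (sin (t * x) * thin (sine_weight t x) (fun y => F y.+1) n) +
        (- 2^-1) * (sin (t * x) * thin (sine_weight t x) F n))).
  by apply/funext => x; rewrite /sine_weight; field.
by apply: goodD; apply: goodD; apply: goodZ => //; exact: good_sin.
Qed.

Let mean_thin t F n : mean P (fun w => a w * thin (sine_weight t (W m w)) F n) @[m --> \oo] -->
  c * mean Q (fun z => thin (sine_weight t (Z z)) F n).
Proof.
have [_ _ /(_ 0 0)] := good_thin t F n.
have e (x k : R) : cos (0 * x + 0) * k = k by rewrite mul0r add0r cos0 mul1r.
under eq_fun do (under eq_mean do rewrite e).
by under [X in _ * X]eq_mean do rewrite e.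
Qed.

Let clamp (s x : R) := Num.max (- s) (Num.min x s).

Let clamp_bound s x : 0 <= s -> `|clamp s x| <= s.
Proof.
move=> s0; rewrite /clamp ler_norml le_max lexx /= ge_max ge_min lexx orbT andbT.
by lra.
Qed.

Let clamp_id s x : `|x| <= s -> clamp s x = x.
Proof.
by rewrite ler_norml => /andP[sx xs]; rewrite /clamp (min_idPl xs) (max_idPr sx).
Qed.

Let continuous_clamp s : continuous (clamp s).
Proof.
move=> x; apply: (@continuous_max R R (cst (- s)) (id \min cst s)); first exact: cvg_cst.
by apply: continuous_min; [exact: cvg_id|exact: cvg_cst].
Qed.

Let one_lt_pihalf : 1 < pi / 2 :> R.
Proof.
have p2 : 1 <= pi / 2 :> R by rewrite ler_pdivlMr// mul1r; exact: pi_ge2.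
rewrite lt_neqAle p2 andbT; apply/eqP => e.
by have := @cos1_gt0 R; rewrite e cos_pihalf ltxx.
Qed.

(** Clamping to [[- sin 1, sin 1]] then stays inside the open interval on which [asin] is
    continuous. *)
Let sin1_lt1 : sin 1 < 1 :> R.
Proof.
have h := one_lt_pihalf.
by rewrite -[ltRHS](@sin_pihalf R) ltr_sin// in_itv /=; apply/andP; split; lra.
Qed.

Let sin1_gt0 : 0 < sin 1 :> R.
Proof. by apply: sin_gt0_pihalf; rewrite ltr01; exact: one_lt_pihalf. Qed.

(* [f] is [F] composed with the sine weight on [-B, B], so that the Bernstein
   polynomials of [F] in the weight are trigonometric polynomials close to [f]. *)
Lemma trig_approx (f : R -> R) M B e : continuous f -> (forall x, `|f x| <= M) -> 0 < B -> 0 < e ->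
  exists (F : nat -> R) n, (forall x, `|thin (sine_weight B^-1 x) F n| <= M) /\
    (forall x, `|x| <= B -> `|thin (sine_weight B^-1 x) F n - f x| <= e).
Proof.
move=> cf fM B0 e0; have M0 : 0 <= M by apply: le_trans (fM 0).
pose F u := f (B * asin (clamp (sin 1) (2 * u - 1))).
have FM u : `|F u| <= M by exact: fM.
have cG : continuous (fun u : R => asin (clamp (sin 1) (2 * u - 1))).
  move=> u; apply: (@continuous_comp _ _ _ (fun u : R => clamp (sin 1) (2 * u - 1)) (@asin R)).
    apply: (@continuous_comp _ _ _ (fun u : R => 2 * u - 1)); last exact: continuous_clamp.
    by apply: cvgB; [apply: cvgMl_tmp; exact: cvg_id|exact: cvg_cst].
  apply: continuous_asin.
  have := clamp_bound (2 * u - 1) (ltW sin1_gt0); rewrite ler_norml => /andP[h1 h2].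
  by have := sin1_lt1; move=> *; apply/andP; split; lra.
have cF : continuous F.
  move=> u; apply: (@continuous_comp _ _ _ (fun u : R => B * asin (clamp (sin 1) (2 * u - 1))) f).
    by apply: cvgMl_tmp; exact: cG.
  exact: cf.
have Ff x : `|x| <= B -> F (sine_weight B^-1 x) = f x.
  move=> xB; rewrite /F /sine_weight (_ : 2 * _ - 1 = sin (B^-1 * x)); last by field.
  have x1 : `|B^-1 * x| <= 1.
    by rewrite normrM (gtr0_norm (_ : 0 < B^-1)) ?invr_gt0// ler_pdivrMl// mulr1.
  have xI : B^-1 * x \in `[- (pi / 2), pi / 2].
    rewrite in_itv /= -ler_norml; apply: le_trans x1 _; have := @pi_ge2 R; lra.
  have s1 : `|sin (B^-1 * x)| <= sin 1.
    have i1 : (1 : R) \in `[- (pi / 2), pi / 2].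
      by rewrite in_itv /=; have := @pi_ge2 R; move=> *; apply/andP; split; lra.
    have iN1 : (- 1 : R) \in `[- (pi / 2), pi / 2].
      by rewrite in_itv /=; have := @pi_ge2 R; move=> *; apply/andP; split; lra.
    move: x1; rewrite !ler_norml => /andP[h1 h2]; apply/andP; split.
      by rewrite -sinN leNgt ltr_sin// -leNgt.
    by rewrite leNgt ltr_sin// -leNgt.
  rewrite clamp_id// sinK// mulrA mulfV ?mul1r// gt_eqF//.
have e20 : 0 < e / 2 by rewrite divr_gt0.
have cg : continuous (fun y : R * (R * R) => F (y.1 + y.2.1)).
  move=> y; apply: (@continuous_comp _ _ _ (fun y : R * (R * R) => y.1 + y.2.1) F); last exact: cF.
  apply: cvgD; first exact: cvg_fst.
  by apply: (@continuous_comp _ _ _ (fun y : R * (R * R) => y.2) fst); [exact: cvg_snd|exact: cvg_fst].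
(* Uniform modulus of continuity of [F] at points of [[-1, 1]]; the last slot is a dummy. *)
have [dl dl0 hdl] := compact_perturbation 1 cg e20.
have mz : 2 * M / dl ^+ 2 * n.+1%:R^-1 @[n --> \oo] --> (0 : R).
  by rewrite -[X in _ --> X](mulr0 (2 * M / dl ^+ 2)); apply: cvgMl_tmp; exact: cvg_harmonic.
move/cvgrPdist_le : mz => /(_ _ e20)[n _ /(_ n (leqnn n))].
rewrite sub0r normrN => /(le_trans (ler_norm _)) hn.
exists (fun y => F (y%:R / n.+1%:R)), n.+1; split=> x.
  rewrite -[leRHS](thin_cst (sine_weight B^-1 x) M n.+1).
  by apply: norm_thin_le => //; exact: sine_weight01.
move=> xB; rewrite -(Ff x xB).
have w01 := sine_weight01 B^-1 x.
have hF : forall y, 0 <= y <= 1 -> `|y - sine_weight B^-1 x| <= dl ->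
    `|F y - F (sine_weight B^-1 x)| <= e / 2.
  move=> y y01 yd; have := hdl (sine_weight B^-1 x) (y - sine_weight B^-1 x) 0 _ yd _.
  rewrite /= addr0 (_ : _ + (y - _) = y); last by ring.
  apply; last by rewrite normr0 ltW.
  by case/andP: w01 => w0 w1; rewrite ger0_norm.
apply: le_trans (bernstein_error w01 dl0 M0 (ltW e20) FM hF _) _ => //.
by move: hn; set X := _ / n.+1%:R => hn; lra.
Qed.

(** Replace [f] by a trigonometric polynomial that is [ep]-close on [[-B, B]] and bounded by [M]
    everywhere. Outside the interval the error is at most [2 * M] times a tail, small uniformly in
    [n] by tightness and small for the limit by the choice of [B]. *)
Theorem weak_convergence (f : R -> R) M : continuous f -> (forall x, `|f x| <= M) ->
  mean P (fun w => a w * f (W n w)) @[n --> \oo] --> c * mean Q (fun z => f (Z z)).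
Proof.
move=> cf fM; have M0 : 0 <= M by apply: le_trans (fM 0).
have mf : measurable_fun setT f by exact: continuous_measurable_fun.
apply/cvgrPdist_le => e e0.
(* Each of the two replacements, before and in the limit, costs [(1 + 2 * M) * ep], together at most
   [e / 2]; the final [+ 1] makes the inequality comfortable. *)
pose ep := e / (4 * (1 + 2 * M) + 1).
have K0 : 0 < 4 * (1 + 2 * M) + 1 by lra.
have ep0 : 0 < ep by rewrite divr_gt0.
have [B1 B10 hB1] := tight ep0; have [n0 hn0] := tail_vanishes Q mZ ep0.
pose B := Num.max B1 (maxn 1 n0)%:R.
have BB1 : B1 <= B by rewrite le_max lexx.
have B0 : 0 < B by exact: lt_le_trans BB1.
have [F [n [FM Fe]]] := trig_approx cf fM B0 ep0.
pose h x := thin (sine_weight B^-1 x) F n.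
have mh : measurable_fun setT h by have [] := good_thin B^-1 F n.
have hf x : `|h x - f x| <= ep + 2 * M * (B < `|x|)%R%:R.
  have [xB|xB] := leP `|x| B; first by rewrite mulr0 addr0; exact: Fe.
  rewrite mulr1; have := ler_normB (h x) (f x); have := FM x; have := fM x; rewrite -/(h x).
  by lra.
have tP m : mean P (fun w => (B < `|W m w|)%R%:R) <= ep.
  apply: le_trans (hB1 m); apply: le_mean.
  - apply: (@integ_bounded _ _ _ _ 1); first exact: measurable_gt_norm.
    by move=> w; case: (_ < _); rewrite ?normr1 ?normr0.
  - apply: (@integ_bounded _ _ _ _ 1); first exact: measurable_gt_norm.
    by move=> w; case: (_ < _); rewrite ?normr1 ?normr0.
  - move=> w; rewrite ler_nat; case: ltP => // h1.
    by rewrite (le_lt_trans BB1 h1).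
have tQ : mean Q (fun z => (B < `|Z z|)%R%:R) <= ep.
  apply: le_trans (hn0 _ (leq_maxr 1 n0)); apply: le_mean.
  - apply: (@integ_bounded _ _ _ _ 1); first exact: measurable_gt_norm.
    by move=> w; case: (_ < _); rewrite ?normr1 ?normr0.
  - apply: (@integ_bounded _ _ _ _ 1); first exact: measurable_gt_norm.
    by move=> w; case: (_ < _); rewrite ?normr1 ?normr0.
  - move=> w; rewrite ler_nat; case: ltP => // h1.
    by rewrite (le_lt_trans _ h1)// /B le_max lexx orbT.
have iah (k : R -> R) m : measurable_fun setT k -> (forall x, `|k x| <= M) -> integ P (fun w => a w * k (W m w)).
  move=> mk kM; apply: (@integ_bounded _ _ _ _ M).
    by apply: measurable_funM => //; exact: measurableT_comp.
  by move=> w; rewrite normrM -[leRHS]mul1r ler_pM.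
have iQ (k : R -> R) : measurable_fun setT k -> (forall x, `|k x| <= M) -> integ Q (fun z => k (Z z)).
  by move=> mk kM; apply: (@integ_bounded _ _ _ _ M) => //; exact: measurableT_comp.
have itail d0 (T0 : measurableType d0) (P0 : probability T0 R) (Y : T0 -> R) :
    measurable_fun setT Y -> integ P0 (fun w => (B < `|Y w|)%R%:R : R).
  move=> mY; apply: (@integ_bounded _ _ _ _ 1); first exact: measurable_gt_norm.
  by move=> w; case: (_ < _); rewrite ?normr1 ?normr0.
have dP m : `|mean P (fun w => a w * f (W m w)) - mean P (fun w => a w * h (W m w))| <= ep + 2 * M * ep.
  have it := itail _ _ P _ (mW m).
  rewrite -(meanB (iah f m mf fM) (iah h m mh FM)).
  apply: (@le_trans _ _ (mean P (fun w => ep + 2 * M * (B < `|W m w|)%R%:R))).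
    apply: norm_mean_le; [exact: integB (iah f m mf fM) (iah h m mh FM)|exact: (integD (integ_cst _ _) (integZ _ it))|].
    move=> w; rewrite -mulrBr normrM -[leRHS]mul1r ler_pM// distrC; exact: hf.
  rewrite (meanD (integ_cst _ _) (integZ _ it)) mean_cst (meanZ _ it) lerD2l.
  by rewrite ler_wpM2l// mulr_ge0.
have dQ : `|mean Q (fun z => f (Z z)) - mean Q (fun z => h (Z z))| <= ep + 2 * M * ep.
  have it := itail _ _ Q _ mZ.
  rewrite -(meanB (iQ f mf fM) (iQ h mh FM)).
  apply: (@le_trans _ _ (mean Q (fun z => ep + 2 * M * (B < `|Z z|)%R%:R))).
    apply: norm_mean_le; [exact: integB (iQ f mf fM) (iQ h mh FM)|exact: (integD (integ_cst _ _) (integZ _ it))|].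
    by move=> w; rewrite distrC; exact: hf.
  rewrite (meanD (integ_cst _ _) (integZ _ it)) mean_cst (meanZ _ it) lerD2l.
  by rewrite ler_wpM2l// mulr_ge0.
have e20 : 0 < e / 2 by rewrite divr_gt0.
have /cvgrPdist_le := @mean_thin B^-1 F n; move=> /(_ _ e20).
apply: filterS => m; rewrite -/h => hm.
have epE : 4 * (1 + 2 * M) * ep <= e.
  rewrite (_ : e = (4 * (1 + 2 * M) + 1) * ep); last by rewrite mulrC divfK// gt_eqF.
  by rewrite ler_wpM2r ?(ltW ep0)//; lra.
have dP' := dP m; rewrite distrC in dP'.
have := ler_pM (normr_ge0 _) (normr_ge0 _) c1 dQ; rewrite -normrM mulrBr mul1r => dQ'.
set A1 := mean P (fun w => a w * f (W m w)) in dP' *.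
set A2 := mean P (fun w => a w * h (W m w)) in dP' *.
rewrite -/A2 in hm.
set C1 := c * mean Q (fun z => f (Z z)) in dQ' *.
set C2 := c * mean Q (fun z => h (Z z)) in dQ' *.
rewrite -/C2 in hm.
have := ler_normD (C1 - C2) ((C2 - A2) + (A2 - A1)).
have := ler_normD (C2 - A2) (A2 - A1).
rewrite (_ : C1 - C2 + _ = C1 - A1); last by ring.
lra.
Qed.

End continuity_theorem.


(** * The profile objective: a parabola with a bounded rational perturbation *)

Section profile.
Context {R : realType}.
Implicit Types (p q a b x y : R).

Definition ratio p q x : R := (p + q * x) / (1 + x ^+ 2).

Let D_gt0 x : 0 < 1 + x ^+ 2. Proof. by have := sqr_ge0 x; lra. Qed.

Lemma ratio_bound p q x : `|ratio p q x| <= `|p| + `|q|.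
Proof.
rewrite /ratio normrM normfV (gtr0_norm (D_gt0 x)) ler_pdivrMr//.
apply: le_trans (ler_normD _ _) _; rewrite normrM mulrDl.
have p0 := normr_ge0 p; have q0 := normr_ge0 q.
have x1 : `|x| <= 1 + x ^+ 2.
  by rewrite -(real_normK (num_real x)); have := sqr_ge0 (`|x| - 1); nra.
by apply: lerD; [rewrite ler_peMr//; have := sqr_ge0 x; lra|rewrite ler_wpM2l].
Qed.

Lemma ratio_lipschitz p q x y : `|ratio p q x - ratio p q y| <= (`|p| + `|q|) * `|x - y|.
Proof.
have Dx := D_gt0 x; have Dy := D_gt0 y; have DD := mulr_gt0 Dx Dy.
have -> : ratio p q x - ratio p q y =
    (p * - (x + y) + q * (1 - x * y)) * (x - y) / ((1 + x ^+ 2) * (1 + y ^+ 2)).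
  by rewrite /ratio; field; rewrite !gt_eqF.
rewrite normrM normfV (gtr0_norm DD) ler_pdivrMr// normrM [leRHS]mulrAC ler_wpM2r//.
apply: le_trans (ler_normD _ _) _; rewrite !normrM mulrDl.
apply: lerD; apply: ler_wpM2l => //.
  rewrite ler_norml; apply/andP; split; have := sqr_ge0 (x - 1); have := sqr_ge0 (y - 1);
  have := sqr_ge0 (x + 1); have := sqr_ge0 (y + 1); have := sqr_ge0 (x * y); nra.
rewrite ler_norml; apply/andP; split; have := sqr_ge0 (x - y); have := sqr_ge0 (x + y);
  have := sqr_ge0 (x * y); nra.
Qed.

(** The coefficient of [x - a] is the derivative at [a]. The remainder is exactly [(x - a) ^+ 2]
    times a bounded rational function, so the bound holds for all [x], near [a] or not. *)
Lemma ratio_taylor p q a x :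
  `|ratio p q x - ratio p q a - (x - a) * ((q * (1 - a ^+ 2) - 2 * a * p) / (1 + a ^+ 2) ^+ 2)|
    <= 3 * (`|p| + `|q|) * (x - a) ^+ 2.
Proof.
have Dx := D_gt0 x; have Da := D_gt0 a.
have DD : 0 < (1 + x ^+ 2) * (1 + a ^+ 2) ^+ 2 by rewrite mulr_gt0// exprn_gt0.
rewrite (_ : _ - _ = (p * (2 * a * x + a ^+ 2 - 1) + q * (x * a ^+ 2 - 2 * a - x)) * (x - a) ^+ 2 /
    ((1 + x ^+ 2) * (1 + a ^+ 2) ^+ 2)); last by rewrite /ratio; field; rewrite !gt_eqF.
rewrite normrM normfV (gtr0_norm DD) ler_pdivrMr// normrM (ger0_norm (sqr_ge0 (x - a))).
rewrite [leRHS]mulrAC ler_wpM2r ?sqr_ge0//.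
have a2 := sqr_ge0 a; have x2 := sqr_ge0 x; have a4 := sqr_ge0 (a ^+ 2).
have xa2 : 0 <= x ^+ 2 * a ^+ 2 by rewrite mulr_ge0.
have xa4 : 0 <= x ^+ 2 * (a ^+ 2) ^+ 2 by rewrite mulr_ge0.
have h1 : `|2 * a * x + a ^+ 2 - 1| <= 3 * ((1 + x ^+ 2) * (1 + a ^+ 2) ^+ 2).
  by rewrite ler_norml; apply/andP; split; have := sqr_ge0 (a - x); have := sqr_ge0 (a + x); nra.
have h2 : `|x * a ^+ 2 - 2 * a - x| <= 3 * ((1 + x ^+ 2) * (1 + a ^+ 2) ^+ 2).
  have e1 : `|x| <= 1 + x ^+ 2.
    by rewrite ler_norml; apply/andP; split; have := sqr_ge0 (x - 1); have := sqr_ge0 (x + 1); nra.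
  move: e1; rewrite !ler_norml => /andP[e1 e2]; have := sqr_ge0 (a - 1); have := sqr_ge0 (a + 1).
  by move=> *; apply/andP; split; nra.
apply: le_trans (ler_normD _ _) _; rewrite !normrM.
have := ler_wpM2l (normr_ge0 p) h1; have := ler_wpM2l (normr_ge0 q) h2; lra.
Qed.

(** A second-difference form of a lower bound for the second derivative. The parabola contributes
    [2 * A * h ^+ 2], so the sum is strictly midpoint convex as soon as [6 * (|p| + |q|) < A]. *)
Lemma ratio_midpoint p q x h :
  - (12 * (`|p| + `|q|) * h ^+ 2) <= ratio p q (x + h) + ratio p q (x - h) - 2 * ratio p q x.
Proof.
have D0 := D_gt0 x; have Dp := D_gt0 (x + h); have Dm := D_gt0 (x - h).
set D := (1 + x ^+ 2) * ((1 + (x + h) ^+ 2) * (1 + (x - h) ^+ 2)).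
have DD : 0 < D by rewrite !mulr_gt0.
rewrite (_ : _ - 2 * _ = h ^+ 2 * ((p * (6 * x ^+ 2 - 2 - 2 * h ^+ 2) +
    q * (x * (2 * x ^+ 2 - 6 - 2 * h ^+ 2))) / D)); last first.
  by rewrite /ratio /D; field; rewrite !gt_eqF.
have x2 := sqr_ge0 x; have h2 := sqr_ge0 h.
have E : 1 + 2 * h ^+ 2 + 2 * x ^+ 2 <= (1 + (x + h) ^+ 2) * (1 + (x - h) ^+ 2).
  by have := sqr_ge0 ((x + h) * (x - h)); nra.
have ED : (1 + x ^+ 2) * (1 + 2 * h ^+ 2 + 2 * x ^+ 2) <= D by rewrite /D ler_wpM2l// ltW.
have xh2 : 0 <= x ^+ 2 * h ^+ 2 by rewrite mulr_ge0.
have x4 : 0 <= x ^+ 2 * x ^+ 2 by rewrite mulr_ge0.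
have h1 : `|6 * x ^+ 2 - 2 - 2 * h ^+ 2| <= 12 * D.
  by rewrite ler_norml; apply/andP; split; nra.
have h3 : `|x * (2 * x ^+ 2 - 6 - 2 * h ^+ 2)| <= 12 * D.
  rewrite normrM; have e1 : 2 * `|x| <= 1 + x ^+ 2.
    by rewrite -(real_normK (num_real x)); have := sqr_ge0 (`|x| - 1); nra.
  have e2 : `|2 * x ^+ 2 - 6 - 2 * h ^+ 2| <= 6 * (1 + 2 * h ^+ 2 + 2 * x ^+ 2).
    by rewrite ler_norml; apply/andP; split; nra.
  have := ler_pM (mulr_ge0 (ler0n _ 2) (normr_ge0 x)) (normr_ge0 _) e1 e2; lra.
have B : `|(p * (6 * x ^+ 2 - 2 - 2 * h ^+ 2) + q * (x * (2 * x ^+ 2 - 6 - 2 * h ^+ 2))) / D|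
    <= 12 * (`|p| + `|q|).
  rewrite normrM normfV (gtr0_norm DD) ler_pdivrMr//.
  apply: le_trans (ler_normD _ _) _; rewrite [`|p * _|]normrM [`|q * _|]normrM.
  have := ler_wpM2l (normr_ge0 p) h1; have := ler_wpM2l (normr_ge0 q) h3; lra.
move: B; rewrite ler_norml => /andP[B _].
by have := ler_wpM2l h2 B; lra.
Qed.

Lemma continuous_ratio p q : continuous (ratio p q).
Proof.
move=> x; rewrite /ratio; apply: cvgM.
  by apply: cvgD; [exact: cvg_cst|apply: cvgMl_tmp; exact: cvg_id].
apply: cvgV; first by rewrite gt_eqF.
by apply: cvgD; [exact: cvg_cst|exact: exprn_continuous].
Qed.

(** A minimiser exists on the unit interval around [b / A], and further away the parabola exceeds
    the oscillation of [ratio]. Two distinct minimisers would be beaten by their midpoint. Comparing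
    the values at [a] and [b / A], with the Lipschitz bound for [ratio], gives
    [A * |a - b / A| ^+ 2 <= B * |a - b / A|], hence the location. *)
Lemma profile_min (A b c p q : R) : 6 * (`|p| + `|q|) < A ->
  let f x := A * x ^+ 2 - 2 * b * x + c + ratio p q x in
  exists a, [/\ forall x, f a <= f x, forall x, (forall y, f x <= f y) -> x = a &
    `|a - b / A| <= (`|p| + `|q|) / A].
Proof.
move=> hA f; set B := `|p| + `|q| in hA *.
have B0 : 0 <= B by rewrite addr_ge0.
have A0 : 0 < A by apply: le_lt_trans hA; rewrite mulr_ge0.
have fE x : f x = A * (x - b / A) ^+ 2 + (c - b ^+ 2 / A) + ratio p q x.
  by rewrite /f; field; rewrite gt_eqF.
have cf : continuous f.
  move=> x; apply: cvgD; last exact: continuous_ratio.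
  apply: cvgD; last exact: cvg_cst.
  apply: cvgB; last by apply: cvgMl_tmp; exact: cvg_id.
  by apply: cvgMl_tmp; exact: exprn_continuous.
have ab : b / A - 1 <= b / A + 1 by lra.
have [a aI ha] := EVT_min ab (continuous_subspaceT cf).
have gmin x : f a <= f x.
  have [h1|h1] := leP `|x - b / A| 1.
    apply: ha; rewrite in_itv /=; move: h1; rewrite ler_norml => /andP[h1 h2].
    by apply/andP; split; lra.
  have /ha : b / A \in `[b / A - 1, b / A + 1] by rewrite in_itv /=; apply/andP; split; lra.
  move=> /le_trans; apply; rewrite !fE subrr expr0n mulr0 add0r.
  have := ratio_bound p q x; have := ratio_bound p q (b / A); rewrite -/B !ler_norml.
  move=> /andP[_ h2] /andP[h3 _].
  have : A * 1 <= A * (x - b / A) ^+ 2.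
    rewrite ler_wpM2l ?(ltW A0)// -(real_normK (num_real _)).
    by rewrite -[leLHS](expr1n R 2) lerXn2r// ?nnegrE// ltW.
  lra.
exists a; split => // [x hx|].
  apply/eqP; rewrite -subr_eq0; apply/negPn/negP => xa.
  pose h := (x - a) / 2; pose m := (x + a) / 2.
  have h0 : 0 < h ^+ 2 by rewrite exprn_even_gt0//= mulf_neq0// invr_neq0.
  have := ratio_midpoint p q m h; rewrite -/B.
  rewrite (_ : m + h = x); last by rewrite /m /h; field.
  rewrite (_ : m - h = a); last by rewrite /m /h; field.
  have := hx m; have := gmin m; rewrite /f.
  have -> : m = a + h by rewrite /m /h; field.
  have -> : x = a + 2 * h by rewrite /h; field.
  have : 12 * B * h ^+ 2 < 2 * A * h ^+ 2 by rewrite ltr_pM2r//; lra.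
  nra.
have := gmin (b / A); rewrite !fE subrr expr0n mulr0 add0r => h1.
have := ratio_lipschitz p q (b / A) a; rewrite -/B ler_norml => /andP[_ h2].
have : A * `|a - b / A| ^+ 2 <= B * `|a - b / A|.
  by rewrite real_normK ?num_real// (distrC a); lra.
rewrite ler_pdivlMr//; have [->|] := eqVneq `|a - b / A| 0; first by rewrite mul0r.
move=> n0; have n1 : 0 < `|a - b / A| by rewrite lt_neqAle eq_sym n0 normr_ge0.
by rewrite expr2 mulrA ler_pM2r// mulrC.
Qed.
End profile.

(** * Elimination of the outlier sizes and the least squares estimator *)

Section cls.
Context {R : realType}.
Variables (mu : R) (s1 s2 n : nat) (y : nat -> R).
Local Notation regular k := (k \notin [:: s1; s1.+1; s2; s2.+1]).

(** The outlier size minimising, at fixed [a], the two residuals that contain it; at [a = alpha] it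
    is the centring [L] of the theorem. *)
Definition outlier_level (s : nat) (a : R) :=
  y s - (a * (y s.-1 + y s.+1) + (1 - a) * mu) / (1 + a ^+ 2).

Definition cls_A := \sum_(1 <= k < n.+1 | regular k) y k.-1 ^+ 2 + y s1.-1 ^+ 2 + y s2.-1 ^+ 2.

Definition cls_b :=
  \sum_(1 <= k < n.+1 | regular k) y k.-1 * (y k - mu) - y s1.-1 * mu - y s2.-1 * mu.

Let cc s := y s.+1 + y s.-1 - mu.

Definition cls_p := (cc s1 ^+ 2 - mu ^+ 2) + (cc s2 ^+ 2 - mu ^+ 2).
Definition cls_q := - (2 * cc s1 * mu) - 2 * cc s2 * mu.

(** Completing the square in [t]. What remains depends on [a] through a parabola and a fraction over
    [1 + a ^+ 2], the sources of the extra terms in [cls_A], [cls_b] and of [cls_p], [cls_q]. *)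
Let outlier_term s a t : (y s - a * y s.-1 - mu - t) ^+ 2 + (y s.+1 - a * y s - mu + a * t) ^+ 2 =
  y s.-1 ^+ 2 * a ^+ 2 + 2 * (y s.-1 * mu) * a + (y s.-1 ^+ 2 - 2 * y s.-1 * cc s + mu ^+ 2) +
  ratio (cc s ^+ 2 - mu ^+ 2) (- (2 * cc s * mu)) a + (1 + a ^+ 2) * (t - outlier_level s a) ^+ 2.
Proof.
have D0 : 1 + a ^+ 2 != 0 by rewrite gt_eqF//; have := sqr_ge0 a; lra.
by rewrite /ratio /outlier_level /cc; field.
Qed.

Lemma Qn_profile : exists c, forall a t1 t2, Qn mu s1 s2 n y a t1 t2 =
  (cls_A * a ^+ 2 - 2 * cls_b * a + c + ratio cls_p cls_q a) +
  (1 + a ^+ 2) * ((t1 - outlier_level s1 a) ^+ 2 + (t2 - outlier_level s2 a) ^+ 2).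
Proof.
pose k0 s := y s.-1 ^+ 2 - 2 * y s.-1 * cc s + mu ^+ 2.
exists (\sum_(1 <= k < n.+1 | regular k) (y k - mu) ^+ 2 + k0 s1 + k0 s2) => a t1 t2.
rewrite /Qn !outlier_term.
rewrite (eq_bigr (fun k => a ^+ 2 * y k.-1 ^+ 2 + (- (2 * a)) * (y k.-1 * (y k - mu)) + (y k - mu) ^+ 2));
  last by move=> k _; ring.
rewrite !big_split /= -!mulr_sumr /cls_A /cls_b /cls_p /cls_q /ratio /k0.
have D0 : 1 + a ^+ 2 != 0 by rewrite gt_eqF//; have := sqr_ge0 a; lra.
by field.
Qed.

(** The squares around the outlier levels are non-negative, so minimising over three variables is
    minimising the profile and then taking the levels; uniqueness of [a] forces both squares to
    vanish. *)
Lemma CLS_spec : 6 * (`|cls_p| + `|cls_q|) < cls_A ->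
  exists2 a, CLS mu s1 s2 n y = (a, outlier_level s1 a, outlier_level s2 a) &
    `|a - cls_b / cls_A| <= (`|cls_p| + `|cls_q|) / cls_A.
Proof.
move=> h; have [c QE] := Qn_profile.
pose f x := cls_A * x ^+ 2 - 2 * cls_b * x + c + ratio cls_p cls_q x.
have [a [amin auniq ad]] : exists a, [/\ forall x, f a <= f x,
    forall x, (forall y, f x <= f y) -> x = a & `|a - cls_b / cls_A| <= (`|cls_p| + `|cls_q|) / cls_A].
  exact: profile_min.
exists a => //; rewrite /CLS.
have fQ x : f x = Qn mu s1 s2 n y x (outlier_level s1 x) (outlier_level s2 x).
  by rewrite QE /f; ring.
have Qf x t1 t2 : f x <= Qn mu s1 s2 n y x t1 t2.
  rewrite QE /f lerDl mulr_ge0 ?addr_ge0 ?sqr_ge0//.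
have vmin : is_global_min (fun v : R * R * R => Qn mu s1 s2 n y v.1.1 v.1.2 v.2)
    (a, outlier_level s1 a, outlier_level s2 a).
  by move=> [[x t1] t2] /=; rewrite -fQ; exact: le_trans (Qf _ _ _).
have vuniq w : is_global_min (fun v : R * R * R => Qn mu s1 s2 n y v.1.1 v.1.2 v.2) w ->
    w = (a, outlier_level s1 a, outlier_level s2 a).
  case: w => [[x t1] t2] wm; have xa : x = a.
    by apply: auniq => z; rewrite [leRHS]fQ; exact: le_trans (Qf x t1 t2) (wm (z, _, _)).
  rewrite xa in wm *; have := wm (a, outlier_level s1 a, outlier_level s2 a); rewrite /= !QE.
  have d0 := sqr_ge0 a; have d1 := sqr_ge0 (t1 - outlier_level s1 a).
  have d2 := sqr_ge0 (t2 - outlier_level s2 a).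
  rewrite !subrr expr0n addr0 mulr0 addr0 gerDl => h3.
  have : (t1 - outlier_level s1 a) ^+ 2 + (t2 - outlier_level s2 a) ^+ 2 <= 0.
    by rewrite -(@pmulr_rle0 _ (1 + a ^+ 2))//; lra.
  move=> h4; have : (t1 - outlier_level s1 a) ^+ 2 == 0 by apply/eqP; lra.
  have : (t2 - outlier_level s2 a) ^+ 2 == 0 by apply/eqP; lra.
  by rewrite !sqrf_eq0 !subr_eq0 => /eqP -> /eqP ->.
(* The set of unique minimisers is inhabited, so the default [(0, 0, 0)] is excluded. *)
case: xgetP => [v -> [vm _]|]; first exact: vuniq.
by move=> /(_ (a, outlier_level s1 a, outlier_level s2 a)) []; split.
Qed.
End cls.


(** * Comparison of the normal equation with sums over the uncontaminated chain *)

Section sample_sums.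
Context {R : realType}.
Variables (alpha mu : R) (x : nat -> nat) (s1 s2 th1 th2 n : nat).
Hypotheses (s1_gt0 : (0 < s1)%N) (s12 : (s1.+1 < s2)%N) (s2n : (s2 < n)%N).
Local Notation regular k := (k \notin [:: s1; s1.+1; s2; s2.+1]).
Let y k : R := (x k + (k == s1) * th1 + (k == s2) * th2)%:R.
Let D k : R := (x k)%:R * ((x k.+1)%:R - alpha * (x k)%:R - mu).

Let yE k : k != s1 -> k != s2 -> y k = (x k)%:R.
Proof. by rewrite /y => /negbTE -> /negbTE ->; rewrite !mul0n !addn0. Qed.

(** Summands are indexed by the later time [k] and expressed at [k.-1], so the excluded indices [s],
    [s.+1] remove the terms at [s.-1] and [s]. The gap between [s1] and [s2] keeps the four indices
    distinct. *)
Let sum_regular (F G : nat -> R) : (forall k, (0 < k)%N -> regular k -> F k = G k.-1) ->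
  \sum_(1 <= k < n.+1 | regular k) F k =
    \sum_(k < n) G k - (G s1.-1 + G s1 + G s2.-1 + G s2).
Proof.
move=> FG; rewrite -(big_mkord predT G) -[X in X - _](big_add1 _ _ 0 n.+1 predT (fun k => G k.-1)).
rewrite [X in X - _](bigID (fun k => regular k)) /=.
rewrite [X in _ + X - _](_ : _ = G s1.-1 + G s1 + G s2.-1 + G s2); last first.
  rewrite -big_filter (perm_big [:: s1; s1.+1; s2; s2.+1]) /=; last first.
    apply: uniq_perm; first by rewrite filter_uniq// iota_uniq.
      rewrite /= !inE !negb_or; lia.
    move=> k; rewrite mem_filter mem_index_iota negbK !inE; lia.
  by rewrite !big_cons big_nil /= addr0 !addrA.
by rewrite addrK big_nat_cond [RHS]big_nat_cond; apply: eq_bigr => k /andP[/andP[k0 _] kr]; exact: FG.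
Qed.

(** The squares at [s1.-1] and [s2.-1] are put back by the elimination, so only the two contaminated
    times are missing. *)
Lemma cls_A_sum : cls_A s1 s2 n y = \sum_(k < n) (x k)%:R ^+ 2 - (x s1)%:R ^+ 2 - (x s2)%:R ^+ 2.
Proof.
rewrite /cls_A (@sum_regular _ (fun k => (x k)%:R ^+ 2)); last first.
  by move=> k k0; rewrite !inE !negb_or => /and4P[h1 h2 h3 h4]; rewrite yE//; lia.
rewrite !yE; [ring|lia..].
Qed.

(** The discrepancy, independent of [n], between [cls_b - alpha * cls_A] and the martingale. *)
Definition cls_shift := D s1.-1 + D s1 + D s2.-1 + D s2 + (y s1.-1 + y s2.-1) * mu +
  alpha * (y s1.-1 ^+ 2 + y s2.-1 ^+ 2).

Lemma cls_b_sum : cls_b mu s1 s2 n y - alpha * cls_A s1 s2 n y = \sum_(k < n) D k - cls_shift.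
Proof.
rewrite /cls_b /cls_A /cls_shift.
rewrite (_ : \sum_(k < n) D k = \sum_(1 <= k < n.+1 | regular k) y k.-1 * (y k - mu) -
   alpha * \sum_(1 <= k < n.+1 | regular k) y k.-1 ^+ 2 + (D s1.-1 + D s1 + D s2.-1 + D s2)).
  by ring.
rewrite mulr_sumr -sumrB (@sum_regular _ D) ?subrK// => k k0.
rewrite !inE !negb_or => /and4P[h1 h2 h3 h4].
have k1 : k.-1 != s1 by lia.
have k2 : k.-1 != s2 by lia.
by rewrite (yE h1 h3) (yE k1 k2) /D prednK//; ring.
Qed.

(** One quantity, independent of [n], that dominates every boundary effect of the outliers; as a
    single random variable it is tight. *)
Definition outlier_size := (x s1)%:R ^+ 2 + (x s2)%:R ^+ 2 + `|cls_shift| +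
  6 * (`|cls_p mu s1 s2 y| + `|cls_q mu s1 s2 y|).

(** The deterministic half of the argument: the hypotheses describe a good sample, and no
    probability enters. The two summands bounded by [rho] are the boundary effects divided by [A],
    and the replacement of [A / n] by [m2]. *)
Lemma CLS_close (m2 dl rho K : R) : 0 < m2 -> 0 < K ->
  outlier_size <= K ->
  `|(\sum_(k < n) D k) / Num.sqrt n%:R| <= K ->
  `|(\sum_(k < n) (x k)%:R ^+ 2) / n%:R - m2| <= dl ->
  dl + K / Num.sqrt n%:R <= m2 / 4 ->
  4 * K / Num.sqrt n%:R / m2 + 2 * K * (dl + K / Num.sqrt n%:R) / m2 ^+ 2 <= rho ->
  exists2 a, CLS mu s1 s2 n y = (a, outlier_level mu y s1 a, outlier_level mu y s2 a) &
    `|Num.sqrt n%:R * (a - alpha) - (\sum_(k < n) D k) / Num.sqrt n%:R / m2| <= rho.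
Proof.
move=> m20 K0 hX hS hU h1 h2.
set s := Num.sqrt n%:R in hS h1 h2 *.
set U := \sum_(k < n) (x k)%:R ^+ 2 in hU.
set S := \sum_(k < n) D k in hS *.
set A := cls_A s1 s2 n y; set Pq := `|cls_p mu s1 s2 y| + `|cls_q mu s1 s2 y|.
have n0 : (0 < n)%N by lia.
have s1' : 1 <= s by rewrite -sqrtr1 ler_wsqrtr// ler1n.
have s0 : 0 < s by exact: lt_le_trans s1'.
have ns : n%:R = s ^+ 2 by rewrite sqr_sqrtr.
have Pq0 : 0 <= Pq by rewrite addr_ge0.
have shift0 := normr_ge0 cls_shift.
have x1 := sqr_ge0 ((x s1)%:R : R); have x2 := sqr_ge0 ((x s2)%:R : R).
rewrite /outlier_size -/Pq in hX.
have AE : A = U - (x s1)%:R ^+ 2 - (x s2)%:R ^+ 2 by exact: cls_A_sum.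
have KN : K / s ^+ 2 <= K / s.
  by rewrite ler_pM2l// lef_pV2 ?posrE ?exprn_gt0// expr2 ler_peMl// ltW.
pose r := A / s ^+ 2 - m2.
have rb : `|r| <= dl + K / s.
  rewrite (_ : r = (U / s ^+ 2 - m2) - ((x s1)%:R ^+ 2 + (x s2)%:R ^+ 2) / s ^+ 2); last first.
    by rewrite /r AE; ring.
  apply: le_trans (ler_normB _ _) _; rewrite -ns; apply: lerD => //.
  rewrite ger0_norm; last by rewrite divr_ge0// addr_ge0.
  apply: le_trans KN; rewrite ns ler_pM2r ?invr_gt0 ?exprn_gt0//; lra.
have s20 : 0 < s ^+ 2 by rewrite exprn_gt0.
have A_ge : m2 / 2 * s ^+ 2 <= A.
  rewrite -ler_pdivlMr//; have := le_trans rb h1; rewrite ler_norml => /andP[+ _].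
  by rewrite /r; lra.
have A0 : 0 < A by apply: lt_le_trans A_ge; rewrite mulr_gt0// divr_gt0.
have KA : K < A.
  apply: lt_le_trans A_ge; rewrite -ltr_pdivrMr//; apply: le_lt_trans KN _.
  have := le_trans (normr_ge0 _) hU; lra.
have [a aE ad] : exists2 a, CLS mu s1 s2 n y = (a, outlier_level mu y s1 a, outlier_level mu y s2 a) &
    `|a - cls_b mu s1 s2 n y / A| <= Pq / A.
  by apply: CLS_spec; rewrite -/A -/Pq; lra.
exists a => //; apply: le_trans h2.
have As : m2 + r = A / s ^+ 2 by rewrite /r; ring.
have mr : m2 / 2 <= m2 + r by rewrite As ler_pdivlMr.
have mr0 : 0 < m2 + r by lra.
have b_eq : cls_b mu s1 s2 n y = alpha * A + S - cls_shift by have /eqP := cls_b_sum; rewrite -/A -/S subr_eq => /eqP ->; ring.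
(* Three errors: the distance of [a] from [b / A], the shift, and [A / n = m2 + r] in place of
   [m2]. *)
rewrite (_ : _ - _ = s * (a - cls_b mu s1 s2 n y / A) - s * (cls_shift / A) -
    S / s * (r / ((m2 + r) * m2))); last first.
  rewrite b_eq [in RHS]As /r; field; rewrite !gt_eqF//.
apply: le_trans (ler_normB _ _) _; apply: lerD.
  apply: le_trans (ler_normB _ _) _; rewrite !normrM (gtr0_norm s0) normfV (gtr0_norm A0) -mulrDr.
  apply: (@le_trans _ _ (s * (2 * K / (m2 / 2 * s ^+ 2)))); last first.
    by rewrite le_eqVlt; apply/orP; left; apply/eqP; field; rewrite !gt_eqF.
  rewrite ler_wpM2l ?(ltW s0)//; apply: (@le_trans _ _ (2 * K / A)).
    by apply: le_trans (lerD ad (lexx _)) _; rewrite -mulrDl ler_pM2r ?invr_gt0//; lra.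
  by rewrite ler_pM2l ?mulr_gt0// lef_pV2 ?posrE// !mulr_gt0// invr_gt0.
rewrite normrM (_ : 2 * K * _ / m2 ^+ 2 = K * (2 * (dl + K / s) / m2 ^+ 2)); last by ring.
apply: ler_pM => //; rewrite normrM normfV (gtr0_norm (mulr_gt0 mr0 m20)).
rewrite ler_pdivrMr ?mulr_gt0//; apply: le_trans rb _.
rewrite [leRHS](_ : _ = (dl + K / s) * (2 * (m2 + r) / m2)); last by field; rewrite !gt_eqF.
apply: ler_peMr; first by have := le_trans (normr_ge0 _) hU; have : 0 <= K / s by [rewrite divr_ge0// ltW]; lra.
by rewrite ler_pdivlMr//; lra.
Qed.
End sample_sums.


(** * Slutsky's theorem and linearisation of the outlier levels *)

Lemma continuous_pair (U : topologicalType) (R : realType) (f g : U -> R) x :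
  {for x, continuous f} -> {for x, continuous g} -> {for x, continuous (fun z => (f z, g z))}.
Proof.
move=> cf cg.
have h := @cvg_pair _ _ _ (nbhs x) (nbhs (f x)) (nbhs (g x)) _ _ _ f g cf cg.
exact: h.
Qed.

Section slutsky.
Context {R : realType} {d d' : measure_display} {T : measurableType d} {T' : measurableType d'}.
Variables (P : probability T R) (Q : probability T' R).
Variables (a : T -> R) (W : nat -> T -> R) (Z : T' -> R) (c : R).
Hypotheses (ma : measurable_fun setT a) (a1 : forall w, `|a w| <= 1) (c1 : `|c| <= 1).
Hypotheses (mW : forall n, measurable_fun setT (W n)) (mZ : measurable_fun setT Z).
Hypothesis cos_cvg : forall th phi, mean P (fun w => a w * cos (th * W n w + phi)) @[n --> \oo] -->
  c * mean Q (fun z => cos (th * Z z + phi)).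
Hypothesis tight : forall e : R, 0 < e -> exists2 B : R, 0 < B & forall n,
  mean P (fun w => (B < `|W n w|)%R%:R) <= e.
Variables p q : nat -> T -> R.
Hypothesis residual : forall dl r : R, 0 < dl -> 0 < r -> exists N, forall n, (N <= n)%N ->
  exists bad : T -> R, [/\ integ P bad, mean P bad <= r, forall w, 0 <= bad w &
    forall w, bad w < 1 -> `|p n w| <= dl /\ `|q n w| <= dl].

(** Convergence in probability of [p] and [q] is encoded by integrable functions [bad] that are at
    least one wherever the residual is large, so that sums of indicators can be used directly.
    Without residuals both coordinates are multiples of [W n], which reduces the claim to one
    dimension; the residuals are removed uniformly on [|W n| <= B]. *)
Theorem slutsky (f : R * R -> R) (M e1 e2 : R) : continuous f -> (forall v, `|f v| <= M) ->
  (forall n, measurable_fun setT (fun w => f (W n w * e1 + p n w, W n w * e2 + q n w))) ->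
  mean P (fun w => a w * f (W n w * e1 + p n w, W n w * e2 + q n w)) @[n --> \oo] -->
    c * mean Q (fun z => f (Z z * e1, Z z * e2)).
Proof.
move=> cf fM mf; have M0 : 0 <= M by apply: le_trans (fM (0, 0)).
pose f0 z := f (z * e1, z * e2).
have cf0 : continuous f0.
  move=> z; apply: (@continuous_comp _ _ _ (fun z : R => (z * e1, z * e2)) f); last exact: cf.
  by apply: continuous_pair; apply: cvgMr_tmp; exact: cvg_id.
have mf0 : measurable_fun setT f0 by exact: continuous_measurable_fun.
have cg : continuous (fun v : R * (R * R) => f (v.1 * e1 + v.2.1, v.1 * e2 + v.2.2)).
  move=> v; apply: (@continuous_comp _ _ _ (fun v : R * (R * R) =>
    (v.1 * e1 + v.2.1, v.1 * e2 + v.2.2)) f); last exact: cf.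
  have c1' : {for v, continuous (fun v : R * (R * R) => v.2.1)}.
    by apply: (@continuous_comp _ _ _ (fun y : R * (R * R) => y.2) fst); [exact: cvg_snd|exact: cvg_fst].
  have c2' : {for v, continuous (fun v : R * (R * R) => v.2.2)}.
    by apply: (@continuous_comp _ _ _ (fun y : R * (R * R) => y.2) snd); [exact: cvg_snd|exact: cvg_snd].
  by apply: continuous_pair; apply: cvgD => //; apply: cvgMr_tmp; exact: cvg_fst.
have lim0 : mean P (fun w => a w * f0 (W n w)) @[n --> \oo] --> c * mean Q (fun z => f0 (Z z)).
  exact: (@weak_convergence _ _ _ _ _ P Q a W Z c ma a1 c1 mW mZ cos_cvg tight f0 M cf0 (fun z => fM _)).
apply/cvgrPdist_le => e e0.
have e20 : 0 < e / 2 by rewrite divr_gt0.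
(* The total cost is [ep] for the perturbation plus [2 * M] times the two small means, of [bad] and
   of the tail of [W n]. *)
pose ep := e / 2 / (1 + 4 * M).
have D0 : 0 < 1 + 4 * M by lra.
have ep0 : 0 < ep by rewrite divr_gt0.
have epE : ep + 4 * M * ep = e / 2 by rewrite /ep; field; rewrite gt_eqF.
have [B B0 hB] := tight ep0.
have [dl dl0 hdl] := compact_perturbation B cg ep0.
have [N hN] := residual dl0 ep0.
move/cvgrPdist_le : lim0 => /(_ _ e20)[N' _ hN'].
exists (maxn N N') => // n /= Nn.
have [bad [ibad mbad bad0 hbad]] := hN n (leq_trans (leq_maxl N N') Nn).
have h1 := hN' n (leq_trans (leq_maxr N N') Nn); rewrite /= in h1.
pose tl w : R := (B < `|W n w|)%R%:R.
have itl : integ P tl.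
  apply: (@integ_bounded _ _ _ _ 1); first exact: measurable_gt_norm.
  by move=> w; rewrite /tl; case: (_ < _); rewrite ?normr1 ?normr0.
have ia (k : T -> R) : measurable_fun setT k -> (forall w, `|k w| <= M) -> integ P (fun w => a w * k w).
  move=> mk kM; apply: (@integ_bounded _ _ _ _ M); first exact: measurable_funM.
  by move=> w; rewrite normrM -[leRHS]mul1r ler_pM.
have i1 := ia _ (mf n) (fun w => fM _).
have i2 : integ P (fun w => a w * f0 (W n w)).
  by apply: ia => [|w]; [exact: measurableT_comp|exact: fM].
have diff : `|mean P (fun w => a w * f0 (W n w)) -
    mean P (fun w => a w * f (W n w * e1 + p n w, W n w * e2 + q n w))| <= e / 2.
  rewrite -(meanB i2 i1).
  apply: (@le_trans _ _ (mean P (fun w => ep + 2 * M * (bad w + tl w)))).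
    have ibt := integD ibad itl.
    apply: norm_mean_le; [exact: (integB i2 i1)|exact: (integD (integ_cst _ _) (integZ _ ibt))|].
    move=> w; rewrite -mulrBr normrM -[leRHS]mul1r ler_pM//.
    have [b1|b1] := ltP (bad w) 1.
      have [h2 h3] := hbad w b1.
      rewrite /tl; have [W1|W1] := ltP B `|W n w|.
        rewrite (_ : true%:R = 1 :> R)//; apply: le_trans (ler_normB _ _) _.
        have := fM (W n w * e1, W n w * e2); have := fM (W n w * e1 + p n w, W n w * e2 + q n w).
        by have := mulr_ge0 M0 (bad0 w); rewrite /f0; lra.
      rewrite (_ : false%:R = 0 :> R)// addr0; apply: ler_wpDr.
        by rewrite !mulr_ge0.
      have := hdl (W n w) (p n w) (q n w) W1 h2 h3; rewrite /= !addr0 distrC; exact.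
    apply: le_trans (ler_normB _ _) _.
    have tl0 : 0 <= tl w by rewrite /tl ler0n.
    have := fM (W n w * e1, W n w * e2); have := fM (W n w * e1 + p n w, W n w * e2 + q n w).
    by have := ler_wpM2l M0 b1; have := mulr_ge0 M0 tl0; rewrite /f0; lra.
  have ibt := integD ibad itl.
  rewrite (meanD (integ_cst _ _) (integZ _ ibt)) mean_cst (meanZ _ ibt) (meanD ibad itl) -epE lerD2l.
  have := hB n; rewrite -/tl => h2; have := ler_wpM2l M0 (lerD mbad h2); lra.
have := ler_normD (c * mean Q (fun z => f0 (Z z)) - mean P (fun w => a w * f0 (W n w)))
  (mean P (fun w => a w * f0 (W n w)) -
    mean P (fun w => a w * f (W n w * e1 + p n w, W n w * e2 + q n w))).
rewrite addrA subrK /f0 in h1 diff *; lra.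
Qed.

End slutsky.

(** The delta method: up to the constant [y k], the level is [ratio (- mu) (mu - S)] with [S] the
    sum of the neighbouring observations, and [e] is its derivative at [alpha]. The quadratic
    remainder, multiplied by [s], equals a constant times [V ^+ 2 / s]. *)
Lemma level_residual (R : realType) (alpha mu a s V W K rho : R) (y : nat -> R) k :
  let e := ((alpha ^+ 2 - 1) * (y k.-1 + y k.+1) + (1 + 2 * alpha - alpha ^+ 2) * mu) /
    (1 + alpha ^+ 2) ^+ 2 in
  0 < s -> V = s * (a - alpha) -> `|W| <= K -> `|V - W| <= rho ->
  `|s * (outlier_level mu y k a - (y k - alpha / (1 + alpha ^+ 2) * (y k.-1 + y k.+1)
      - (1 - alpha) / (1 + alpha ^+ 2) * mu)) - W * e|
    <= `|e| * rho + 3 * (`|mu| + `|mu - (y k.-1 + y k.+1)|) * (K + rho) ^+ 2 / s.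
Proof.
move=> e s0 VE WK VW.
set S := y k.-1 + y k.+1 in e *; set C := `|mu| + _.
have D0 x : 1 + x ^+ 2 != 0 :> R by rewrite gt_eqF//; have := sqr_ge0 x; lra.
have := ratio_taylor (- mu) (mu - S) alpha a; rewrite normrN -/C.
rewrite (_ : ((mu - S) * _ - _) / _ = e); last by rewrite /e; congr (_ / _); ring.
set rem := _ - _ - _ * e => hrem.
rewrite (_ : _ - W * e = e * (V - W) + s * rem); last first.
  by rewrite VE /rem /ratio /outlier_level -/S; move: (e) => e'; field; rewrite !D0.
apply: le_trans (ler_normD _ _) _; apply: lerD; first by rewrite normrM ler_wpM2l.
rewrite normrM (gtr0_norm s0) mulrC -ler_pdivlMr//.
apply: le_trans hrem _.
rewrite [leRHS](_ : _ = 3 * C * ((K + rho) ^+ 2 / s ^+ 2)); last by field; rewrite gt_eqF.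
rewrite ler_wpM2l ?mulr_ge0 ?addr_ge0// ler_pdivlMr ?exprn_gt0//.
rewrite -exprMn mulrC -VE -(real_normK (num_real V)) lerXn2r// ?nnegrE//.
  by rewrite addr_ge0//; [exact: le_trans WK|exact: le_trans VW].
by have := ler_normD W (V - W); rewrite addrC subrK; lra.
Qed.


(** * The event on which the estimator follows the normalised martingale *)

Section estimator_event.
Context {R : realType} {d : measure_display} {T : measurableType d}.
Variables (P : probability T R) (alpha : R) (X0 : T -> nat) (eps : nat -> T -> nat).
Variables (xi : nat -> nat -> T -> nat) (mu sig2 : R) (pi : nat -> R) (s1 s2 th1 th2 : nat).
Hypothesis H : inar_model P alpha X0 eps xi mu sig2.
Hypothesis S : is_stationary alpha (eps_pmf P eps) pi.
Hypotheses (s1_gt0 : (0 < s1)%N) (s12 : (s1.+1 < s2)%N).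
Local Notation X := (inar X0 eps xi).
Local Notation Y w := (fun k => (Yobs X s1 s2 th1 th2 k w)%:R : R).
Local Notation m2 := (moment pi 2).
Local Notation mart := (martingale alpha X0 eps xi mu).
Local Notation adapted := (adapted X0 eps xi).

Lemma adapted_observed k (F : (nat -> R) -> R) :
  (forall y y', (forall j, (j <= k)%N -> y j = y' j) -> F y = F y') -> adapted k (fun w => F (Y w)).
Proof.
move=> hF; exists (fun p => F (fun j => (Yobs (fun j p => nth 0%N p j) s1 s2 th1 th2 j p)%:R)) => w.
by apply: hF => j jk; rewrite /Yobs path_to_nth.
Qed.

(** The outlier residuals are part of [Qn] for every [n], so small [n] still look at observations up
    to [s2.+1]. *)
Lemma eq_CLS n (y y' : nat -> R) : (forall j, (j <= maxn n s2.+1)%N -> y j = y' j) ->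
  CLS mu s1 s2 n y = CLS mu s1 s2 n y'.
Proof.
move=> yy'; have QE a t1 t2 : Qn mu s1 s2 n y a t1 t2 = Qn mu s1 s2 n y' a t1 t2.
  rewrite /Qn !(yy' s1, yy' s1.-1, yy' s1.+1, yy' s2, yy' s2.-1, yy' s2.+1); try lia.
  congr (_ + _ + _); rewrite big_nat_cond [RHS]big_nat_cond; apply: eq_bigr => k /andP[/andP[k1 k2] _].
  by rewrite !yy'//; lia.
by rewrite /CLS (_ : (fun v : R * R * R => _) = (fun v => Qn mu s1 s2 n y' v.1.1 v.1.2 v.2)) //;
  apply/funext => v; exact: QE.
Qed.

(** [bad] adds three indicators: large normalised martingale, large [outlier_size], failed law of
    large numbers. The bound [K] is fixed before [rho], since the linearisation of the outlier
    levels needs a bound on the score that does not change as [rho] shrinks. *)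
Lemma cls_event (r : R) : 0 < r -> exists2 K : R, 0 < K & forall rho : R, 0 < rho ->
  exists N, forall n, (N <= n)%N -> exists bad : T -> R,
    [/\ integ P bad, mean P bad <= r, forall w, 0 <= bad w &
      forall w, bad w < 1 -> `|mart n w / Num.sqrt n%:R / m2| <= K /\
        exists2 a, CLS mu s1 s2 n (Y w) = (a, outlier_level mu (Y w) s1 a, outlier_level mu (Y w) s2 a) &
          `|Num.sqrt n%:R * (a - alpha) - mart n w / Num.sqrt n%:R / m2| <= rho].
Proof.
move=> r0; have m20 := moment2_gt0 H S.
have r30 : 0 < r / 3 by rewrite divr_gt0.
have [B B0 hB] := martingale_tight H r30.
pose os w := outlier_size alpha mu (fun k => X k w) s1 s2 th1 th2.
have mos : measurable_fun setT os.
  apply: (adapted_measurable H (k := s2.+1)).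
  exists (fun p => outlier_size alpha mu (nth 0%N p) s1 s2 th1 th2) => w.
  rewrite /os /outlier_size /cls_shift /cls_p /cls_q !path_to_nth//; lia.
have [n0 hn0] := tail_vanishes P mos r30.
pose K := B + n0%:R; have K0 : 0 < K by rewrite ltr_wpDr.
exists (K / m2); first by rewrite divr_gt0.
move=> rho rho0.
(* The eighths make [dl + K / sqrt n] at most [m2 / 4] and each of the two error terms of
   [CLS_close] at most [rho / 2]. *)
pose dl := Num.min (m2 / 8) (rho * m2 ^+ 2 / (8 * K)).
have dl0 : 0 < dl by rewrite lt_min !divr_gt0 ?mulr_gt0 ?exprn_gt0.
have dl1 : dl <= m2 / 8 by rewrite ge_min lexx.
have dl2 : dl <= rho * m2 ^+ 2 / (8 * K) by rewrite ge_min lexx orbT.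
pose tau := Num.min (Num.min (m2 / 8) (rho * m2 / 8)) (rho * m2 ^+ 2 / (8 * K)).
have tau0 : 0 < tau by rewrite !lt_min !divr_gt0 ?mulr_gt0 ?exprn_gt0.
have /cvgrPdist_le/(_ _ r30)[N1 _ hN1] := lln_sqr H S dl0.
have := @sqrt_invn_cvg0 R K 0; under eq_fun do rewrite addn0.
move=> /cvgrPdist_le/(_ _ tau0)[N2 _ hN2].
exists (maxn s2.+1 (maxn N1 N2)) => n nN.
move: nN; rewrite !geq_max => /and3P[sn /hN1/= n1N /hN2/= n2N].
move: n1N.
rewrite sub0r normrN => /(le_trans (ler_norm _)) h1.
move: n2N; rewrite sub0r normrN => /(le_trans (ler_norm _)); rewrite !le_min => /andP[/andP[t1 t2] t3].
pose S0 w := mart n w / Num.sqrt n%:R.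
pose U0 w := (\sum_(k < n) (X k w)%:R ^+ 2) / n%:R - m2 : R.
have mS0 : measurable_fun setT S0.
  apply: (adapted_measurable H (k := n)).
  by apply: (adapted1 (fun x => x / Num.sqrt n%:R)); exact: adapted_martingale.
have mU0 : measurable_fun setT U0.
  apply: (adapted_measurable H (k := n)).
  apply: (adapted1 (fun x => x / n%:R - m2)).
  apply: (adapted_sum (f := fun j w => (X j w)%:R ^+ 2)) => j jn.
  exact: (adapted_X _ _ _ (fun x => x%:R ^+ 2) (ltnW jn)).
have itail (Z : T -> R) b : measurable_fun setT Z -> integ P (fun w => (b < `|Z w|)%R%:R : R).
  move=> mZ; apply: (@integ_bounded _ _ _ _ 1); first exact: measurable_gt_norm.
  by move=> w; case: (_ < _); rewrite ?normr1 ?normr0.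
have i1 := itail S0 B mS0; have i2 := itail os n0%:R mos; have i3 := itail U0 dl mU0.
exists (fun w => (B < `|S0 w|)%R%:R + (n0%:R < `|os w|)%R%:R + (dl < `|U0 w|)%R%:R); split.
- exact: (integD (integD i1 i2) i3).
- rewrite (meanD (integD i1 i2) i3) (meanD i1 i2).
  have := hB n; have := hn0 n0 (leqnn n0); move: h1; rewrite -/S0 -/U0; lra.
- by move=> w; rewrite !addr_ge0.
move=> w; case: (ltP B `|S0 w|) => [_|b1].
  by rewrite -addrA (_ : true%:R = 1 :> R)// ltNge lerDl addr_ge0.
case: (ltP n0%:R `|os w|) => [_|b2].
  by rewrite (_ : false%:R = 0 :> R)// add0r (_ : true%:R = 1 :> R)// ltNge lerDl ler0n.
case: (ltP dl `|U0 w|) => [_|b3 _].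
  by rewrite (_ : false%:R = 0 :> R)// !add0r ltxx.
have SK : `|S0 w| <= K by apply: le_trans b1 _; rewrite lerDl.
split.
  by rewrite normrM normfV (gtr0_norm m20) ler_pM2r ?invr_gt0.
apply: (@CLS_close _ alpha mu (fun k => X k w) s1 s2 th1 th2 n s1_gt0 s12 sn m2 dl rho K) => //.
- apply: le_trans (ler_norm _) _; apply: le_trans b2 _; rewrite lerDr; exact: ltW.
- lra.
have c0 : 0 < 2 * K / m2 ^+ 2 by rewrite divr_gt0 ?mulr_gt0 ?exprn_gt0.
have e1 : 4 * K / Num.sqrt n%:R / m2 <= rho / 2.
  by rewrite ler_pdivrMr// -mulrA; lra.
have e2 : 2 * K * (dl + K / Num.sqrt n%:R) / m2 ^+ 2 <= rho / 2.
  have := ler_wpM2l (ltW c0) (lerD dl2 t3).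
  rewrite (_ : 2 * K / m2 ^+ 2 * (rho * m2 ^+ 2 / (8 * K) + _) = rho / 2); last first.
    by field; rewrite !gt_eqF.
  by apply: le_trans; rewrite le_eqVlt; apply/orP; left; apply/eqP; ring.
lra.
Qed.

End estimator_event.


(** * Joint limit of the weight and the normalised score *)

Section limit_theorem.
Context {R : realType} {d : measure_display} {T : measurableType d}.
Variables (P : probability T R) (alpha : R) (X0 : T -> nat) (eps : nat -> T -> nat).
Variables (xi : nat -> nat -> T -> nat) (mu sig2 : R) (pi : nat -> R).
Hypothesis H : inar_model P alpha X0 eps xi mu sig2.
Hypothesis S : is_stationary alpha (eps_pmf P eps) pi.
Local Notation m2 := (moment pi 2).
Local Notation mart := (martingale alpha X0 eps xi mu).
Local Notation adapted := (adapted X0 eps xi).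
Local Notation N := (normal_prob 0 1 : probability _ R).

Definition limit_score n w : R := mart n w / Num.sqrt n%:R / m2.

Lemma adapted_limit_score n : adapted n (limit_score n).
Proof.
by apply: (adapted1 (fun x => x / Num.sqrt n%:R / m2)); exact: adapted_martingale.
Qed.

Lemma limit_score_tight (e : R) : 0 < e -> exists2 B : R, 0 < B & forall n,
  mean P (fun w => (B < `|limit_score n w|)%R%:R) <= e.
Proof.
move=> e0; have m20 := moment2_gt0 H S; have [B B0 hB] := martingale_tight H e0.
exists (B / m2) => [|n]; first exact: divr_gt0.
rewrite [leLHS](_ : _ = mean P (fun w => (B < `|mart n w / Num.sqrt n%:R|)%R%:R)); first exact: hB.
apply: eq_mean => w; rewrite /limit_score normrM normfV (gtr0_norm m20) ltr_pM2r ?invr_gt0//.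
Qed.

(** The limit is a product: asymptotically the score is independent of anything observed up to the
    fixed time [k0]. The frequency [th / m2] turns [incr_var] into [sigma2_ae]. *)
Lemma limit_score_cos k0 (a : T -> R) th phi : adapted k0 a -> (forall w, `|a w| <= 1) ->
  mean P (fun w => a w * cos (th * limit_score n w + phi)) @[n --> \oo] -->
    mean P a * mean N (fun z => cos (th * (Num.sqrt (sigma2_ae alpha sig2 pi) * z) + phi)).
Proof.
move=> aa a1; have m20 := moment2_gt0 H S.
have [g cg hg] := poisson_cond_var H S.
have s0 : 0 <= sigma2_ae alpha sig2 pi.
  by rewrite divr_ge0 ?exprn_ge0 ?(ltW m20)//; exact: (incr_var_ge0 H S).
rewrite (eq_mean N (g := fun z => cos (th * Num.sqrt (sigma2_ae alpha sig2 pi) * z + phi))); last first.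
  by move=> z; rewrite mulrA.
rewrite mean_normal_cos exprMn sqr_sqrtr//.
rewrite (_ : th ^+ 2 * sigma2_ae alpha sig2 pi / 2 = (th / m2) ^+ 2 / 2 * incr_var alpha sig2 pi); last first.
  by rewrite /sigma2_ae /incr_var; field; rewrite gt_eqF.
have h : mean P (fun w => a w * cos (th / m2 / Num.sqrt n%:R * mart n w + phi)) @[n --> \oo] -->
    mean P a * (cos phi * expR (- ((th / m2) ^+ 2 / 2 * incr_var alpha sig2 pi))).
  by rewrite mulrA; exact: (cos_clt H S aa a1 cg hg).
rewrite (_ : (fun n => _) = (fun n => mean P (fun w => a w * cos (th / m2 / Num.sqrt n%:R * mart n w + phi)))); first exact: h.
apply/funext => n; apply: eq_mean => w; rewrite /limit_score.
by congr (_ * cos (_ + _)); ring.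
Qed.

(** The common form of both claims: a weight from a fixed time, a direction [(e1, e2)] and vanishing
    residuals. Adaptedness of the residuals at some time provides measurability. *)
Theorem estimator_cvg k0 (a : T -> R) (p q : nat -> T -> R) (f : R * R -> R) (M e1 e2 : R) :
  adapted k0 a -> (forall w, `|a w| <= 1) ->
  (forall n, exists k, adapted k (p n)) -> (forall n, exists k, adapted k (q n)) ->
  (forall dl r : R, 0 < dl -> 0 < r -> exists N, forall n, (N <= n)%N ->
    exists bad : T -> R, [/\ integ P bad, mean P bad <= r, forall w, 0 <= bad w &
      forall w, bad w < 1 -> `|p n w| <= dl /\ `|q n w| <= dl]) ->
  continuous f -> (forall v, `|f v| <= M) ->
  mean P (fun w => a w * f (limit_score n w * e1 + p n w, limit_score n w * e2 + q n w)) @[n --> \oo] -->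
    mean P a * normal_rank1_expect (sigma2_ae alpha sig2 pi) (e1, e2) f.
Proof.
move=> aa a1 pa qa hres cf fM.
have ma := adapted_measurable H aa.
have ia : integ P a by exact: integ_bounded ma a1.
apply: (@slutsky _ _ _ _ _ P N a limit_score (fun z => Num.sqrt (sigma2_ae alpha sig2 pi) * z) (mean P a)
  ma a1 _ _ _ _ limit_score_tight p q hres f M e1 e2 cf fM) => //.
- by rewrite -(mean_cst P 1); apply: norm_mean_le => //; exact: integ_cst.
- by move=> n; exact: (adapted_measurable H (adapted_limit_score n)).
- by apply: measurable_funM.
- by move=> th phi; exact: (@limit_score_cos k0 a th phi aa a1).
- move=> n; have [k1 p1] := pa n; have [k2 q2] := qa n.
  pose k := maxn n (maxn k1 k2).
  apply: (adapted_measurable H (k := k)).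
  apply: (adapted2 (fun x y => f (x, y))).
    apply: (adapted2 (fun x y => x * e1 + y)).
      by apply: (adaptedW _ (adapted_limit_score n)); rewrite /k leq_maxl.
    by apply: (adaptedW _ p1); rewrite /k !leq_max leqnn orbT.
  apply: (adapted2 (fun x y => x * e2 + y)).
    by apply: (adaptedW _ (adapted_limit_score n)); rewrite /k leq_maxl.
  by apply: (adaptedW _ q2); rewrite /k !leq_max leqnn !orbT.
Qed.

End limit_theorem.

(** * The limits of the autoregressive estimator and, conditionally, of the outlier sizes *)

Theorem theorem3p4p2
  (R : realType) (d : measure_display) (T : measurableType d)
  (P : probability T R)
  (alpha : R) (X0 : T -> nat) (eps : nat -> T -> nat)
  (xi : nat -> nat -> T -> nat)
  (mu sig2eps : R) (pi : nat -> R) (s1 s2 th1 th2 : nat) :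
  0 < alpha < 1 ->
  (* measurability *)
  measurable_fun setT X0 ->
  (forall k, measurable_fun setT (eps k)) ->
  (forall k j, measurable_fun setT (xi k j)) ->
  (* X_0, (eps_k)_k, (xi_{k,j})_{k,j} are all mutually independent *)
  mutually_independent P (inar_family X0 eps xi) ->
  (* eps_k identically distributed *)
  (forall k (B : set nat), P (eps k @^-1` B) = P (eps 0%N @^-1` B)) ->
  (* xi_{k,j} Bernoulli with mean alpha *)
  (forall k j, P (xi k j @^-1` [set 1%N]) = alpha%:E /\
               P (xi k j @^-1` [set 0%N]) = (1 - alpha)%:E) ->
  (* moments of eps_1 *)
  (Exp P (fun w => ((eps 0%N w)%:R ^+ 2)%R) < +oo)%E ->
  (Exp P (fun w => ((eps 0%N w)%:R ^+ 3)%R) < +oo)%E ->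
  (0 < P (eps 0%N @^-1` [set n | n != 0%N]))%E ->
  Exp P (fun w => (eps 0%N w)%:R) = mu%:E ->
  Exp P (fun w => ((eps 0%N w)%:R - mu) ^+ 2) = sig2eps%:E ->
  (* moments of X_0 *)
  (Exp P (fun w => ((X0 w)%:R ^+ 2)%R) < +oo)%E ->
  (Exp P (fun w => ((X0 w)%:R ^+ 3)%R) < +oo)%E ->
  (* pi is the stationary distribution of the chain *)
  is_stationary alpha (fun k => fine (P (eps 0%N @^-1` [set k]))) pi ->
  (* outlier positions and sizes *)
  (0 < s1)%N -> (s1.+1 < s2)%N -> (0 < th1)%N -> (0 < th2)%N ->
  let X := inar X0 eps xi in
  let Y := Yobs X s1 s2 th1 th2 in
  let est := fun (n : nat) (w : T) => CLS mu s1 s2 n (fun k => (Y k w)%:R) in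
  let s2ae := sigma2_ae alpha sig2eps pi in
  let L := fun (s : nat) (w : T) =>
    (Y s w)%:R - alpha / (1 + alpha ^+ 2) * ((Y s.-1 w)%:R + (Y s.+1 w)%:R)
    - (1 - alpha) / (1 + alpha ^+ 2) * mu in
  let eta := fun w : T => (Y s1.-1 w, Y s2.-1 w, Y s1.+1 w, Y s2.+1 w) in
  let e := fun m : nat * nat * nat * nat =>
    let '(a1, a2, b1, b2) := m in
    (((alpha ^+ 2 - 1) * ((a1 + b1)%N)%:R + (1 + 2 * alpha - alpha ^+ 2) * mu)
       / (1 + alpha ^+ 2) ^+ 2,
     ((alpha ^+ 2 - 1) * ((a2 + b2)%N)%:R + (1 + 2 * alpha - alpha ^+ 2) * mu)
       / (1 + alpha ^+ 2) ^+ 2) in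
  cvg_dist_normal P
    (fun n w => Num.sqrt (n%:R) * ((est n w).1.1 - alpha)) s2ae /\
  cond_cvg_dist_normal_rank1 P
    (fun n w => (Num.sqrt (n%:R) * ((est n w).1.2 - L s1 w),
                 Num.sqrt (n%:R) * ((est n w).2 - L s2 w)))
    eta s2ae e.
Proof.
move=> alpha01 mX0 meps mxi indep law bern _ eps3 eps0 eps_mean eps_var _ X03 S s1_gt0 s12 _ _ X Y est s2ae L eta e.
have H : inar_model P alpha X0 eps xi mu sig2eps by split.
have K0 := cls_event th1 th2 H S s1_gt0 s12.
pose W := limit_score alpha X0 eps xi mu pi.
pose y w k : R := (Y k w)%:R.
have est_adapted (F : R * R * R -> R) n : exists k, adapted X0 eps xi k (fun w => F (est n w)).
  exists (maxn n s2.+1).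
  apply: (@adapted_observed _ _ _ X0 eps xi s1 s2 th1 th2 _ (fun y => F (CLS mu s1 s2 n y))).
  by move=> z z' zz'; congr F; apply: eq_CLS.
have W_adapted n : adapted X0 eps xi n (W n) by exact: adapted_limit_score.
split.
  move=> f cf [M fM].
  have cf1 : continuous (f \o fst : R * R -> R).
    by move=> v; apply: continuous_comp; [exact: cvg_fst|exact: cf].
  (* For the first claim the weight is one, the direction is [(1, 0)] and the test function ignores
     the second coordinate; [p] is the residual by definition. *)
  pose p n w := Num.sqrt n%:R * ((est n w).1.1 - alpha) - W n w.
  have := @estimator_cvg _ _ _ P alpha X0 eps xi mu sig2eps pi H S 0%N (fun=> 1) p (fun _ _ => 0)
    (f \o fst) M 1 0.
  have -> : mean P (fun=> 1) = 1 :> R by rewrite mean_cst.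
  rewrite mul1r /normal_rank1_expect /=.
  have -> : (fun z : R => f (Num.sqrt s2ae * z * 1)) = (fun z => f (Num.sqrt s2ae * z)).
    by apply/funext => z; rewrite mulr1.
  have -> : (fun n => mean P (fun w => 1 * f (W n w * 1 + p n w))) =
      (fun n => Rintegral P setT (fun w => f (Num.sqrt n%:R * ((est n w).1.1 - alpha)))).
    apply/funext => n; apply: eq_mean => w; rewrite mul1r mulr1 /p addrC subrK//.
  apply => //.
  - by exists (fun=> 1).
  - by move=> w; rewrite normr1.
  - move=> n; have [k hk] := est_adapted (fun v => v.1.1) n; exists (maxn k n).
    apply: (adapted2 (fun x y => Num.sqrt n%:R * (x - alpha) - y)).
      by apply: adaptedW hk; exact: leq_maxl.
    by apply: (adaptedW _ (W_adapted n)); exact: leq_maxr.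
  - by move=> n; exists 0%N; exists (fun=> 0).
  - move=> dl r dl0 r0; have [K _ /(_ _ dl0)[N hN]] := K0 _ r0.
    exists N => n /hN[bad [h1 h2 h3 h4]]; exists bad; split => // w /h4[_ [a aE ha]].
    by rewrite normr0 (ltW dl0) /p /est aE.
move=> m mP f cf [M fM].
set A := eta @^-1` [set m].
pose a : T -> R := \1_A.
pose Yo k (s : seq nat) := Yobs (fun j s => nth 0%N s j) s1 s2 th1 th2 k s.
have aE : adapted X0 eps xi s2.+1 a.
  exists (fun s => ((Yo s1.-1 s, Yo s2.-1 s, Yo s1.+1 s, Yo s2.+1 s) == m)%:R) => w.
  have YoE k : (k <= s2.+1)%N -> Yo k (path_to X0 eps xi s2.+1 w) = Y k w.
    by move=> ks; rewrite /Yo /Yobs path_to_nth.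
  rewrite !YoE; try lia.
  by rewrite /a indicE (_ : (w \in A) = (eta w == m))//; apply/idP/eqP; rewrite inE.
have a01 w : `|a w| <= 1 by rewrite /a indicE; case: (_ \in _); rewrite ?normr1 ?normr0.
have mA : measurable A.
  rewrite (_ : A = setT `&` a @^-1` [set 1]).
    by apply: (adapted_measurable H aE) => //; exact: measurable_set1.
  rewrite setTI; apply/seteqP; split => w /=.
    by move=> wA; rewrite /a indicE mem_set.
  by rewrite /a indicE; case: (boolP (w \in A)) => [/set_mem//|_] /eqP; rewrite eq_sym oner_eq0.
have meanA : mean P a = fine (P A) by exact: mean_indic.
have PA0 : 0 < fine (P A) by rewrite fine_gt0// mP (le_lt_trans (probability_le1 P mA))// ltry.
(* The factor [a] kills the residual off the conditioning event, where the direction is not [e m];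
   under the expectation, already weighted by [a], it changes nothing. *)
pose p s (z : R * R * R -> R) e0 n w := a w * (Num.sqrt n%:R * (z (est n w) - L s w) - W n w * e0).
have p_adapted s z e0 n : (s <= s2)%N -> exists k, adapted X0 eps xi k (p s z e0 n).
  move=> ss2; have [k hk] := est_adapted z n; exists (maxn n (maxn k s2.+1)).
  apply: (adapted2 *%R); first by apply: adaptedW aE; rewrite !leq_max leqnn !orbT.
  apply: (adapted2 (fun x y => x - y * e0)); last first.
    by apply: (adaptedW _ (W_adapted n)); rewrite leq_max leqnn.
  apply: (adapted2 (fun x y => Num.sqrt n%:R * (x - y))).
    by apply: (adaptedW _ hk); rewrite !leq_max leqnn orbT.
  apply: (adaptedW (k := s2.+1)); first by rewrite !leq_max leqnn !orbT.
  apply: (@adapted_observed _ _ _ X0 eps xi s1 s2 th1 th2 _ (fun y => y s -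
    alpha / (1 + alpha ^+ 2) * (y s.-1 + y s.+1) - (1 - alpha) / (1 + alpha ^+ 2) * mu)).
  by move=> y0 y1 hy; rewrite !hy//; lia.
have key := @estimator_cvg _ _ _ P alpha X0 eps xi mu sig2eps pi H S s2.+1 a
  (p s1 (fun v => v.1.2) (e m).1) (p s2 snd (e m).2) f M (e m).1 (e m).2.
rewrite meanA in key.
(* Dividing the limit weighted by the indicator by the probability of the event gives the
   conditional expectation. *)
have -> : (fun n => cond_exp P A (fun w => f (Num.sqrt n%:R * ((est n w).1.2 - L s1 w),
      Num.sqrt n%:R * ((est n w).2 - L s2 w)))) =
    (fun n => mean P (fun w => a w * f (W n w * (e m).1 + p s1 (fun v => v.1.2) (e m).1 n w,
      W n w * (e m).2 + p s2 snd (e m).2 n w)) * (fine (P A))^-1).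
  apply/funext => n; rewrite /cond_exp Rintegral_mkcond; congr (_ / _).
  apply: eq_mean => w; rewrite patchE /p /a indicE.
  case: ifPn => _; last by rewrite mul0r.
  by rewrite !mul1r ![W n w * _ + _]addrC !subrK.
have -> : normal_rank1_expect s2ae (e m) f =
    fine (P A) * normal_rank1_expect s2ae ((e m).1, (e m).2) f * (fine (P A))^-1.
  by rewrite mulrAC divff ?gt_eqF// mul1r; case: (e m).
apply: cvgMr_tmp; apply: key => //; [by move=> n; apply: p_adapted; lia..|].
move=> dl r dl0 r0.
(* The constants of [level_residual] with the neighbouring observations frozen at [m], hence
   deterministic; [m] lists both left neighbours before both right ones. *)
pose c1 := 3 * (`|mu| + `|mu - (m.1.1.1 + m.1.2)%:R|).
pose c2 := 3 * (`|mu| + `|mu - (m.1.1.2 + m.2)%:R|).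
have c10 : 0 <= c1 by rewrite mulr_ge0// addr_ge0.
have c20 : 0 <= c2 by rewrite mulr_ge0// addr_ge0.
pose b := `|(e m).1| + `|(e m).2| + 1.
have b0 : 0 < b by rewrite ltr_wpDl// addr_ge0.
have dl20 : 0 < dl / 2 by rewrite divr_gt0.
(* Half of [dl] pays for the linear error [|e| * rho], the other half for the quadratic error, which
   vanishes with [n] once [rho <= 1] and [K] are fixed. *)
pose rho := Num.min 1 (dl / 2 / b).
have rho0 : 0 < rho by rewrite lt_min ltr01 divr_gt0.
have rho1 : rho <= 1 by rewrite ge_min lexx.
have rhob : b * rho <= dl / 2 by rewrite mulrC -ler_pdivlMr// ge_min lexx orbT.
have [K K_gt0 /(_ _ rho0)[N1 hN1]] := K0 _ r0.
have := @sqrt_invn_cvg0 R ((c1 + c2) * (K + 1) ^+ 2) 0; under eq_fun do rewrite addn0.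
move=> /cvgrPdist_le/(_ _ dl20)[N2 _ hN2].
exists (maxn 1 (maxn N1 N2)) => n; rewrite !geq_max => /and3P[n0 /hN1[bad [h1 h2 h3 h4]] /hN2 /=].
rewrite sub0r normrN => /(le_trans (ler_norm _)) hn.
exists bad; split => // w /h4[WK [a' aE' ha]].
have sn0 : 0 < Num.sqrt n%:R :> R by rewrite sqrtr_gt0 ltr0n.
rewrite /p /a indicE; case: (boolP (w \in A)) => [wA|_]; last first.
  by rewrite (_ : false%:R = 0 :> R)// !mul0r normr0 ltW.
have etaw : eta w = m by move: wA; rewrite inE.
rewrite (_ : true%:R = 1 :> R)// !mul1r.
have sum1 : (m.1.1.1 + m.1.2)%:R = y w s1.-1 + y w s1.+1 by rewrite -etaw natrD.
have sum2 : (m.1.1.2 + m.2)%:R = y w s2.-1 + y w s2.+1 by rewrite -etaw natrD.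
have em1 : (e m).1 = ((alpha ^+ 2 - 1) * (y w s1.-1 + y w s1.+1) +
    (1 + 2 * alpha - alpha ^+ 2) * mu) / (1 + alpha ^+ 2) ^+ 2 by rewrite -sum1; case: (m) => [[[]]].
have em2 : (e m).2 = ((alpha ^+ 2 - 1) * (y w s2.-1 + y w s2.+1) +
    (1 + 2 * alpha - alpha ^+ 2) * mu) / (1 + alpha ^+ 2) ^+ 2 by rewrite -sum2; case: (m) => [[[]]].
have r1 := level_residual mu (y w) s1 sn0 erefl WK ha.
have r2 := level_residual mu (y w) s2 sn0 erefl WK ha.
rewrite -em1 -sum1 -/c1 sum1 in r1; rewrite -em2 -sum2 -/c2 sum2 in r2.
have bound c0 : 0 <= c0 -> c0 <= c1 + c2 -> c0 * (K + rho) ^+ 2 / Num.sqrt n%:R <= dl / 2.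
  move=> c00 c0c; apply: le_trans hn; rewrite ler_pM2r ?invr_gt0//.
  apply: ler_pM => //; first exact: sqr_ge0.
  by rewrite lerXn2r// ?nnegrE ?addr_ge0 ?lerD2l// ltW.
have b1 := bound c1 c10; have b2 := bound c2 c20.
have e1b : `|(e m).1| * rho <= dl / 2.
  by apply: le_trans rhob; rewrite ler_pM2r// /b -addrA lerDl addr_ge0.
have e2b : `|(e m).2| * rho <= dl / 2.
  by apply: le_trans rhob; rewrite ler_pM2r// /b -addrA addrCA lerDl addr_ge0.
rewrite /est aE' /= (splitr dl); split.
  by apply: le_trans r1 (lerD e1b (b1 _)); rewrite lerDl.
by apply: le_trans r2 (lerD e2b (b2 _)); rewrite lerDr.
Qed.
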